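(* Let $N\ge1$ and let $\xi(\tau)=\{\xi^{(n)}_k(\tau)\}_{1\le k\le n\le N}$, $\tau>0$, be the Gaussian vectors defined in the context (with all $a_i=1$). For any fixed $T>0$ the limit $$\zeta^{(n)}_k(T)=\lim_{L\to\infty}L^{-1/2}\xi^{(n)}_k(LT)$$ exists (in distribution, jointly for $1\le k\le n\le N$), and $\zeta=\{\zeta^{(n)}_k(T):1\le k\le n\le N\}$ is centered Gaussian with covariance given through the following formula: for $N\ge n_1\ge n_2\ge1$ and $1\le r_i\le n_i$, $$\mathrm{Cov}\Big(\zeta^{(n_1)}_{n_1}(T)+\cdots+\zeta^{(n_1)}_{n_1-r_1+1}(T);\ \zeta^{(n_2)}_{n_2}(T)+\cdots+\zeta^{(n_2)}_{n_2-r_2+1}(T)\Big)$$ $$=\frac{\oint\oint\sum_{k=1}^{r_1}\sum_{\ell=1}^{r_2}\frac1{z_k-w_\ell}\Big(\prod_{1\le i<j\le r_1}(z_j-z_i)^2\prod_{m=1}^{r_1}\frac{e^{Tz_m}}{(z_m)^{n_1}}dz_m\Big)\Big(\prod_{1\le i<j\le r_2}(w_j-w_i)^2\prod_{m=1}^{r_2}\frac{e^{Tw_m}}{(w_m)^{n_2}}dw_m\Big)}{\Big(\oint\prod_{1\le i<j\le r_1}(z_j-z_i)^2\prod_{m=1}^{r_1}\frac{e^{Tz_m}}{(z_m)^{n_1}}dz_m\Big)\Big(\oint\prod_{1\le i<j\le r_2}(w_j-w_i)^2\prod_{m=1}^{r_2}\frac{e^{Tw_m}}{(w_m)^{n_2}}dw_m\Big)},$$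 where the integrals are around $0$ and the $z$-contours contain the $w$-contours.
   Context: For each $\tau>0$, $\xi(\tau)=\{\xi^{(n)}_k(\tau)\}_{1\le k\le n\le N}$ is the centered Gaussian vector (arising as the limit of rescaled fluctuations of the Plancherel $q$-Whittaker process with $a_1=\dots=a_N=1$ as $q\to1$) whose covariance is determined, for $n_1\ge n_2$ and $1\le r_i\le n_i$, by $$\mathrm{Cov}\Big(\sum_{j=n_1-r_1+1}^{n_1}\xi^{(n_1)}_j(\tau);\sum_{j=n_2-r_2+1}^{n_2}\xi^{(n_2)}_j(\tau)\Big)=\frac{\oint\oint\Big(-\sum_{k=1}^{r_1}\sum_{\ell=1}^{r_2}\frac{z_{1,k}}{z_{1,k}-z_{2,\ell}}\Big)\mathfrak{F}(n_1,r_1,\vec z_1)\mathfrak{F}(n_2,r_2,\vec z_2)\,d\vec z_1d\vec z_2}{\oint\mathfrak{F}(n_1,r_1,\vec z_1)d\vec z_1\oint\mathfrak{F}(n_2,r_2,\vec z_2)d\vec z_2},$$ $$\mathfrak{F}(n,r,\vec z)=\frac{(-1)^{\frac{r(r+1)}2}\prod_{1\le k<\ell\le r}(z_k-z_\ell)^2}{(2\pi\mathrm{i})^r\,r!\prod_{k=1}^r(z_k)^r}\prod_{k=1}^r\frac{e^{-z_k\tau}}{(1-z_k)^n},$$ where $\vec z_i=(z_{i,k})_{k=1}^{r_i}$, $d\vec z_i=\prod_kdz_{i,k}$, all contours are counterclockwise simple loops enclosing $1$ but not $0$, and the contours of the $z_{1,k}$ enclose those of the $z_{2,\ell}$. *)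

(* Defs.v *)
From HB Require Import structures.
From mathcomp Require Import all_boot all_order all_algebra.
From mathcomp Require Import complex.
From mathcomp Require Import all_classical all_reals all_analysis.

Set Implicit Arguments.
Unset Strict Implicit.
Unset Printing Implicit Defensive.

Import Order.TTheory GRing.Theory Num.Theory.
Import numFieldNormedType.Exports.

Local Open Scope classical_set_scope.
Local Open Scope ring_scope.

Definition cexp (R : realType) (z : R[i]) : R[i] :=
  Complex (expR (complex.Re z) * cos (complex.Im z))
          (expR (complex.Re z) * sin (complex.Im z)).

(* A contour is a map [R -> R[i]] of which only the values on [[0, 1]] matter.
   Smoothness is required on the whole of [R] for convenience: a C^1 map on
   [[0, 1]] with one-sided derivatives at the ends extends to a C^1 map on
   [R].  The velocity may vanish, so every piecewise C^1 loop has such a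
   parametrization. *)

Definition velocity (R : realType) (g : R -> R[i]) (t : R) : R[i] :=
  Complex (derive1 (fun s => complex.Re (g s)) t)
          (derive1 (fun s => complex.Im (g s)) t).

Definition simple_loop (R : realType) (g : R -> R[i]) : Prop :=
  [/\ (forall t : R, derivable (fun s => complex.Re (g s)) t 1) /\
        continuous (derive1 (fun s : R => complex.Re (g s))),
      (forall t : R, derivable (fun s => complex.Im (g s)) t 1) /\
        continuous (derive1 (fun s : R => complex.Im (g s))),
      g 0 = g 1 &
      forall s t : R, 0 <= s < 1 -> 0 <= t < 1 -> g s = g t -> s = t].

Definition cintegral (R : realType) (g : R -> R[i]) (f : R[i] -> R[i]) : R[i] :=
  Complex
    (Rintegral lebesgue_measure `[0, 1]
       (fun t => complex.Re (f (g t) * velocity g t)))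
    (Rintegral lebesgue_measure `[0, 1]
       (fun t => complex.Im (f (g t) * velocity g t))).

Definition two_pi_i (R : realType) : R[i] := Complex 0 (2 * pi).

Definition winding (R : realType) (g : R -> R[i]) (p : R[i]) : R[i] :=
  cintegral g (fun z => (z - p)^-1) / two_pi_i R.

(* A simple loop has winding number 1 exactly around the points of its interior
   when it is counterclockwise, and 0 around the points of its exterior. *)
Definition encloses (R : realType) (g : R -> R[i]) (p : R[i]) : Prop :=
  (forall t : R, 0 <= t <= 1 -> g t <> p) /\ winding g p = 1.

Definition excludes (R : realType) (g : R -> R[i]) (p : R[i]) : Prop :=
  (forall t : R, 0 <= t <= 1 -> g t <> p) /\ winding g p = 0.

Definition encloses_loop (R : realType) (g h : R -> R[i]) : Prop :=
  forall t : R, 0 <= t <= 1 -> encloses g (h t).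

Definition fcons (A : Type) (r : nat) (x : A) (v : 'I_r -> A) : 'I_r.+1 -> A :=
  fun i => if unlift ord0 i is Some j then v j else x.

(* Iterated integral, in which the variable [z i] runs over the contour [g i]. *)
Fixpoint mcintegral (R : realType) (r : nat) :
    ('I_r -> R -> R[i]) -> (('I_r -> R[i]) -> R[i]) -> R[i] :=
  match r with
  | 0 => fun _ f => f (fun _ => 0)
  | r'.+1 => fun g f =>
      cintegral (g ord0) (fun z =>
        mcintegral (fun i => g (lift ord0 i)) (fun zs => f (fcons z zs)))
  end.

Definition sq_vandermonde (R : realType) (r : nat) (z : 'I_r -> R[i]) : R[i] :=
  \prod_(k < r) \prod_(l < r | (k < l)%N) (z k - z l) ^+ 2.

Definition frakF (R : realType) (tau : R) (n r : nat) (z : 'I_r -> R[i]) : R[i] :=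
  (-1) ^+ (r * r.+1)./2 * sq_vandermonde z
    / (two_pi_i R ^+ r * (r`!)%:R * \prod_(k < r) z k ^+ r)
  * \prod_(k < r) (cexp (- (z k * real_complex R tau)) / (1 - z k) ^+ n).

Definition xi_contours (R : realType) (r1 r2 : nat)
    (g1 : 'I_r1 -> R -> R[i]) (g2 : 'I_r2 -> R -> R[i]) : Prop :=
  [/\ forall k, [/\ simple_loop (g1 k), encloses (g1 k) 1 & excludes (g1 k) 0],
      forall l, [/\ simple_loop (g2 l), encloses (g2 l) 1 & excludes (g2 l) 0] &
      forall k l, encloses_loop (g1 k) (g2 l)].

Definition xi_cov (R : realType) (tau : R) (n1 r1 n2 r2 : nat)
    (g1 : 'I_r1 -> R -> R[i]) (g2 : 'I_r2 -> R -> R[i]) : R[i] :=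
  mcintegral g1 (fun z => mcintegral g2 (fun w =>
    - (\sum_(k < r1) \sum_(l < r2) z k / (z k - w l))
    * frakF tau n1 z * frakF tau n2 w))
  / (mcintegral g1 (fun z => frakF tau n1 z)
     * mcintegral g2 (fun w => frakF tau n2 w)).

Definition zeta_weight (R : realType) (T : R) (n r : nat) (z : 'I_r -> R[i]) :
    R[i] :=
  sq_vandermonde z * \prod_(m < r) (cexp (real_complex R T * z m) / z m ^+ n).

Definition zeta_contours (R : realType) (r1 r2 : nat)
    (g1 : 'I_r1 -> R -> R[i]) (g2 : 'I_r2 -> R -> R[i]) : Prop :=
  [/\ forall k, simple_loop (g1 k) /\ encloses (g1 k) 0,
      forall l, simple_loop (g2 l) /\ encloses (g2 l) 0 &
      forall k l, encloses_loop (g1 k) (g2 l)].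

Definition zeta_cov (R : realType) (T : R) (n1 r1 n2 r2 : nat)
    (g1 : 'I_r1 -> R -> R[i]) (g2 : 'I_r2 -> R -> R[i]) : R[i] :=
  mcintegral g1 (fun z => mcintegral g2 (fun w =>
    (\sum_(k < r1) \sum_(l < r2) (z k - w l)^-1)
    * zeta_weight T n1 z * zeta_weight T n2 w))
  / (mcintegral g1 (fun z => zeta_weight T n1 z)
     * mcintegral g2 (fun w => zeta_weight T n2 w)).

(* Pairs [(n, k)] with [1 <= k <= n <= N]. *)
Definition tri (N : nat) : finType :=
  {p : 'I_N.+1 * 'I_N.+1 | (0 < p.2 <= p.1)%N}.

Definition level (N : nat) (p : tri N) : nat := (val p).1.
Definition rank_in_level (N : nat) (p : tri N) : nat := (val p).2.

(* [X^(n)_(n-r+1) + ... + X^(n)_n] *)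
Definition top_sum (R : realType) (N : nat) (W : Type) (X : tri N -> W -> R)
    (n r : nat) : W -> R :=
  fun w => \sum_(p : tri N | (level p == n) && (n - r < rank_in_level p)%N) X p w.

(* The library's [normal_prob m 0] is a uniform law, hence the case split. *)
Definition normal_law (R : realType) (m s : R) (A : set R) : \bar R :=
  if s == 0 then \d_m A else normal_prob m s A.

Definition gaussian_vector (R : realType) (I : finType) (d : measure_display)
    (W : measurableType d) (P : probability W R) (X : I -> {RV P >-> R}) : Prop :=
  forall a : I -> R, exists m s : R, forall A : set R, measurable A ->
    P ((fun w => \sum_i a i * X i w) @^-1` A) = normal_law m s A.

Definition centered (R : realType) (I : finType) (d : measure_display)
    (W : measurableType d) (P : probability W R) (X : I -> {RV P >-> R}) : Prop :=
  forall i : I, 'E_P[X i]%E = 0%E.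

(* Convergence in distribution of [I]-indexed random vectors as the parameter
   tends to [+oo]; the vectors may live on different probability spaces. *)
Definition cvg_in_distribution (R : realType) (I : finType)
    (d : R -> measure_display) (W : forall L, measurableType (d L))
    (P : forall L, probability (W L) R) (X : forall L, I -> W L -> R)
    (d' : measure_display) (W' : measurableType d') (Q : probability W' R)
    (Y : I -> W' -> R) : Prop :=
  forall f : {ptws I -> R} -> R,
    continuous f -> (exists M : R, forall x, `|f x| <= M) ->
    ('E_(P L)[fun w => f (fun i => X L i w)])%E @[L --> +oo]
      --> ('E_Q[fun w => f (fun i => Y i w)])%E.

(* Main.v *)
Require Import Defs.
From HB Require Import structures.
From mathcomp Require Import all_boot all_order all_algebra.
From mathcomp Require Import fingroup perm.
From mathcomp Require Import complex.
From mathcomp Require Import all_classical all_reals all_analysis.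
From mathcomp Require Import measurable_realfun.
From mathcomp Require Import zify ring lra.

Set Implicit Arguments.
Unset Strict Implicit.
Unset Printing Implicit Defensive.

Import Order.TTheory GRing.Theory Num.Theory.
Import numFieldNormedType.Exports.

Local Open Scope classical_set_scope.
Local Open Scope ring_scope.


(** The proof has a contour part, which gives the convergence of the
covariances, and a probabilistic part, which turns it into the convergence of
the vectors.

The covariance of [xi (L T)] can be computed on small circles around 1, with
[|1 - z| = 2 / L] and [|1 - w| = 1 / L]. In the coordinates [z = 1 - u / L] and
[w = 1 - v / L] the factor [exp (- L T z) / (1 - z) ^ n] becomes
[exp (T u) / u ^ n] up to a constant, [z ^ - r] becomes [(1 - u / L) ^ - r], and
the kernel [- z / (z - w)] becomes [L (1 - u / L) / (u - v)]. The constants cancel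
between numerator and denominator, so that the covariance is [L] times a
function of [1 / L] ([xi_cov_circ]), which is continuous at 0, where its value is
the asserted formula on the circles [|u| = 2] and [|v| = 1] ([eps_cov_ccont],
[eps_cov0]). The quotients make sense because the denominators do not vanish:
by the expansion of the squared Vandermonde determinant, such a denominator is
[r!] times a Hankel determinant of residues of [exp (T z) z ^ (i + j - n)], which
reduces to a Vandermonde determinant ([hankel_exp_residue_neq0]).

The formula is asserted for all admissible contours, and these are only known
through winding numbers. The same expansion writes both sides of the quotient
as finite sums of integrals in at most two variables ([zeta_covE]). In one
variable, the integrals of [z ^ m exp (T z)] satisfy a recursion in [m], because
derivatives integrate to 0, which starts from the winding number
([cintegral_laurent_exp]). In two variables, the identity
[z / (z - w) = 1 + w / (z - w)] lowers the power of [z] until the integral in [z] is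
Cauchy's formula for the exponential ([cauchy_double_universal]). Cauchy's
formula itself and the winding numbers of circles come from explicit
deformations ([cintegral_deformation]).

Only covariances of sums of top coordinates are prescribed, but a coordinate
is a difference of two consecutive sums, so that all covariances converge
([top_form_coord]). The characteristic function of a centered Gaussian vector
is a continuous function of its covariance matrix ([gaussian_family_cos],
[gauss_cos_continuous]); hence the characteristic functions converge, and a
bound on the second moments turns this into convergence in distribution
([cvg_in_distribution_cos]): Bernstein polynomials in the sines of the
coordinates are trigonometric polynomials that approximate a bounded
continuous function on large cubes. The limit vector has to be produced on
some probability space. The rank of a positive semidefinite matrix can only
drop in a limit, so that the limiting covariance matrix is [A S A^T] for the
covariance matrix [S] of the rescaled [xi (L T)] at one large [L], and [A] applied
to that vector is a limit vector ([psd_limit], [gaussian_limit]). *)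
(** * Real integrals over the unit interval *)

Lemma continuous_for_pair (U V W : topologicalType) (f : U -> V) (g : U -> W)
    (x : U) : {for x, continuous f} -> {for x, continuous g} ->
  {for x, continuous (fun y => (f y, g y))}.
Proof.
by move=> cf cg; exact: (cvg_pair (F := nbhs x) (G := nbhs (f x)) (H := nbhs (g x))).
Qed.

Section UnitInterval.
Variable R : realType.
Implicit Types f g F : R -> R.

Definition int01 f : R := Rintegral lebesgue_measure `[0, 1] f.

Lemma continuous_within01 f :
  (forall t : R, 0 <= t <= 1 -> {for t, continuous f}) ->
  {within `[0%R, 1%R], continuous f}.
Proof.
move=> cf; apply: continuous_in_subspaceT => t.
by rewrite inE/= in_itv/= => /cf.
Qed.

Lemma int01_integrable f :
  (forall t : R, 0 <= t <= 1 -> {for t, continuous f}) ->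
  lebesgue_measure.-integrable `[0, 1] (EFin \o f).
Proof.
move=> /continuous_within01 cf.
by apply: continuous_compact_integrable => //; exact: segment_compact.
Qed.

Lemma eq_int01 f g : (forall t : R, 0 <= t <= 1 -> f t = g t) -> int01 f = int01 g.
Proof.
by move=> fg; apply: eq_Rintegral => t; rewrite inE/= in_itv/= => /fg.
Qed.

Lemma int01D f g :
  (forall t : R, 0 <= t <= 1 -> {for t, continuous f}) ->
  (forall t : R, 0 <= t <= 1 -> {for t, continuous g}) ->
  int01 (fun t => f t + g t) = int01 f + int01 g.
Proof. by move=> cf cg; apply: RintegralD => //; exact: int01_integrable. Qed.

Lemma int01B f g :
  (forall t : R, 0 <= t <= 1 -> {for t, continuous f}) ->
  (forall t : R, 0 <= t <= 1 -> {for t, continuous g}) ->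
  int01 (fun t => f t - g t) = int01 f - int01 g.
Proof. by move=> cf cg; apply: RintegralB => //; exact: int01_integrable. Qed.

Lemma int01Z k f :
  (forall t : R, 0 <= t <= 1 -> {for t, continuous f}) ->
  int01 (fun t => k * f t) = k * int01 f.
Proof. by move=> cf; apply: RintegralZl => //; exact: int01_integrable. Qed.

Lemma int01_cst (k : R) : int01 (fun=> k) = k.
Proof.
rewrite /int01 Rintegral_cst//= lebesgue_measure_itv/= lte_fin ltr01.
by rewrite -EFinD/= subr0 mulr1.
Qed.

Lemma int01_norm_le f (M : R) :
  (forall t : R, 0 <= t <= 1 -> {for t, continuous f}) ->
  (forall t : R, 0 <= t <= 1 -> `|f t| <= M) -> `|int01 f| <= M.
Proof.
move=> cf fM; rewrite /int01.
have intf := int01_integrable cf.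
apply: le_trans (le_normr_Rintegral _ intf) _ => //.
rewrite -[leRHS]int01_cst; apply: le_Rintegral => //.
- have := int01_integrable (f := fun t => `|f t|); apply => t t01.
  by apply: continuous_comp; [exact: cf|exact: norm_continuous].
- by apply: int01_integrable => t _; exact: cst_continuous.
Qed.

Lemma int01_FTC F f :
  (forall t : R, 0 <= t <= 1 -> is_derive t 1 F (f t)) ->
  (forall t : R, 0 <= t <= 1 -> {for t, continuous f}) ->
  int01 f = F 1 - F 0.
Proof.
move=> dF cf; rewrite /int01 /Rintegral.
have cF (t : R) : 0 <= t <= 1 -> {for t, continuous F}.
  move=> /dF[dFt _]; apply: differentiable_continuous.
  exact/derivable1_diffP.
rewrite (@continuous_FTC2 _ f F)//; first exact: continuous_within01.
- split.
  + by move=> t; rewrite in_itv/= => /andP[t0 t1]; have [] := dF t; rewrite ?ltW.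
  + by apply: cvg_at_right_filter; apply: cF; rewrite lexx ler01.
  + by apply: cvg_at_left_filter; apply: cF; rewrite lexx ler01.
- move=> t; rewrite in_itv/= => /andP[t0 t1]; rewrite derive1E.
  by have [] := dF t; rewrite ?ltW.
Qed.

(** Compactness of the interval makes the convergence of the integrands
uniform. *)
Lemma int01_continuous (U : topologicalType) (K : U -> R -> R) (u0 : U) :
  (forall t : R, 0 <= t <= 1 -> {for (u0, t), continuous (fun p => K p.1 p.2)}) ->
  (\forall u \near u0, forall t : R, 0 <= t <= 1 -> {for t, continuous (K u)}) ->
  {for u0, continuous (fun u => int01 (K u))}.
Proof.
move=> cK cKu; apply/cvgrPdist_le => e e0.
have unif : \forall u \near u0,
    `[0%R, 1%R] `<=` (fun t => `|K u0 t - K u t| <= e).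
  have := @segment_compact R 0 1; rewrite compact_near_coveringP => cov.
  apply: (cov U (nbhs u0) (fun u t => `|K u0 t - K u t| <= e)) => t /=.
  rewrite in_itv/= => t01.
  have e20 : 0 < e / 2 by rewrite divr_gt0.
  have /cvgrPdist_le/(_ _ e20) := cK t t01.
  rewrite near_simpl/= => -[[A B]/= [Au Bt] AB].
  exists (B, A) => // -[t' u]/= [Bt' Au'].
  have := AB (u, t') (conj Au' Bt').
  have := AB (u0, t') (conj (nbhs_singleton Au) Bt') => /=.
  move=> h1 h2; rewrite (_ : _ - _ =
    (K u0 t - K u t') - (K u0 t - K u0 t')); last by ring.
  by rewrite (le_trans (ler_normB _ _))// (splitr e) lerD.
have cK0 (t : R) : 0 <= t <= 1 -> {for t, continuous (K u0)}.
  by move/nbhs_singleton : cKu; exact.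
near=> u.
have cKn : forall t : R, 0 <= t <= 1 -> {for t, continuous (K u)} by near: u.
rewrite -int01B//; apply: int01_norm_le => t t01.
  by apply: cvgB; [exact: cK0|exact: cKn].
by have := near unif u; apply => //; rewrite /= in_itv.
Unshelve. all: by end_near. Qed.

(** Every open set of the plane is a countable union of boxes. *)
Lemma continuous_measurable_fun2 (K : R * R -> R) : continuous K ->
  measurable_fun [set: measurableTypeR R * measurableTypeR R] K.
Proof.
move=> cK; apply: (measurability _ (RGenOpens.measurableE R)).
move=> _ [_ [a [b ->] <-]]; rewrite setTI.
pose box (q : (rat * rat) * (rat * rat)) : set (R * R) :=
  `]ratr q.1.1, ratr q.1.2[%classic `*` `]ratr q.2.1, ratr q.2.2[%classic.
set A := K @^-1` _.
have oA : open A by apply: open_comp; [by move=> ? _; exact: cK|exact: interval_open].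
suff -> : A = \bigcup_(q in [set q | box q `<=` A]) box q.
  rewrite bigcup_mkcond; apply: countable_bigcupT_measurable => // q.
  by case: ifP => _ //; apply: measurableX; exact: measurable_itv.
apply/seteqP; split => [[x y] Axy|p [q qA]]; last exact: qA.
have [[B C]/= [Bx Cy] BC] : nbhs (x, y) A by exact: open_nbhs_nbhs.
have ex (z : R) (D : set R) : nbhs z D ->
    exists p q : rat, `]ratr p, ratr q[%classic z /\ `]ratr p, ratr q[ `<=` D.
  move=> /nbhs_ballP[e /= e0 De].
  have zl : z - e < z by rewrite ltrBlDr ltrDl.
  have zr : z < z + e by rewrite ltrDl.
  have [p pI] := rat_in_itvoo zl; have [q qI] := rat_in_itvoo zr.
  move: pI qI; rewrite !in_itv/= => /andP[p1 p2] /andP[q1 q2].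
  exists p, q; split; first by rewrite /= in_itv/= p2 q1.
  move=> t /=; rewrite in_itv/= => /andP[t1 t2]; apply: De.
  by rewrite /ball/= ltr_distlC (lt_trans p1)//= (lt_trans t2).
have [p1 [p2 [Ip IpB]]] := ex _ _ Bx.
have [q1 [q2 [Iq IqC]]] := ex _ _ Cy.
exists ((p1, p2), (q1, q2)); last by split.
move=> [s t] [/= Is It]; apply: BC; split; [exact: IpB|exact: IqC].
Qed.

Definition clamp01 (t : R) : R := Num.max 0 (Num.min 1 t).

Lemma clamp01_itv t : 0 <= clamp01 t <= 1.
Proof. by rewrite /clamp01 le_max lexx/= ge_max ler01 ge_min lexx. Qed.

Lemma clamp01_id t : 0 <= t <= 1 -> clamp01 t = t.
Proof. by case/andP=> t0 t1; rewrite /clamp01 min_r// max_r. Qed.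

Lemma clamp01_continuous : continuous clamp01.
Proof.
move=> t; apply: continuous_max; first exact: cst_continuous.
apply: continuous_min; first exact: cst_continuous.
exact: cvg_id.
Qed.

(** Clamping both variables to the interval extends the integrand to a bounded
continuous function on the plane, to which Fubini's theorem for Lebesgue
measure applies. *)
Lemma int01_Fubini (K : R -> R -> R) :
  (forall s t : R, 0 <= s <= 1 -> 0 <= t <= 1 ->
     {for (s, t), continuous (fun p => K p.1 p.2)}) ->
  int01 (fun s => int01 (K s)) = int01 (fun t => int01 (fun s => K s t)).
Proof.
move=> cK.
pose Kc (p : R * R) := K (clamp01 p.1) (clamp01 p.2).
have cKc : continuous Kc.
  move=> [s t]; rewrite /Kc.
  apply: (@continuous_comp _ _ _ (fun p : R * R => (clamp01 p.1, clamp01 p.2))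
    (fun p => K p.1 p.2)); last by apply: cK => /=; exact: clamp01_itv.
  apply: continuous_for_pair.
    by apply: continuous_comp; [exact: cvg_fst|exact: clamp01_continuous].
  by apply: continuous_comp; [exact: cvg_snd|exact: clamp01_continuous].
have [M KcM] : exists M, forall p, `|Kc p| <= M.
  have cS : compact (`[0%R, 1%R]%classic `*` `[0%R, 1%R]%classic : set (R * R)).
    by apply: compact_setX; exact: segment_compact.
  have := compact_bounded (continuous_compact (continuous_subspaceT cKc) cS).
  move=> [M [_ /(_ (M + 1))]]; rewrite ltrDl ltr01 => /(_ isT) KM.
  exists (M + 1) => p; have -> : Kc p = Kc (clamp01 p.1, clamp01 p.2).
    by rewrite /Kc/= !(clamp01_id (clamp01_itv _)).
  by apply: KM => /=; exists (clamp01 p.1, clamp01 p.2) => //;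
    split; rewrite /= in_itv/= clamp01_itv.
pose mu := @lebesgue_measure R.
pose I := (`[0%R, 1%R]%classic : set R).
pose f (p : measurableTypeR R * measurableTypeR R) : \bar R :=
  (Kc p * (\1_I p.1 * \1_I p.2))%:E.
have mI : measurable_fun [set: measurableTypeR R] (\1_I : R -> R).
  by apply: measurable_indic; exact: measurable_itv.
have mI1 : measurable_fun [set: measurableTypeR R * measurableTypeR R]
    (fun p => \1_I p.1 * \1_I p.2 : R).
  apply: measurable_funM.
    by apply: (measurableT_comp mI); exact: measurable_fst.
  by apply: (measurableT_comp mI); exact: measurable_snd.
have mf : measurable_fun setT f.
  apply/measurable_EFinP; apply: measurable_funM => //.
  exact: continuous_measurable_fun2.
have intE (x : R) (h : R -> R) :
    (\int[mu]_y (h y * \1_I y)%:E = \int[mu]_(y in I) (h y)%:E)%E.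
  rewrite [RHS]integral_mkcond; apply: eq_integral => y _.
  by rewrite patchE indicE; case: ifPn; rewrite ?mulr1 ?mulr0.
have mu1 (k : R) : (\int[mu]_(y in I) k%:E = k%:E)%E.
  rewrite integral_cst//=; last exact: measurable_itv.
  by rewrite /I lebesgue_measure_itv/= lte_fin ltr01 -EFinD subr0 mule1.
have intf : (mu \x mu)%E.-integrable setT f.
  apply/(integrable12ltyP mu mu mf).
  apply: (@le_lt_trans _ _ (\int[mu]_x ((M * \1_I x)%:E))%E).
    apply: ge0_le_integral => //.
    - by move=> x _; exact: integral_ge0.
    - have mnf : measurable_fun setT (fun p => `|f p|%E) by exact: measurableT_comp.
      by have := measurable_fun_fubini_tonelli_F (m2 := mu) _ mnf (fun p => abse_ge0 (f p)).
    - by apply/measurable_EFinP; apply: measurable_funM => //; exact: mI.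
    move=> x _; rewrite [leRHS](_ : _ = \int[mu]_y ((M * \1_I x) * \1_I y)%:E)%E.
      apply: ge0_le_integral => //.
      - by apply: measurableT_comp => //; exact: (measurableT_comp mf).
      - by apply/measurable_EFinP; apply: measurable_funM => //; exact: mI.
      move=> y _; rewrite /f abse_EFin lee_fin normrM -mulrA.
      rewrite [`|_ * _|]ger0_norm; last by rewrite mulr_ge0 // indicE ler0n.
      by rewrite ler_wpM2r // mulr_ge0 // indicE ler0n.
    by rewrite (intE x (fun=> M * \1_I x)) mu1.
  by rewrite (intE 0 (fun=> M)) mu1 ltry.
have KE s t : 0 <= s <= 1 -> 0 <= t <= 1 -> K s t = Kc (s, t).
  by move=> s01 t01; rewrite /Kc/= !clamp01_id.
have cKc1 (s : R) t : {for t, continuous (fun t => Kc (s, t))}.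
  apply: (@continuous_comp _ _ _ (fun t => (s, t)) Kc); last exact: cKc.
  by apply: continuous_for_pair; [exact: cvg_cst|exact: cvg_id].
have cKc2 (t : R) s : {for s, continuous (fun s => Kc (s, t))}.
  apply: (@continuous_comp _ _ _ (fun s => (s, t)) Kc); last exact: cKc.
  by apply: continuous_for_pair; [exact: cvg_id|exact: cvg_cst].
have finE h : (forall t, {for t, continuous h}) ->
    (\int[mu]_(y in I) (h y)%:E = (int01 h)%:E)%E.
  move=> ch; rewrite /int01 /Rintegral fineK//; apply: integrable_fin_num => //.
  by apply: int01_integrable.
transitivity (int01 (fun s => int01 (fun t => Kc (s, t)))).
  by apply: eq_int01 => s s01; apply: eq_int01 => t t01; rewrite KE.
transitivity (int01 (fun t => int01 (fun s => Kc (s, t)))); last first.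
  by apply: eq_int01 => s s01; apply: eq_int01 => t t01; rewrite KE.
have := Fubini intf; rewrite /f /=.
have -> : (\int[mu]_x \int[mu]_y (Kc (x, y) * (\1_I x * \1_I y))%:E =
    \int[mu]_(x in I) (int01 (fun t => Kc (x, t)))%:E)%E.
  rewrite -(intE 0); apply: eq_integral => x _.
  under eq_integral do rewrite mulrA.
  rewrite (intE 0 (fun y => Kc (x, y) * \1_I x)) finE.
    congr (_%:E); under [in LHS]eq_int01 do rewrite mulrC.
    by rewrite int01Z// mulrC.
  by move=> t; apply: cvgM; [exact: cKc1|exact: cvg_cst].
have -> : (\int[mu]_y \int[mu]_x (Kc (x, y) * (\1_I x * \1_I y))%:E =
    \int[mu]_(y in I) (int01 (fun s => Kc (s, y)))%:E)%E.
  rewrite -(intE 0); apply: eq_integral => y _.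
  under eq_integral do rewrite [\1_I _ * _]mulrC mulrA.
  rewrite (intE 0 (fun x => Kc (x, y) * \1_I y)) finE.
    congr (_%:E); under [in LHS]eq_int01 do rewrite mulrC.
    by rewrite int01Z// mulrC.
  by move=> t; apply: cvgM; [exact: cKc2|exact: cvg_cst].
by rewrite /int01 /Rintegral => ->.
Qed.

End UnitInterval.

(** * Limits and derivatives of complex-valued functions, componentwise *)

Section ComplexParts.
Variable R : realType.
Implicit Types x y : R[i].
Local Notation Re := complex.Re.
Local Notation Im := complex.Im.

Lemma complex_eq x y : Re x = Re y -> Im x = Im y -> x = y.
Proof. by case: x y => a b [c d] /= -> ->. Qed.

Lemma ReD x y : Re (x + y) = Re x + Re y. Proof. by case: x y => a b []. Qed.
Lemma ImD x y : Im (x + y) = Im x + Im y. Proof. by case: x y => a b []. Qed.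
Lemma ReN x : Re (- x) = - Re x. Proof. by case: x. Qed.
Lemma ImN x : Im (- x) = - Im x. Proof. by case: x. Qed.
Lemma ReM x y : Re (x * y) = Re x * Re y - Im x * Im y.
Proof. by case: x y => a b []. Qed.
Lemma ImM x y : Im (x * y) = Re x * Im y + Im x * Re y.
Proof. by case: x y => a b []. Qed.
Lemma ReV x : Re x^-1 = Re x / (Re x ^+ 2 + Im x ^+ 2).
Proof. by case: x. Qed.
Lemma ImV x : Im x^-1 = - (Im x / (Re x ^+ 2 + Im x ^+ 2)).
Proof. by case: x. Qed.

Lemma sqr_parts_neq0 x : x != 0 -> Re x ^+ 2 + Im x ^+ 2 != 0.
Proof.
case: x => a b; apply: contraNneq => /= /eqP.
by rewrite paddr_eq0 ?sqr_ge0// !sqrf_eq0 eq_complex.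
Qed.

Lemma cexpD x y : cexp (x + y) = cexp x * cexp y.
Proof.
apply: complex_eq; rewrite ?ReM ?ImM /= ReD ImD expRD ?cosD ?sinD; ring.
Qed.

Lemma cexp0 : cexp (0 : R[i]) = 1.
Proof. by apply: complex_eq; rewrite /= expR0 ?cos0 ?sin0 ?mulr1 ?mulr0. Qed.

Lemma cexp_neq0 x : cexp x != 0.
Proof.
apply/eqP => ex; have /eqP := cexpD x (- x).
by rewrite subrr cexp0 ex mul0r oner_eq0.
Qed.

Lemma two_pi_i_neq0 : two_pi_i R != 0.
Proof. by rewrite eq_complex /= eqxx mulf_eq0 pnatr_eq0/= gt_eqF// pi_gt0. Qed.

End ComplexParts.

Section ComplexLimits.
Variable R : realType.
Local Notation Re := complex.Re.
Local Notation Im := complex.Im.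

Definition ccvg (T : Type) (F : set_system T) (f : T -> R[i]) (l : R[i]) :=
  (Re (f x) @[x --> F] --> Re l) /\ (Im (f x) @[x --> F] --> Im l).

Section Filter.
Context (T : Type) (F : set_system T) {FF : Filter F}.
Implicit Types f g : T -> R[i].

Lemma ccvg_cst l : ccvg F (fun=> l) l.
Proof. by split; exact: cvg_cst. Qed.

Lemma ccvgD f g a b : ccvg F f a -> ccvg F g b -> ccvg F (fun x => f x + g x) (a + b).
Proof.
move=> [f1 f2] [g1 g2]; split; rewrite ?ReD ?ImD.
- by under eq_fun do rewrite ReD; exact: cvgD.
- by under eq_fun do rewrite ImD; exact: cvgD.
Qed.

Lemma ccvgN f a : ccvg F f a -> ccvg F (fun x => - f x) (- a).
Proof.
move=> [f1 f2]; split; rewrite ?ReN ?ImN.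
- by under eq_fun do rewrite ReN; exact: cvgN.
- by under eq_fun do rewrite ImN; exact: cvgN.
Qed.

Lemma ccvgB f g a b : ccvg F f a -> ccvg F g b -> ccvg F (fun x => f x - g x) (a - b).
Proof. by move=> fa gb; apply: ccvgD => //; exact: ccvgN. Qed.

Lemma ccvgM f g a b : ccvg F f a -> ccvg F g b -> ccvg F (fun x => f x * g x) (a * b).
Proof.
move=> [f1 f2] [g1 g2]; split; rewrite ?ReM ?ImM.
- by under eq_fun do rewrite ReM; apply: cvgB; exact: cvgM.
- by under eq_fun do rewrite ImM; apply: cvgD; exact: cvgM.
Qed.

Lemma ccvgV f a : a != 0 -> ccvg F f a -> ccvg F (fun x => (f x)^-1) a^-1.
Proof.
move=> /sqr_parts_neq0 a0 [f1 f2].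
have n2 : (Re (f x) ^+ 2 + Im (f x) ^+ 2)^-1 @[x --> F] -->
    (Re a ^+ 2 + Im a ^+ 2)^-1.
  by apply: cvgV => //; apply: cvgD; exact: cvgM.
split; rewrite ?ReV ?ImV.
- by under eq_fun do rewrite ReV; exact: cvgM.
- by under eq_fun do rewrite ImV; apply: cvgN; exact: cvgM.
Qed.

Lemma ccvgX f a n : ccvg F f a -> ccvg F (fun x => f x ^+ n) (a ^+ n).
Proof.
move=> fa; elim: n => [|n ih]; first by rewrite expr0; exact: ccvg_cst.
by rewrite exprS; under [f in ccvg _ f]eq_fun do rewrite exprS; exact: ccvgM.
Qed.

Lemma ccvg_cexp f a : ccvg F f a -> ccvg F (fun x => cexp (f x)) (cexp a).
Proof.
move=> [f1 f2]; split => /=; apply: cvgM.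
- by apply: continuous_cvg f1; exact: continuous_expR.
- by apply: continuous_cvg f2; exact: continuous_cos.
- by apply: continuous_cvg f1; exact: continuous_expR.
- by apply: continuous_cvg f2; exact: continuous_sin.
Qed.

Lemma ccvg_sum (I : Type) (r : seq I) (P : pred I) (f : I -> T -> R[i])
    (a : I -> R[i]) : (forall i, P i -> ccvg F (f i) (a i)) ->
  ccvg F (fun x => \sum_(i <- r | P i) f i x) (\sum_(i <- r | P i) a i).
Proof.
move=> fa; elim: r => [|i r ih].
  by rewrite big_nil; under [f in ccvg _ f]eq_fun do rewrite big_nil; exact: ccvg_cst.
rewrite big_cons; under [f in ccvg _ f]eq_fun do rewrite big_cons.
by case: ifP => // Pi; apply: ccvgD => //; exact: fa.
Qed.

Lemma ccvg_prod (I : Type) (r : seq I) (P : pred I) (f : I -> T -> R[i])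
    (a : I -> R[i]) : (forall i, P i -> ccvg F (f i) (a i)) ->
  ccvg F (fun x => \prod_(i <- r | P i) f i x) (\prod_(i <- r | P i) a i).
Proof.
move=> fa; elim: r => [|i r ih].
  by rewrite big_nil; under [f in ccvg _ f]eq_fun do rewrite big_nil; exact: ccvg_cst.
rewrite big_cons; under [f in ccvg _ f]eq_fun do rewrite big_cons.
by case: ifP => // Pi; apply: ccvgM => //; exact: fa.
Qed.

End Filter.

Definition ccont (U : topologicalType) (f : U -> R[i]) (x : U) :=
  ccvg (nbhs x) f (f x).

Lemma ccvg_comp (T : Type) (F : set_system T) (U : topologicalType) (h : T -> U)
    (u : U) (f : U -> R[i]) : Filter F ->
  h x @[x --> F] --> u -> ccont f u -> ccvg F (fun x => f (h x)) (f u).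
Proof.
move=> FF hu [f1 f2]; split; first exact: cvg_trans (cvg_app _ hu) f1.
exact: cvg_trans (cvg_app _ hu) f2.
Qed.

Lemma ccont_comp (U V : topologicalType) (h : V -> U) (f : U -> R[i]) (x : V) :
  {for x, continuous h} -> ccont f (h x) -> ccont (fun x => f (h x)) x.
Proof. by move=> ch cf; exact: (ccvg_comp _ ch cf). Qed.

Lemma ccont_fst (U V : topologicalType) (f : U -> R[i]) (p : U * V) :
  ccont f p.1 -> ccvg (nbhs p) (fun q => f q.1) (f p.1).
Proof. by apply: (@ccont_comp _ _ fst); exact: cvg_fst. Qed.

Lemma ccont_snd (U V : topologicalType) (f : V -> R[i]) (p : U * V) :
  ccont f p.2 -> ccvg (nbhs p) (fun q => f q.2) (f p.2).
Proof. by apply: (@ccont_comp _ _ snd); exact: cvg_snd. Qed.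

(** [cder f t v]: the curve [f] has velocity [v] at time [t]. *)
Definition cder (f : R -> R[i]) (t : R) (v : R[i]) :=
  is_derive t 1 (fun s => Re (f s)) (Re v) /\
  is_derive t 1 (fun s => Im (f s)) (Im v).

Section Derivatives.
Implicit Types (f g : R -> R[i]) (t : R) (v w : R[i]).

Lemma cder_ccont f t v : cder f t v -> ccont f t.
Proof.
move=> [[d1 _] [d2 _]]; split; apply: differentiable_continuous;
  exact/derivable1_diffP.
Qed.

Lemma cder_eq f t v w : cder f t v -> v = w -> cder f t w.
Proof. by move=> fv <-. Qed.

Lemma cder_cst c t : cder (fun=> c) t 0.
Proof. by split; exact: is_derive_cst. Qed.

Lemma cder_real t : cder (real_complex R) t 1.
Proof. by split => /=; [exact: is_derive_id|exact: is_derive_cst]. Qed.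

Lemma cderD f g t v w : cder f t v -> cder g t w ->
  cder (fun s => f s + g s) t (v + w).
Proof.
move=> [f1 f2] [g1 g2]; split; rewrite ?ReD ?ImD.
- by under eq_fun do rewrite ReD; exact: is_deriveD.
- by under eq_fun do rewrite ImD; exact: is_deriveD.
Qed.

Lemma cderN f t v : cder f t v -> cder (fun s => - f s) t (- v).
Proof.
move=> [f1 f2]; split; rewrite ?ReN ?ImN.
- by under eq_fun do rewrite ReN; exact: is_deriveN.
- by under eq_fun do rewrite ImN; exact: is_deriveN.
Qed.

Lemma cderB f g t v w : cder f t v -> cder g t w ->
  cder (fun s => f s - g s) t (v - w).
Proof. by move=> fv gw; apply: cderD => //; exact: cderN. Qed.

Lemma cderM f g t v w : cder f t v -> cder g t w ->
  cder (fun s => f s * g s) t (v * g t + f t * w).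
Proof.
move=> [f1 f2] [g1 g2]; split.
- under eq_fun do rewrite ReM.
  apply: is_derive_eq.
  by rewrite ReD !ReM /GRing.scale/=; ring.
- under eq_fun do rewrite ImM.
  apply: is_derive_eq.
  by rewrite ImD !ImM /GRing.scale/=; ring.
Qed.

Lemma cderV f t v : f t != 0 -> cder f t v ->
  cder (fun s => (f s)^-1) t (- v / f t ^+ 2).
Proof.
move=> ft0 [f1 f2]; have n0 := sqr_parts_neq0 ft0.
have dn : is_derive t 1 (fun s => (Re (f s) ^+ 2 + Im (f s) ^+ 2)^-1)
    (- (Re (f t) ^+ 2 + Im (f t) ^+ 2) ^- 2 *:
      (2 * Re (f t) * Re v + 2 * Im (f t) * Im v)).
  apply: is_deriveV => //.
  apply: is_derive_eq.
  by rewrite /GRing.scale/= ?expr1 ?mulr_natl; ring.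
have n0' : Re (f t) * Re (f t) + Im (f t) * Im (f t) != 0 by rewrite -!expr2.
split.
- under eq_fun do rewrite ReV.
  apply: is_derive_eq.
  rewrite expr2 ReM ReV ImV ReN ImN !ReM !ImM /GRing.scale/=.
  have n1 : (Re (f t) * Re (f t) - Im (f t) * Im (f t)) ^+ 2 +
    (Re (f t) * Im (f t) + Im (f t) * Re (f t)) ^+ 2 != 0.
    rewrite (_ : _ + _ = (Re (f t) ^+ 2 + Im (f t) ^+ 2) ^+ 2); last by ring.
    by rewrite expf_neq0.
  by field; rewrite n0' n1.
- under eq_fun do rewrite ImV.
  apply: is_derive_eq.
  rewrite expr2 ImM ReV ImV ReN ImN !ReM !ImM /GRing.scale/=.
  have n1 : (Re (f t) * Re (f t) - Im (f t) * Im (f t)) ^+ 2 +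
    (Re (f t) * Im (f t) + Im (f t) * Re (f t)) ^+ 2 != 0.
    rewrite (_ : _ + _ = (Re (f t) ^+ 2 + Im (f t) ^+ 2) ^+ 2); last by ring.
    by rewrite expf_neq0.
  by field; rewrite n0' n1.
Qed.

Lemma cderX f t v n : cder f t v ->
  cder (fun s => f s ^+ n) t (f t ^+ n.-1 * v *+ n).
Proof.
move=> fv; elim: n => [|n ih]; first by rewrite mulr0n; exact: cder_cst.
under [g in cder g]eq_fun do rewrite exprS.
apply: (cder_eq (cderM fv ih)) => /=.
case: n {ih} => [|n]; first by rewrite !mulr0n mulr0 addr0 mulrC.
by rewrite mulrnAr mulrA -exprS mulrC -mulrS.
Qed.

Lemma cder_cexp f t v : cder f t v -> cder (fun s => cexp (f s)) t (cexp (f t) * v).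
Proof.
move=> [f1 f2].
have dE : is_derive t 1 (fun s => expR (Re (f s))) (expR (Re (f t)) * Re v).
  by apply: is_derive_eq; rewrite /GRing.scale/=; ring.
have dC : is_derive t 1 (fun s => cos (Im (f s))) (- sin (Im (f t)) * Im v).
  by apply: is_derive_eq; rewrite /GRing.scale/=; ring.
have dS : is_derive t 1 (fun s => sin (Im (f s))) (cos (Im (f t)) * Im v).
  by apply: is_derive_eq; rewrite /GRing.scale/=; ring.
split; rewrite ?ReM ?ImM /=; apply: is_derive_eq; rewrite /GRing.scale/=; ring.
Qed.

End Derivatives.
End ComplexLimits.

(** * Contour integrals *)

Section ContourIntegrals.
Variable R : realType.
Local Notation Re := complex.Re.
Local Notation Im := complex.Im.
Implicit Types (F G : R -> R[i]) (g h : R -> R[i]).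

Definition cint01 F : R[i] :=
  Complex (int01 (fun t => Re (F t))) (int01 (fun t => Im (F t))).

Definition ccont01 F := forall t : R, 0 <= t <= 1 -> ccont F t.

Lemma eq_cint01 F G : (forall t : R, 0 <= t <= 1 -> F t = G t) -> cint01 F = cint01 G.
Proof. by move=> FG; congr Complex; apply: eq_int01 => t /FG ->. Qed.

Lemma cint01D F G : ccont01 F -> ccont01 G ->
  cint01 (fun t => F t + G t) = cint01 F + cint01 G.
Proof.
move=> cF cG; apply: complex_eq; rewrite ?ReD ?ImD /= -int01D.
- by apply: eq_int01 => t _; rewrite ReD.
- by move=> t /cF[].
- by move=> t /cG[].
- by apply: eq_int01 => t _; rewrite ImD.
- by move=> t /cF[].
- by move=> t /cG[].
Qed.

Lemma cint01Z k F : ccont01 F -> cint01 (fun t => k * F t) = k * cint01 F.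
Proof.
move=> cF.
have cR (a : R) (t : R) : 0 <= t <= 1 -> {for t, continuous (fun t => a * Re (F t))}.
  by move=> /cF[? _]; apply: cvgM => //; exact: cvg_cst.
have cI (a : R) (t : R) : 0 <= t <= 1 -> {for t, continuous (fun t => a * Im (F t))}.
  by move=> /cF[_ ?]; apply: cvgM => //; exact: cvg_cst.
apply: complex_eq; rewrite ?ReM ?ImM /= -!int01Z.
- rewrite -int01B; [|exact: cR|exact: cI].
  by apply: eq_int01 => t _; rewrite ReM.
- by move=> t /cF[].
- by move=> t /cF[].
- rewrite -int01D; [|exact: cI|exact: cR].
  by apply: eq_int01 => t _; rewrite ImM.
- by move=> t /cF[].
- by move=> t /cF[].
Qed.

Lemma cint01_FTC F G : (forall t : R, 0 <= t <= 1 -> cder F t (G t)) ->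
  ccont01 G -> cint01 G = F 1 - F 0.
Proof.
move=> dF cG; apply: complex_eq; rewrite /= ?ReD ?ImD ?ReN ?ImN.
- by apply: (@int01_FTC R (fun t => Re (F t))) => t t01;
    [case: (dF t t01)|case: (cG t t01)].
- by apply: (@int01_FTC R (fun t => Im (F t))) => t t01;
    [case: (dF t t01)|case: (cG t t01)].
Qed.

Lemma cint01_Fubini (K : R -> R -> R[i]) :
  (forall s t : R, 0 <= s <= 1 -> 0 <= t <= 1 ->
     ccont (fun p : R * R => K p.1 p.2) (s, t)) ->
  cint01 (fun s => cint01 (K s)) = cint01 (fun t => cint01 (fun s => K s t)).
Proof.
move=> cK; apply: complex_eq => /=.
- by apply: (@int01_Fubini R (fun s t => Re (K s t))) => s t s01 t01;
    case: (cK s t s01 t01).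
- by apply: (@int01_Fubini R (fun s t => Im (K s t))) => s t s01 t01;
    case: (cK s t s01 t01).
Qed.

Lemma cint01_ccont (U : topologicalType) (K : U -> R -> R[i]) (u0 : U) :
  (forall t : R, 0 <= t <= 1 -> ccont (fun p => K p.1 p.2) (u0, t)) ->
  (\forall u \near u0, ccont01 (K u)) ->
  ccont (fun u => cint01 (K u)) u0.
Proof.
move=> cK cKu; split => /=.
- apply: (@int01_continuous R U (fun u t => Re (K u t))) => [t /cK[]//|].
  by near=> u => t /(near cKu u _)[].
- apply: (@int01_continuous R U (fun u t => Im (K u t))) => [t /cK[]//|].
  by near=> u => t /(near cKu u _)[].
Unshelve. all: by end_near. Qed.

(** The tube lemma for the compact unit interval. *)
Lemma near_unit_tube (U : topologicalType) (P : U -> R -> Prop) (u0 : U) :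
  (forall t : R, 0 <= t <= 1 -> \forall p \near (u0, t), P p.1 p.2) ->
  \forall u \near u0, forall t : R, 0 <= t <= 1 -> P u t.
Proof.
move=> nP; have := @segment_compact R 0 1; rewrite compact_near_coveringP => cov.
suff : \forall u \near u0, `[0%R, 1%R] `<=` P u.
  by apply: filterS => u Pu t t01; apply: Pu; rewrite /= in_itv.
apply: cov => t /=; rewrite in_itv/= => /nP[[A B]/= [Au Bt] AB].
by exists (B, A) => // -[t' u]/= [Bt' Au']; exact: (AB (u, t')).
Qed.

Lemma ccont_neq0_near (U : topologicalType) (f : U -> R[i]) (x : U) :
  ccont f x -> f x != 0 -> \forall y \near x, f y != 0.
Proof.
move=> [f1 f2] /sqr_parts_neq0 f0.
have : Re (f y) ^+ 2 + Im (f y) ^+ 2 @[y --> x] --> Re (f x) ^+ 2 + Im (f x) ^+ 2.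
  by apply: cvgD; exact: cvgM.
move=> /cvgr_neq0 /(_ f0); apply: filterS => y.
by apply: contraNneq => ->; rewrite /= expr0n addr0.
Qed.

(** What the argument uses of a contour: a closed curve of class C^1, possibly
with self-intersections. *)
Definition smooth_loop g : Prop :=
  [/\ forall t, cder g t (velocity g t), forall t, ccont (velocity g) t & g 0 = g 1].

Lemma simple_loop_smooth g : simple_loop g -> smooth_loop g.
Proof.
case=> -[d1 c1] [d2 c2] g01 _; split => //.
- move=> t; split => /=.
  + by rewrite derive1E; apply: DeriveDef => //; exact: d1.
  + by rewrite derive1E; apply: DeriveDef => //; exact: d2.
- by move=> t; split => /=; [exact: c1|exact: c2].
Qed.

Lemma smooth_loop_ccont g : smooth_loop g -> forall t, ccvg (nbhs t) g (g t).
Proof. by case=> dg _ _ t; exact: cder_ccont (dg t). Qed.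

Lemma cintegralE g f : cintegral g f = cint01 (fun t => f (g t) * velocity g t).
Proof. by []. Qed.

Lemma eq_cintegral g (f f' : R[i] -> R[i]) :
  (forall t : R, 0 <= t <= 1 -> f (g t) = f' (g t)) -> cintegral g f = cintegral g f'.
Proof. by move=> ff'; rewrite !cintegralE; apply: eq_cint01 => t /ff' ->. Qed.

Definition ccont_on g (f : R[i] -> R[i]) := ccont01 (fun t => f (g t)).

Section Loop.
Variable g : R -> R[i].
Hypothesis lg : smooth_loop g.
Implicit Types f : R[i] -> R[i].

Let ccont_velocity f : ccont_on g f -> ccont01 (fun t => f (g t) * velocity g t).
Proof. by case: lg => _ cv _ cf t t01; apply: ccvgM; [exact: cf|exact: cv]. Qed.

Lemma cintegralD f1 f2 : ccont_on g f1 -> ccont_on g f2 ->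
  cintegral g (fun z => f1 z + f2 z) = cintegral g f1 + cintegral g f2.
Proof.
move=> c1 c2; rewrite !cintegralE -cint01D; [|exact: ccont_velocity..].
by apply: eq_cint01 => t _; rewrite mulrDl.
Qed.

Lemma cintegralZ k f : ccont_on g f ->
  cintegral g (fun z => k * f z) = k * cintegral g f.
Proof.
move=> cf; rewrite !cintegralE -cint01Z; last exact: ccont_velocity.
by apply: eq_cint01 => t _; rewrite mulrA.
Qed.

Lemma cintegralB f1 f2 : ccont_on g f1 -> ccont_on g f2 ->
  cintegral g (fun z => f1 z - f2 z) = cintegral g f1 - cintegral g f2.
Proof.
move=> c1 c2; rewrite -[- cintegral g f2]mulN1r -cintegralZ// -cintegralD//.
  by apply: eq_cintegral => t _; rewrite mulN1r.
by move=> t t01; apply: ccvgM; [exact: ccvg_cst|exact: c2].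
Qed.

Lemma cintegral0 : cintegral g (fun=> 0) = 0.
Proof.
rewrite (_ : (fun=> 0) = (fun=> 0 * 0)); last by rewrite mulr0.
by rewrite cintegralZ ?mul0r// => t _; exact: ccvg_cst.
Qed.

Lemma cintegral_sum (I : Type) (r : seq I) (P : pred I) (f : I -> R[i] -> R[i]) :
  (forall i, P i -> ccont_on g (f i)) ->
  cintegral g (fun z => \sum_(i <- r | P i) f i z) =
  \sum_(i <- r | P i) cintegral g (f i).
Proof.
move=> cf; elim: r => [|i r ih].
  rewrite big_nil -[RHS]cintegral0; apply: eq_cintegral => t _.
  by rewrite big_nil.
rewrite big_cons; case: ifP => Pi.
  rewrite -ih -cintegralD; first by apply: eq_cintegral => t _; rewrite big_cons Pi.
    exact: cf.
  by move=> t t01; apply: ccvg_sum => j Pj; exact: cf.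
by rewrite -ih; apply: eq_cintegral => t _; rewrite big_cons Pi.
Qed.

Lemma cintegral_primitive (F : R -> R[i]) f :
  (forall t : R, 0 <= t <= 1 -> cder F t (f (g t) * velocity g t)) ->
  ccont_on g f -> F 0 = F 1 -> cintegral g f = 0.
Proof.
move=> dF cf F01; rewrite cintegralE (cint01_FTC dF) ?F01 ?subrr//.
exact: ccont_velocity.
Qed.

(** This stands in for Cauchy's theorem: in each use, the derivative [k s] in the
parameter has an explicit primitive along the loop. Fubini's theorem on the unit
square replaces differentiation under the integral sign. *)
Lemma cintegral_deformation (h k : R -> R[i] -> R[i]) :
  (forall s t : R, 0 <= s <= 1 -> 0 <= t <= 1 ->
     cder (fun s => h s (g t)) s (k s (g t))) ->
  (forall s t : R, 0 <= s <= 1 -> 0 <= t <= 1 ->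
     ccont (fun p : R * R => k p.1 (g p.2)) (s, t)) ->
  ccont_on g (h 0) -> ccont_on g (h 1) ->
  (forall s : R, 0 <= s <= 1 -> cintegral g (k s) = 0) ->
  cintegral g (h 1) = cintegral g (h 0).
Proof.
move=> dh ck c0 c1 k0; apply/eqP; rewrite -subr_eq0 -cintegralB//; apply/eqP.
have cks t : 0 <= t <= 1 -> ccont01 (fun s => k s (g t)).
  move=> t01 s s01.
  apply: (@ccont_comp R _ _ (fun s => (s, t)) (fun p => k p.1 (g p.2)));
    last exact: ck.
  by apply: continuous_for_pair; [exact: cvg_id|exact: cvg_cst].
transitivity (cint01 (fun t => cint01 (fun s => k s (g t) * velocity g t))).
  rewrite cintegralE; apply: eq_cint01 => t t01.
  transitivity (velocity g t * cint01 (fun s => k s (g t))).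
    rewrite mulrC; congr (_ * _).
    by rewrite (@cint01_FTC (fun s => h s (g t)))//; [move=> s s01; exact: dh|exact: cks].
  rewrite -cint01Z; last exact: cks.
  by apply: eq_cint01 => s _; rewrite mulrC.
rewrite -(@cint01_Fubini (fun s t => k s (g t) * velocity g t)); last first.
  move=> s t s01 t01; apply: ccvgM; first exact: ck.
  case: lg => _ cv _.
  by apply: (@ccont_comp R _ _ snd (velocity g)); [exact: cvg_snd|exact: cv].
transitivity (cint01 (fun=> 0)); last first.
  by rewrite /cint01 /= !int01_cst.
by apply: eq_cint01 => s s01; rewrite -cintegralE k0.
Qed.

Lemma cintegral_ccont (U : topologicalType) (K : U -> R[i] -> R[i]) (u0 : U) :
  (forall t : R, 0 <= t <= 1 -> ccont (fun p => K p.1 (g p.2)) (u0, t)) ->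
  (\forall u \near u0, ccont_on g (K u)) ->
  ccont (fun u => cintegral g (K u)) u0.
Proof.
move=> cK cKu.
apply: (@cint01_ccont U (fun u t => K u (g t) * velocity g t)).
  move=> t t01; apply: ccvgM; first exact: cK.
  case: lg => _ cv _.
  by apply: (@ccont_comp R _ _ snd (velocity g)); [exact: cvg_snd|exact: cv].
by near=> u; apply: ccont_velocity; near: u.
Unshelve. all: by end_near. Qed.

End Loop.

Lemma cintegral_Fubini g h (K : R[i] -> R[i] -> R[i]) :
  smooth_loop g -> smooth_loop h ->
  (forall s t : R, 0 <= s <= 1 -> 0 <= t <= 1 ->
     ccont (fun p : R * R => K (g p.1) (h p.2)) (s, t)) ->
  cintegral g (fun z => cintegral h (K z)) =
  cintegral h (fun w => cintegral g (fun z => K z w)).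
Proof.
move=> lg lh cK; have [_ cvg _] := lg; have [_ cvh _] := lh.
have c1 s : 0 <= s <= 1 -> ccont01 (fun t => K (g s) (h t) * velocity h t).
  move=> s01 t t01; apply: ccvgM; last exact: cvh.
  apply: (@ccont_comp R _ _ (fun t => (s, t)) (fun p => K (g p.1) (h p.2)));
    last exact: cK.
  by apply: continuous_for_pair; [exact: cvg_cst|exact: cvg_id].
have c2 t : 0 <= t <= 1 -> ccont01 (fun s => K (g s) (h t) * velocity g s).
  move=> t01 s s01; apply: ccvgM; last exact: cvg.
  apply: (@ccont_comp R _ _ (fun s => (s, t)) (fun p => K (g p.1) (h p.2)));
    last exact: cK.
  by apply: continuous_for_pair; [exact: cvg_id|exact: cvg_cst].
transitivity (cint01 (fun s => cint01 (fun t =>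
    K (g s) (h t) * velocity h t * velocity g s))).
  rewrite [LHS]cintegralE; apply: eq_cint01 => s s01.
  rewrite cintegralE mulrC -cint01Z; last exact: c1.
  by apply: eq_cint01 => t _; rewrite mulrC.
rewrite (@cint01_Fubini (fun s t => K (g s) (h t) * velocity h t * velocity g s)).
  rewrite [RHS]cintegralE; apply: eq_cint01 => t t01.
  rewrite cintegralE [RHS]mulrC -cint01Z; last exact: c2.
  by apply: eq_cint01 => s _; rewrite mulrCA [RHS]mulrA.
move=> s t s01 t01; apply: ccvgM; first apply: ccvgM.
- exact: cK.
- by apply: (@ccont_comp R _ _ snd (velocity h)); [exact: cvg_snd|exact: cvh].
- by apply: (@ccont_comp R _ _ fst (velocity g)); [exact: cvg_fst|exact: cvg].
Qed.

End ContourIntegrals.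
#[global] Opaque cintegral.

(** * Residues of Laurent monomials times an exponential *)

(** Splits the continuity of an arithmetic expression into that of its atoms. *)
Ltac ccont_arith :=
  lazymatch goal with
  | |- ccont ?f ?x => rewrite /ccont; ccont_arith
  | |- ccvg _ (fun x => (@?a x + - @?b x)%R) _ => apply: ccvgB; ccont_arith
  | |- ccvg _ (fun x => (@?a x + @?b x)%R) _ => apply: ccvgD; ccont_arith
  | |- ccvg _ (fun x => (- @?a x)%R) _ => apply: ccvgN; ccont_arith
  | |- ccvg _ (fun x => (@?a x * @?b x)%R) _ => apply: ccvgM; ccont_arith
  | |- ccvg _ (fun x => ((@?a x)^-1)%R) _ => apply: ccvgV; ccont_arith
  | |- ccvg _ (fun x => (@?a x ^+ ?n)%R) _ => apply: ccvgX; ccont_arith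
  | |- ccvg _ (fun x => cexp (@?a x)) _ => apply: ccvg_cexp; ccont_arith
  | |- ccvg _ ?f ?l =>
      lazymatch f with
      | (fun _ : ?T => _) =>
        let c := constr:(fun _ : T => l) in
        first [constr_eq f c; apply: ccvg_cst | solve [auto 1 with nocore] | idtac]
      | _ => try solve [auto 1 with nocore]
      end
  | |- _ => try by []
  end.

Section Residues.
Variable R : realType.
Implicit Types (g h : R -> R[i]) (m a b : int) (T : R).
Local Notation "x %:C" := (real_complex R x).

Definition avoids g (p : R[i]) : Prop := forall t : R, 0 <= t <= 1 -> g t != p.

Lemma encloses_avoids g p : encloses g p -> avoids g p.
Proof. by case=> gp _ t /gp/eqP. Qed.

Lemma encloses_winding g p : encloses g p ->
  cintegral g (fun z => (z - p)^-1) = two_pi_i R.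
Proof.
case=> _ /(congr1 ( *%R^~ (two_pi_i R))).
by rewrite /winding mul1r divfK// two_pi_i_neq0.
Qed.

Lemma ccvg_exprz (S : Type) (F : set_system S) {FF : Filter F} (f : S -> R[i])
    (l : R[i]) m : l != 0 -> ccvg F f l -> ccvg F (fun x => f x ^ m) (l ^ m).
Proof.
move=> l0 fl; case: m => n; rewrite /exprz; first exact: ccvgX.
by apply: ccvgV; [rewrite expf_neq0|exact: ccvgX].
Qed.

Lemma cder_exprz (f : R -> R[i]) (t : R) (v : R[i]) m : f t != 0 -> cder f t v ->
  cder (fun s => f s ^ m) t (m%:~R * f t ^ (m - 1) * v).
Proof.
move=> ft0 fv; case: m => n.
  apply: (cder_eq (cderX n fv)).
  case: n => [|n]; first by rewrite mulr0n !mul0r.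
  by rewrite -pmulrn -mulr_natl mulrA subzSS subr0.
rewrite /exprz; apply: (cder_eq (cderV _ (cderX n.+1 fv))).
  by rewrite expf_neq0.
have -> : Negz n - 1 = Negz n.+1 by rewrite !NegzE -opprD -PoszD addn1.
have -> : (Negz n)%:~R = - n.+1%:R :> R[i] by rewrite NegzE mulrNz.
rewrite -mulr_natl /=; have : f t ^+ n != 0 by rewrite expf_neq0.
by rewrite !exprS; move: (f t ^+ n) => y y0; field; rewrite y0.
Qed.

Section Loop.
Variable g : R -> R[i].
Hypothesis lg : smooth_loop g.

Let cg (t : R) : ccvg (nbhs t) g (g t). Proof. exact: smooth_loop_ccont. Qed.

Lemma cintegral_exp (c : R[i]) : cintegral g (fun z => cexp (c * z)) = 0.
Proof.
have [dg _ g01] := lg.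
have [->|c0] := eqVneq c 0.
  apply: (cintegral_primitive lg (F := g)) => //.
    by move=> t _; rewrite mul0r cexp0 mul1r; exact: dg.
  by move=> t _; ccont_arith.
apply: (cintegral_primitive lg (F := fun t => cexp (c * g t) / c)).
- move=> t _; apply: cder_eq.
    exact: (cderM (cder_cexp (cderM (cder_cst c t) (dg t))) (cder_cst c^-1 t)).
  by cbv beta; field.
- by move=> t _; ccont_arith.
- by rewrite g01.
Qed.

(** The family [exp (s T (z - w)) / (z - w)], whose derivative in [s] is entire,
joins [1 / (z - w)] to [exp (T (z - w)) / (z - w)]. *)
Lemma cintegral_exp_cauchy T (w : R[i]) : avoids g w ->
  cintegral g (fun z => cexp (T%:C * z) / (z - w)) =
  cexp (T%:C * w) * cintegral g (fun z => (z - w)^-1).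
Proof.
move=> gw.
have gw0 (t : R) : 0 <= t <= 1 -> g t - w != 0 by move=> /gw; rewrite subr_eq0.
pose h (s : R) (z : R[i]) := cexp (s%:C * (T%:C * (z - w))) / (z - w).
pose k (s : R) (z : R[i]) := T%:C * cexp (s%:C * (T%:C * (z - w))).
have ch (s : R) : ccont_on g (h s).
  by move=> t t01; rewrite /h; ccont_arith; exact: gw0.
have hE : cintegral g (h 1) = cintegral g (h 0).
  apply: (cintegral_deformation lg (h := h) (k := k)); [| |exact: ch|exact: ch|].
  - move=> s t s01 t01; apply: cder_eq.
      apply: (cderM (cder_cexp (cderM (cder_real s) (cder_cst _ s))) (cder_cst _ s)).
    by rewrite /k; cbv beta; field; exact: gw0.
  - move=> s t s01 t01; rewrite /k; ccont_arith.
      by apply: (ccont_fst (p := (s, t))); split; [exact: cvg_id|exact: cvg_cst].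
    by apply: (ccont_snd (p := (s, t))); exact: cg.
  - move=> s s01.
    rewrite (_ : k s = fun z => (T%:C * cexp (- (s%:C * T%:C * w))) *
        cexp ((s%:C * T%:C) * z)).
      rewrite cintegralZ// ?cintegral_exp ?mulr0// => t t01.
      by ccont_arith.
    by apply/funext => z; rewrite /k -mulrA -cexpD; congr (_ * cexp _); ring.
have -> : cintegral g (fun z => cexp (T%:C * z) / (z - w)) =
    cexp (T%:C * w) * cintegral g (h 1).
  rewrite -cintegralZ//; apply: eq_cintegral => t t01.
  by rewrite /h mulrA -cexpD mul1r; congr (cexp _ / _); ring.
rewrite hE; congr (_ * _); apply: eq_cintegral => t t01.
by rewrite /h mul0r cexp0 mul1r.
Qed.

Definition laurent_exp T m (z : R[i]) : R[i] := z ^ m * cexp (T%:C * z).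

Hypothesis g0 : avoids g 0.

Lemma ccont_laurent_exp T m : ccont_on g (laurent_exp T m).
Proof.
move=> t t01; rewrite /laurent_exp; ccont_arith.
by apply: ccvg_exprz; [exact: g0|exact: cg].
Qed.

(** The derivative of [z ^ m * exp (T z)] integrates to 0 along the loop. *)
Lemma cintegral_laurent_exp_rec T m :
  m%:~R * cintegral g (laurent_exp T (m - 1)) +
  T%:C * cintegral g (laurent_exp T m) = 0.
Proof.
have [dg _ g01] := lg.
have cl c k : ccont_on g (fun z => c * laurent_exp T k z).
  by move=> t t01; ccont_arith; exact: ccont_laurent_exp.
rewrite -!cintegralZ//; [|exact: ccont_laurent_exp..].
rewrite -cintegralD//.
apply: (cintegral_primitive lg (F := fun t => laurent_exp T m (g t))).
- move=> t t01; apply: cder_eq.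
    exact: (cderM (cder_exprz m (g0 t01) (dg t))
      (cder_cexp (cderM (cder_cst T%:C t) (dg t)))).
  by rewrite /laurent_exp; cbv beta; ring.
- by move=> t t01; ccont_arith; exact: ccont_laurent_exp.
- by rewrite g01.
Qed.

End Loop.

Lemma cintegral_cauchy_ccont (h : R -> R[i]) (U : topologicalType) (f : U -> R[i])
    (psi : U -> R[i] -> R[i]) (u0 : U) : smooth_loop h ->
  ccont f u0 -> (forall t : R, 0 <= t <= 1 -> f u0 - h t != 0) ->
  (forall t : R, 0 <= t <= 1 -> ccont (fun p => psi p.1 (h p.2)) (u0, t)) ->
  (\forall u \near u0, ccont_on h (psi u)) ->
  ccont (fun u => cintegral h (fun w => psi u w * (f u - w)^-1)) u0.
Proof.
move=> lh cf fh cpsi cpsiu; have ch := smooth_loop_ccont lh.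
have cfh t : ccont (fun p : U * R => f p.1 - h p.2) (u0, t).
  ccont_arith; first exact: (ccont_fst (p := (u0, t)) cf).
  exact: (ccont_snd (p := (u0, t)) (ch t)).
apply: (cintegral_ccont lh (K := fun u w => psi u w * (f u - w)^-1)).
  move=> t t01; apply: ccvgM; first exact: cpsi.
  by apply: ccvgV; [exact: fh|exact: cfh].
have nfh : \forall u \near u0, forall t : R, 0 <= t <= 1 -> f u - h t != 0.
  apply: (near_unit_tube (P := fun u t => f u - h t != 0)) => t t01.
  by apply: (ccont_neq0_near (cfh t)); exact: fh.
near=> u => t t01; apply: ccvgM.
  by move: t t01; near: u.
by ccont_arith; move: t t01; near: u.
Unshelve. all: by end_near. Qed.

(** The residue of [z ^ m * exp (T z)] at 0. *)
Definition exp_residue T m : R[i] := if m is Negz k then (T ^+ k / k`!%:R)%:C else 0.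

Lemma cintegral_laurent_exp g T m : smooth_loop g -> encloses g 0 -> T != 0 ->
  cintegral g (laurent_exp T m) = two_pi_i R * exp_residue T m.
Proof.
move=> lg eg T0; have g0 := encloses_avoids eg.
have TC0 : T%:C != 0 by rewrite fmorph_eq0.
case: m => n; elim: n => [|n ih].
- rewrite mulr0 -[RHS](cintegral_exp lg T%:C); apply: eq_cintegral => t _.
  by rewrite /laurent_exp expr0z mul1r.
- rewrite mulr0; have := cintegral_laurent_exp_rec lg g0 T n.+1.
  rewrite subzSS subr0 ih !mulr0 add0r => /eqP.
  by rewrite mulf_eq0 (negbTE TC0) => /eqP.
- transitivity (cintegral g (fun z => cexp (T%:C * z) / (z - 0))).
    by apply: eq_cintegral => t _; rewrite /laurent_exp subr0 mulrC.
  rewrite cintegral_exp_cauchy// encloses_winding// mulr0 cexp0 mul1r.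
  by rewrite /= fact0 expr0 divr1 rmorph1 mulr1.
- have := cintegral_laurent_exp_rec lg g0 T (Negz n).
  rewrite (_ : Negz n - 1 = Negz n.+1); last by rewrite !NegzE -opprD -PoszD addn1.
  rewrite ih NegzE intrN mulNr addrC => /eqP; rewrite subr_eq0 => /eqP E.
  have n0 : n.+1%:R != 0 :> R[i] by rewrite pnatr_eq0.
  apply: (mulfI n0); rewrite -pmulrn in E; rewrite -E /=.
  rewrite factS natrM exprS -(rmorph_nat (real_complex R)) mulrCA [RHS]mulrCA.
  congr (_ * _); rewrite -!rmorphM /=; congr (_%:C).
  have f0 : n`!%:R != 0 :> R by rewrite pnatr_eq0 -lt0n fact_gt0.
  by rewrite natrM; field; rewrite f0 addrC natr1 pnatr_eq0.
Qed.

Section Double.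
Variable T : R.
Hypothesis T0 : T != 0.

Definition cauchy_double g h a b : R[i] :=
  cintegral g (fun z => cintegral h (fun w =>
    (z - w)^-1 * laurent_exp T a z * laurent_exp T b w)).

Section Pair.
Variables g h : R -> R[i].
Hypotheses (lg : smooth_loop g) (lh : smooth_loop h).
Hypotheses (eg : encloses g 0) (eh : encloses h 0) (egh : encloses_loop g h).

Let cg (t : R) : ccvg (nbhs t) g (g t). Proof. exact: smooth_loop_ccont. Qed.
Let ch (t : R) : ccvg (nbhs t) h (h t). Proof. exact: smooth_loop_ccont. Qed.
Let gh (s t : R) : 0 <= s <= 1 -> 0 <= t <= 1 -> g s - h t != 0.
Proof. by move=> s01 t01; rewrite subr_eq0; exact: (encloses_avoids (egh t01) s01). Qed.

Let ccont_laurent a (p : R * R) (k : R * R -> R) u :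
  smooth_loop u -> encloses u 0 -> {for p, continuous k} -> 0 <= k p <= 1 ->
  ccvg (nbhs p) (fun q => laurent_exp T a (u (k q))) (laurent_exp T a (u (k p))).
Proof.
move=> lu eu ck kp.
apply: (@ccont_comp _ _ _ k (fun t => laurent_exp T a (u t))) => //.
by apply: ccont_laurent_exp => //; exact: encloses_avoids.
Qed.

Lemma ccont_cauchy_kernel a b (s t : R) : 0 <= s <= 1 -> 0 <= t <= 1 ->
  ccont (fun p : R * R => (g p.1 - h p.2)^-1 * laurent_exp T a (g p.1) *
    laurent_exp T b (h p.2)) (s, t).
Proof.
move=> s01 t01; ccont_arith.
- exact: gh.
- by apply: (ccont_fst (p := (s, t))); exact: cg.
- by apply: (ccont_snd (p := (s, t))); exact: ch.
- exact: (@ccont_laurent a (s, t) fst g lg eg cvg_fst s01).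
- exact: (@ccont_laurent b (s, t) snd h lh eh cvg_snd t01).
Qed.

Lemma ccont_cauchy_inner a b z : (forall t : R, 0 <= t <= 1 -> z - h t != 0) ->
  ccont_on h (fun w => (z - w)^-1 * laurent_exp T a z * laurent_exp T b w).
Proof.
move=> zh t t01; ccont_arith; first exact: zh.
by apply: ccont_laurent_exp => //; exact: encloses_avoids.
Qed.

Lemma ccont_cauchy_outer a b :
  ccont_on g (fun z => cintegral h (fun w =>
    (z - w)^-1 * laurent_exp T a z * laurent_exp T b w)).
Proof.
move=> s s01; pose K (s : R) (w : R[i]) := (g s - w)^-1 * laurent_exp T a (g s) *
  laurent_exp T b w.
apply: (cintegral_ccont lh (K := K)).
  by move=> t t01; exact: ccont_cauchy_kernel.
near=> u; apply: ccont_cauchy_inner; near: u.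
apply: (near_unit_tube (P := fun u t => g u - h t != 0)) => t t01.
apply: (@ccont_neq0_near _ _ (fun p : R * R => g p.1 - h p.2)); last exact: gh.
ccont_arith; first by apply: (ccont_fst (p := (s, t))); exact: cg.
by apply: (ccont_snd (p := (s, t))); exact: ch.
Unshelve. all: by end_near. Qed.

(** Without a power of [z], the only pole of the integrand in [z] is [w], so that
Cauchy's formula in [z] leaves a single residue with exponential [exp (2 T w)]. *)
Lemma cauchy_double0 b :
  cauchy_double g h 0 b = two_pi_i R * (two_pi_i R * exp_residue (T + T) b).
Proof.
have T20 : T + T != 0 by rewrite -mulr2n mulrn_eq0.
rewrite /cauchy_double cintegral_Fubini//; last exact: ccont_cauchy_kernel.
rewrite -(cintegral_laurent_exp b lh eh T20) -cintegralZ//; last first.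
  by apply: ccont_laurent_exp => //; exact: encloses_avoids.
apply: eq_cintegral => t t01.
have gt := encloses_avoids (egh t01).
transitivity (laurent_exp T b (h t) *
    cintegral g (fun z => cexp (real_complex R T * z) / (z - h t))).
  rewrite -cintegralZ//; last first.
    by move=> s s01; ccont_arith; exact: gh.
  apply: eq_cintegral => s _; rewrite /laurent_exp expr0z mul1r.
  by rewrite mulrC [cexp _ / _]mulrC.
rewrite cintegral_exp_cauchy// (encloses_winding (egh t01)) /laurent_exp.
rewrite mulrC -!mulrA mulrCA; congr (_ * _).
rewrite rmorphD mulrDl cexpD; ring.
Qed.

(** From [z / (z - w) = 1 + w / (z - w)]. *)
Lemma cauchy_double_rec a b :
  cauchy_double g h (a + 1) b =
  cintegral g (laurent_exp T a) * cintegral h (laurent_exp T b) +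
  cauchy_double g h a (b + 1).
Proof.
have g0 := encloses_avoids eg; have h0 := encloses_avoids eh.
have cga := ccont_laurent_exp lg g0 T a.
have chb := ccont_laurent_exp lh h0 T b.
rewrite mulrC -cintegralZ// -cintegralD//; last exact: ccont_cauchy_outer.
  apply: eq_cintegral => s s01.
  rewrite mulrC -cintegralZ// -cintegralD//.
  - apply: eq_cintegral => t t01; rewrite /laurent_exp.
    rewrite (expfzDr _ _ (g0 _ s01)) (expfzDr _ _ (h0 _ t01)) !expr1z.
    by field; exact: gh.
  - by move=> t t01; ccont_arith; exact: chb.
  - by apply: ccont_cauchy_inner => t; exact: gh.
by move=> s s01; ccont_arith; exact: cga.
Qed.

End Pair.
(** By induction on [a], upwards and downwards from [cauchy_double0]: the
recursion [cauchy_double_rec] only adds products of residues. *)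
Lemma cauchy_double_universal (g h g' h' : R -> R[i]) a b :
  smooth_loop g -> smooth_loop h -> encloses g 0 -> encloses h 0 -> encloses_loop g h ->
  smooth_loop g' -> smooth_loop h' -> encloses g' 0 -> encloses h' 0 ->
  encloses_loop g' h' ->
  cauchy_double g h a b = cauchy_double g' h' a b.
Proof.
move=> lg lh eg eh egh lg' lh' eg' eh' egh'.
have Jg c := cintegral_laurent_exp c lg eg T0.
have Jh c := cintegral_laurent_exp c lh eh T0.
have Jg' c := cintegral_laurent_exp c lg' eg' T0.
have Jh' c := cintegral_laurent_exp c lh' eh' T0.
have rec := cauchy_double_rec lg lh eg eh egh.
have rec' := cauchy_double_rec lg' lh' eg' eh' egh'.
elim/int_ind: a b => [|n ih|n ih] b.
- exact: (etrans (cauchy_double0 lg lh eg eh egh b)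
    (esym (cauchy_double0 lg' lh' eg' eh' egh' b))).
- have -> : n.+1%:Z = n%:Z + 1 by rewrite -addn1 PoszD.
  by rewrite rec rec' ih Jg Jh Jg' Jh'.
- have : - n.+1%:Z + 1 = - n%:Z by rewrite -addn1 PoszD opprD subrK.
  move: (- n.+1%:Z) => a E.
  have := rec a (b - 1); have := rec' a (b - 1).
  rewrite E [b - 1 + 1]subrK ih => ->.
  by rewrite Jg Jh Jg' Jh' => /addrI ->.
Qed.

End Double.
End Residues.

(** * Multiple contour integrals with squared Vandermonde weights *)

Section MultipleIntegrals.
Variable R : realType.
Local Notation C := R[i].

Lemma fcons0 (A : Type) (r : nat) (x : A) (v : 'I_r -> A) : fcons x v ord0 = x.
Proof. by rewrite /fcons unlift_none. Qed.

Lemma fconsS (A : Type) (r : nat) (x : A) (v : 'I_r -> A) i :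
  fcons x v (lift ord0 i) = v i.
Proof. by rewrite /fcons liftK. Qed.

Definition on_contours r (g : 'I_r -> R -> C) (z : 'I_r -> C) : Prop :=
  forall k, exists2 t : R, 0 <= t <= 1 & z k = g k t.

Lemma eq_mcintegral r (g : 'I_r -> R -> C) (f f' : ('I_r -> C) -> C) :
  (forall z, on_contours g z -> f z = f' z) -> mcintegral g f = mcintegral g f'.
Proof.
elim: r => [|r ih] in g f f' * => ff' /=; first by apply: ff' => -[].
apply: eq_cintegral => t t01; apply: ih => z gz; apply: ff' => k.
have [->|[j ->]] : k = ord0 \/ exists j, k = lift ord0 j.
- by case: (unliftP ord0 k) => [j ->|->]; [right; exists j|left].
- by exists t => //; rewrite fcons0.
- by have [u u01 zu] := gz j; exists u => //; rewrite fconsS.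
Qed.

(** An integral of a sum of products separates at every level of iteration. *)
Lemma mcintegral_sum_prod r (g : 'I_r -> R -> C) (I : finType) (c : I -> C)
    (f : I -> 'I_r -> C -> C) :
  (forall k, smooth_loop (g k)) -> (forall i k, ccont_on (g k) (f i k)) ->
  mcintegral g (fun z => \sum_i c i * \prod_k f i k (z k)) =
  \sum_i c i * \prod_k cintegral (g k) (f i k).
Proof.
elim: r => [|r ih] in g c f * => lg cf.
  by rewrite /=; apply: eq_bigr => i _; rewrite !big_ord0.
transitivity (cintegral (g ord0) (fun z => \sum_i f i ord0 z *
    (c i * \prod_(k < r) cintegral (g (lift ord0 k)) (f i (lift ord0 k))))).
  apply: eq_cintegral => t _.
  transitivity (mcintegral (fun k => g (lift ord0 k)) (fun zs =>
      \sum_i (f i ord0 (g ord0 t) * c i) * \prod_(k < r) f i (lift ord0 k) (zs k))).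
    apply: eq_mcintegral => zs _; apply: eq_bigr => i _.
    rewrite big_ord_recl fcons0 mulrA [c i * _]mulrC; congr (_ * _).
    by apply: eq_bigr => k _; rewrite fconsS.
  apply: etrans (ih _ (fun i => f i ord0 (g ord0 t) * c i)
    (fun i k => f i (lift ord0 k)) _ _) _.
  - by move=> k; exact: lg.
  - by move=> i k; exact: cf.
  - by apply: eq_bigr => i _; rewrite mulrA.
rewrite cintegral_sum//; last first.
  by move=> i _ t t01; apply: ccvgM; [exact: (cf i ord0 t t01)|exact: ccvg_cst].
apply: eq_bigr => i _; rewrite big_ord_recl mulrCA.
rewrite [RHS]mulrC -(cintegralZ (lg ord0) _ (cf i ord0)).
by apply: eq_cintegral => t _; rewrite mulrC.
Qed.

(** Indices of the expansion of the squared Vandermonde determinant. *)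
Definition perm_pair r : finType := ('S_r * 'S_r)%type.
Definition pp_sign r (s : perm_pair r) : C := (-1) ^+ s.1 * (-1) ^+ s.2.
Definition pp_exp r (s : perm_pair r) (k : 'I_r) : nat := (s.1 k + s.2 k)%N.

Lemma sq_vandermonde_sum r (z : 'I_r -> C) :
  sq_vandermonde z = \sum_(s : perm_pair r) pp_sign s * \prod_k z k ^+ pp_exp s k.
Proof.
pose V := Vandermonde r (\row_k z k).
have detV : \det V = \sum_(s : 'S_r) (-1) ^+ s * \prod_k z k ^+ s k.
  rewrite -det_tr /determinant; apply: eq_bigr => s _; congr (_ * _).
  by apply: eq_bigr => k _; rewrite !mxE.
have -> : sq_vandermonde z = \det V ^+ 2.
  rewrite det_Vandermonde -prodrXl; apply: eq_bigr => i _.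
  rewrite -prodrXl; apply: eq_bigr => j _.
  by rewrite !mxE -sqrrN opprB.
rewrite expr2 {1}detV detV big_distrlr/= pair_big/=.
apply: eq_bigr => -[s1 s2] _ /=; rewrite /pp_sign /pp_exp/= mulrACA.
by congr (_ * _); rewrite -big_split/=; apply: eq_bigr => k _; rewrite exprD.
Qed.

Definition weight_sum r (M : 'I_r -> nat -> C) : C :=
  \sum_(s : perm_pair r) pp_sign s * \prod_k M k (pp_exp s k).

Lemma mcintegral_weight r (g : 'I_r -> R -> C) (c : C) (y phi : C -> C) :
  (forall k, smooth_loop (g k)) ->
  (forall k a, ccont_on (g k) (fun z => y z ^+ a * phi z)) ->
  mcintegral g (fun z => c * (sq_vandermonde (fun k => y (z k)) * \prod_k phi (z k))) =
  c * weight_sum (fun k a => cintegral (g k) (fun z => y z ^+ a * phi z)).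
Proof.
move=> lg cM.
transitivity (mcintegral g (fun z => \sum_(s : perm_pair r) (c * pp_sign s) *
    \prod_k (y (z k) ^+ pp_exp s k * phi (z k)))).
  apply: eq_mcintegral => z _; rewrite sq_vandermonde_sum mulr_suml mulr_sumr.
  by apply: eq_bigr => s _; rewrite big_split/= !mulrA.
rewrite (mcintegral_sum_prod _ lg (f := fun s k z => y z ^+ pp_exp s k * phi z)).
  by rewrite mulr_sumr; apply: eq_bigr => s _; rewrite mulrA.
by move=> s k; exact: cM.
Qed.

Definition kernel_index r1 r2 : finType :=
  (('I_r1 * 'I_r2) * (perm_pair r1 * perm_pair r2))%type.

Definition kernel_sum r1 r2 (M1 : 'I_r1 -> nat -> C) (M2 : 'I_r2 -> nat -> C)
    (D : 'I_r1 -> 'I_r2 -> nat -> nat -> C) : C :=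
  \sum_(q : kernel_index r1 r2) let: (k, l, (s1, s2)) := q in
    pp_sign s1 * pp_sign s2 *
    ((\prod_(k' | k' != k) M1 k' (pp_exp s1 k')) *
     (\prod_(l' | l' != l) M2 l' (pp_exp s2 l')) *
     D k l (pp_exp s1 k) (pp_exp s2 l)).

(** A factor that concerns a single variable, written as a product over all
variables, so that [mcintegral_sum_prod] applies. *)
Lemma prod_insert (S : comNzRingType) (I : finType) (k : I) (F x : I -> S) :
  \prod_i (F i * (if i == k then x i else 1)) = (\prod_i F i) * x k.
Proof.
rewrite big_split/=; congr (_ * _).
by rewrite (bigD1 k)//= eqxx big1 ?mulr1// => i /negbTE ->.
Qed.

Lemma mul_sums3 (I J K : finType) (F : I -> C) (G : J -> C) (H : K -> C) (c d : C) :
  (\sum_i F i) * (c * \sum_j G j) * (d * \sum_k H k) =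
  \sum_(q : I * (J * K)) c * d * (F q.1 * (G q.2.1 * H q.2.2)).
Proof.
transitivity (c * d * ((\sum_i F i) * ((\sum_j G j) * (\sum_k H k)))); first by ring.
by rewrite [(\sum_j G j) * _]big_distrlr pair_big/= big_distrlr pair_big/= mulr_sumr.
Qed.

(** Each term of the kernel couples a single variable of the first group with a
single one of the second; all other integrals separate. *)
Lemma mcintegral_kernel r1 r2 (g1 : 'I_r1 -> R -> C) (g2 : 'I_r2 -> R -> C)
    (c1 c2 : C) (y1 y2 phi1 phi2 : C -> C) (kappa : C -> C -> C) :
  (forall k, smooth_loop (g1 k)) -> (forall l, smooth_loop (g2 l)) ->
  (forall k a, ccont_on (g1 k) (fun z => y1 z ^+ a * phi1 z)) ->
  (forall l b, ccont_on (g2 l) (fun w => y2 w ^+ b * phi2 w)) ->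
  (forall k l b (t : R), 0 <= t <= 1 ->
    ccont_on (g2 l) (fun w => y2 w ^+ b * phi2 w * kappa (g1 k t) w)) ->
  (forall k l b, ccont_on (g1 k) (fun z =>
    cintegral (g2 l) (fun w => y2 w ^+ b * phi2 w * kappa z w))) ->
  mcintegral g1 (fun z => mcintegral g2 (fun w =>
    (\sum_k \sum_l kappa (z k) (w l)) *
    (c1 * (sq_vandermonde (fun k => y1 (z k)) * \prod_k phi1 (z k))) *
    (c2 * (sq_vandermonde (fun l => y2 (w l)) * \prod_l phi2 (w l))))) =
  c1 * c2 * kernel_sum
    (fun k a => cintegral (g1 k) (fun z => y1 z ^+ a * phi1 z))
    (fun l b => cintegral (g2 l) (fun w => y2 w ^+ b * phi2 w))
    (fun k l a b => cintegral (g1 k) (fun z => y1 z ^+ a * phi1 z *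
      cintegral (g2 l) (fun w => y2 w ^+ b * phi2 w * kappa z w))).
Proof.
move=> lg1 lg2 cM1 cM2 cK cD.
pose I2 (l : 'I_r2) b := cintegral (g2 l) (fun w => y2 w ^+ b * phi2 w).
pose Psi (l : 'I_r2) b z := cintegral (g2 l) (fun w => y2 w ^+ b * phi2 w * kappa z w).
pose cq (q : kernel_index r1 r2) : C := c1 * c2 * (pp_sign q.2.1 * pp_sign q.2.2).
pose P1 (q : kernel_index r1 r2) (z : 'I_r1 -> C) : C :=
  \prod_k (y1 (z k) ^+ pp_exp q.2.1 k * phi1 (z k)).
pose f2 (q : kernel_index r1 r2) (zk : C) (l : 'I_r2) (w : C) : C :=
  y2 w ^+ pp_exp q.2.2 l * phi2 w * (if l == q.1.2 then kappa zk w else 1).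
pose rest (q : kernel_index r1 r2) : C :=
  \prod_(l | l != q.1.2) I2 l (pp_exp q.2.2 l).
pose f1 (q : kernel_index r1 r2) (k : 'I_r1) (z : C) : C :=
  y1 z ^+ pp_exp q.2.1 k * phi1 z *
  (if k == q.1.1 then Psi q.1.2 (pp_exp q.2.2 q.1.2) z else 1).
transitivity (mcintegral g1 (fun z =>
    \sum_q (cq q * rest q) * \prod_k f1 q k (z k))).
  apply: eq_mcintegral => z gz.
  transitivity (mcintegral g2 (fun w =>
      \sum_q (cq q * P1 q z) * \prod_l f2 q (z q.1.1) l (w l))).
    apply: eq_mcintegral => w _.
    have E r (y phi : C -> C) (x : 'I_r -> C) :
        sq_vandermonde (fun k => y (x k)) * \prod_k phi (x k) =
        \sum_(s : perm_pair r) pp_sign s * \prod_k (y (x k) ^+ pp_exp s k * phi (x k)).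
      rewrite sq_vandermonde_sum mulr_suml.
      by apply: eq_bigr => s _; rewrite big_split/= mulrA.
    rewrite !E pair_big/= mul_sums3; apply: eq_bigr => -[[k l] [s1 s2]] _ /=.
    have H2 : \prod_l' f2 (k, l, (s1, s2)) (z k) l' (w l') =
        (\prod_l' (y2 (w l') ^+ pp_exp s2 l' * phi2 (w l'))) * kappa (z k) (w l).
      exact: (prod_insert l (fun l' => y2 (w l') ^+ pp_exp s2 l' * phi2 (w l'))
        (fun l' => kappa (z k) (w l'))).
    rewrite H2 /cq /P1/=; ring.
  have cf2 q l : ccont_on (g2 l) (f2 q (z q.1.1) l).
    rewrite /f2; case: eqP => [_|_] t t01.
      by have [u u01 ->] := gz q.1.1; exact: cK.
    by apply: ccvgM; [exact: (cM2 l _ t t01)|exact: ccvg_cst].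
  rewrite (mcintegral_sum_prod _ lg2 cf2); apply: eq_bigr => q _.
  have -> : \prod_l cintegral (g2 l) (f2 q (z q.1.1) l) =
      Psi q.1.2 (pp_exp q.2.2 q.1.2) (z q.1.1) * rest q.
    rewrite (bigD1 q.1.2)//=; congr (_ * _).
      by rewrite /Psi; apply: eq_cintegral => t _; rewrite /f2 eqxx.
    apply: eq_bigr => l /negbTE ll.
    by rewrite /I2; apply: eq_cintegral => t _; rewrite /f2 ll mulr1.
  have -> : \prod_k f1 q k (z k) = P1 q z * Psi q.1.2 (pp_exp q.2.2 q.1.2) (z q.1.1).
    exact: (prod_insert q.1.1 (fun k => y1 (z k) ^+ pp_exp q.2.1 k * phi1 (z k))
      (fun k => Psi q.1.2 (pp_exp q.2.2 q.1.2) (z k))).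
  ring.
have cf1 q k : ccont_on (g1 k) (f1 q k).
  rewrite /f1; case: eqP => [_|_] t t01.
    by apply: ccvgM; [exact: (cM1 k _ t t01)|exact: (cD k _ _ t t01)].
  by apply: ccvgM; [exact: (cM1 k _ t t01)|exact: ccvg_cst].
rewrite (mcintegral_sum_prod _ lg1 cf1) mulr_sumr; apply: eq_bigr => -[[k l] [s1 s2]] _.
rewrite (bigD1 k)//= [cintegral (g1 k) (f1 _ k)](_ : _ = cintegral (g1 k) (fun z =>
    y1 z ^+ pp_exp s1 k * phi1 z * Psi l (pp_exp s2 l) z)); last first.
  by apply: eq_cintegral => t _; rewrite /f1/= eqxx.
rewrite [\prod_(i | _) _](_ : _ = \prod_(k' | k' != k)
    cintegral (g1 k') (fun z => y1 z ^+ pp_exp s1 k' * phi1 z)); last first.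
  apply: eq_bigr => k' /negbTE kk'.
  by apply: eq_cintegral => t _; rewrite /f1/= kk' mulr1.
rewrite /cq /rest /Psi /=; ring.
Qed.

End MultipleIntegrals.

(** * The limiting covariance: contour independence and nonzero denominators *)

Section WeightSums.
Variable R : realType.
Local Notation C := R[i].

Lemma eq_weight_sum r (M M' : 'I_r -> nat -> C) :
  (forall k a, M k a = M' k a) -> weight_sum M = weight_sum M'.
Proof.
move=> MM; apply: eq_bigr => s _; congr (_ * _).
by apply: eq_bigr => k _; exact: MM.
Qed.

Lemma eq_kernel_sum r1 r2 (M1 M1' : 'I_r1 -> nat -> C) (M2 M2' : 'I_r2 -> nat -> C)
    (D D' : 'I_r1 -> 'I_r2 -> nat -> nat -> C) :
  (forall k a, M1 k a = M1' k a) -> (forall l b, M2 l b = M2' l b) ->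
  (forall k l a b, D k l a b = D' k l a b) ->
  kernel_sum M1 M2 D = kernel_sum M1' M2' D'.
Proof.
move=> E1 E2 ED; apply: eq_bigr => -[[k l] [s1 s2]] _.
rewrite ED; congr (_ * (_ * _ * _)).
  by apply: eq_bigr => k' _; exact: E1.
by apply: eq_bigr => l' _; exact: E2.
Qed.

(** One of the two permutations can be absorbed by relabelling the rows. *)
Lemma weight_sum_det r (m : nat -> C) :
  weight_sum (fun (_ : 'I_r) a => m a) = r`!%:R * \det (\matrix_(i < r, j < r) m (i + j)%N).
Proof.
rewrite /weight_sum -(pair_bigA _ (fun s1 s2 : 'S_r =>
  pp_sign R (s1, s2) * \prod_k m (pp_exp (s1, s2) k)))/=.
rewrite -card_Sn -[#|_|]sum1_card natr_sum mulr_suml; apply: eq_bigr => s1 _.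
rewrite mul1r (reindex_inj (mulgI s1)) /determinant; apply: eq_bigr => t _.
rewrite /pp_sign /pp_exp/= odd_permM signr_addb mulrA -signr_addb addbb mul1r.
congr (_ * _); rewrite [RHS](reindex_inj (@perm_inj _ s1)).
by apply: eq_bigr => k _; rewrite mxE permM.
Qed.

Definition falling_poly (i : nat) : {poly C} := \prod_(t < i) ('X - (t%:R)%:P).

Lemma size_falling_poly i : size (falling_poly i) = i.+1.
Proof. by rewrite size_prod_XsubC /index_enum -enumT size_enum_ord. Qed.

Lemma horner_falling_poly i (l : nat) : (falling_poly i).[l%:R] = (l ^_ i)%:R.
Proof.
rewrite horner_prod ffact_prod natr_prod.
have [il|li] := leqP i l.
  apply: eq_bigr => t _; rewrite hornerXsubC natrB//.
  by rewrite (leq_trans _ il)// ltnW.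
rewrite (bigD1 (Ordinal li))//= hornerXsubC subrr mul0r.
by rewrite (bigD1 (Ordinal li))//= subnn mul0r.
Qed.

(** The falling factorials are monic of increasing degree, so this determinant
reduces to that of Vandermonde. *)
Lemma det_falling r (x : 'I_r -> C) :
  \det (\matrix_(i < r, j < r) (falling_poly i).[x j]) = \det (Vandermonde r (\row_j x j)).
Proof.
pose L := \matrix_(i < r, k < r) (falling_poly i)`_k.
have -> : \matrix_(i < r, j < r) (falling_poly i).[x j] = L *m Vandermonde r (\row_j x j).
  apply/matrixP => i j; rewrite !mxE (@horner_coef_wide _ r); last first.
    by rewrite size_falling_poly.
  by apply: eq_bigr => k _; rewrite !mxE.
rewrite det_mulmx det_trig ?big1 ?mul1r//.
  move=> i _; rewrite mxE.
  have /monicP : falling_poly i \is monic by exact: monic_prod_XsubC.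
  by rewrite /lead_coef size_falling_poly.
apply/is_trig_mxP => i k ik; rewrite mxE nth_default// size_falling_poly.
by [].
Qed.

(** With [l = n - 1 - j], the entry is
[T ^ (l - i) / (l - i)! = T ^ l / l! * (l ^_ i) * T ^ - i]: up to diagonal factors,
the matrix consists of falling factorials of distinct integers. *)
Lemma hankel_exp_residue_neq0 (T : R) (n r : nat) : T != 0 -> (r <= n)%N ->
  \det (\matrix_(i < r, j < r) exp_residue T ((i + j)%:Z - n%:Z)) != 0.
Proof.
move=> T0 rn.
pose l (j : 'I_r) := (n.-1 - j)%N.
have ln (j : 'I_r) : (j < n)%N by exact: leq_trans (ltn_ord j) rn.
pose c := real_complex R T; have c0 : c != 0 by rewrite fmorph_eq0.
have -> : \matrix_(i < r, j < r) exp_residue T ((i + j)%:Z - n%:Z) =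
    diag_mx (\row_i (c ^+ n.-1 * c ^- i)) *m
    (\matrix_(i < r, j < r) (falling_poly i).[(l j)%:R]) *m
    diag_mx (\row_j (c ^- j / ((l j)`!)%:R)).
  apply/matrixP => i j; rewrite mul_mx_diag mxE mul_diag_mx !mxE.
  rewrite horner_falling_poly.
  have fl0 : ((l j)`!)%:R != 0 :> C by rewrite pnatr_eq0 -lt0n fact_gt0.
  have [ij|ij] := ltnP (i + j) n; last first.
    rewrite ffact_small ?mulr0 ?mul0r; last first.
      by rewrite /l; move: ij (ln j); lia.
    by rewrite subzn.
  have E : ((i + j)%:Z - n%:Z) = Negz (l j - i).
    by rewrite NegzE /l; move: ij (ln j); lia.
  have il : (i <= l j)%N by rewrite /l; move: ij (ln j); lia.
  have F : n.-1 = (l j - i + i + j)%N by rewrite /l; move: ij (ln j); lia.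
  rewrite E /= rmorphM rmorphXn fmorphV rmorph_nat -/c F !exprD.
  have cX k : c ^+ k != 0 by rewrite expf_neq0.
  have := ffact_fact il => /(congr1 (fun k : nat => k%:R : C)); rewrite natrM => G.
  have d0 : ((l j - i)`!)%:R != 0 :> C by rewrite pnatr_eq0 -lt0n fact_gt0.
  rewrite -G in fl0 *.
  have f0 : ((l j) ^_ i)%:R != 0 :> C by move: fl0; rewrite mulf_eq0 negb_or => /andP[].
  by field; rewrite d0 f0 !cX.
rewrite !det_mulmx !det_diag det_falling det_Vandermonde !mulf_neq0//.
- by apply/prodf_neq0 => i _; rewrite mxE mulf_neq0 ?invr_eq0 ?expf_neq0//.
- apply/prodf_neq0 => i _; apply/prodf_neq0 => j ij; rewrite !mxE subr_eq0.
  by rewrite eqr_nat /l; move: ij (ln j); lia.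
- by apply/prodf_neq0 => i _; rewrite mxE mulf_neq0 ?invr_eq0 ?expf_neq0//.
Qed.

End WeightSums.

Section ZetaCovariance.
Variable R : realType.
Variable T : R.
Hypothesis T_gt0 : 0 < T.
Local Notation C := R[i].

Let T0 : T != 0. Proof. by rewrite gt_eqF. Qed.

Definition exp_weight (n : nat) (z : C) : C := cexp (real_complex R T * z) / z ^+ n.

Lemma exp_weightE n a (z : C) : z != 0 ->
  z ^+ a * exp_weight n z = laurent_exp T (a%:Z - n%:Z) z.
Proof.
move=> z0; rewrite /exp_weight /laurent_exp expfzDr// -exprnN -exprnP.
by rewrite mulrA mulrAC.
Qed.

Definition exp_moment (n a : nat) : C := two_pi_i R * exp_residue T (a%:Z - n%:Z).

Lemma cintegral_exp_weight (g : R -> C) n a : smooth_loop g -> encloses g 0 ->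
  cintegral g (fun z => z ^+ a * exp_weight n z) = exp_moment n a.
Proof.
move=> lg eg; have g0 := encloses_avoids eg.
rewrite /exp_moment -(cintegral_laurent_exp _ lg eg T0).
by apply: eq_cintegral => t t01; rewrite exp_weightE// g0.
Qed.

Lemma ccont_exp_weight (g : R -> C) n a : smooth_loop g -> encloses g 0 ->
  ccont_on g (fun z => z ^+ a * exp_weight n z).
Proof.
move=> lg eg t t01; have g0 := encloses_avoids eg t01.
have cg := smooth_loop_ccont lg; rewrite /exp_weight.
by ccont_arith; rewrite expf_neq0.
Qed.

Lemma weight_sum_exp_moment_neq0 (n r : nat) : (r <= n)%N ->
  weight_sum (fun (_ : 'I_r) a => exp_moment n a) != 0.
Proof.
move=> rn; rewrite weight_sum_det mulf_neq0//.
have -> : \matrix_(i < r, j < r) exp_moment n (i + j) =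
    two_pi_i R *: \matrix_(i < r, j < r) exp_residue T ((i + j)%:Z - n%:Z).
  by apply/matrixP => i j; rewrite !mxE.
by rewrite detZ mulf_neq0 ?expf_neq0 ?two_pi_i_neq0 ?hankel_exp_residue_neq0.
Qed.

Section Contours.
Variables (n1 r1 n2 r2 : nat) (g1 : 'I_r1 -> R -> C) (g2 : 'I_r2 -> R -> C).
Hypothesis cont : zeta_contours g1 g2.

Let lg1 k : smooth_loop (g1 k).
Proof. by case: cont => h _ _; apply: simple_loop_smooth; case: (h k). Qed.
Let lg2 l : smooth_loop (g2 l).
Proof. by case: cont => _ h _; apply: simple_loop_smooth; case: (h l). Qed.
Let eg1 k : encloses (g1 k) 0. Proof. by case: cont => h _ _; case: (h k). Qed.
Let eg2 l : encloses (g2 l) 0. Proof. by case: cont => _ h _; case: (h l). Qed.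
Let eg12 k l : encloses_loop (g1 k) (g2 l). Proof. by case: cont => _ _; exact. Qed.

Let gg0 k l (s t : R) : 0 <= s <= 1 -> 0 <= t <= 1 -> g1 k s - g2 l t != 0.
Proof. by move=> s01 t01; rewrite subr_eq0 (encloses_avoids (eg12 k l t01)). Qed.

Let inner k l a b (s : R) : 0 <= s <= 1 ->
  laurent_exp T a (g1 k s) *
    cintegral (g2 l) (fun w => laurent_exp T b w * (g1 k s - w)^-1) =
  cintegral (g2 l) (fun w =>
    (g1 k s - w)^-1 * laurent_exp T a (g1 k s) * laurent_exp T b w).
Proof.
move=> s01; rewrite -(cintegralZ (lg2 l)).
  by apply: eq_cintegral => t _; rewrite mulrA mulrC mulrA.
have cg := smooth_loop_ccont (lg2 l).
move=> t t01; apply: ccvgM.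
  by apply: ccont_laurent_exp => //; exact: encloses_avoids.
by ccont_arith; exact: gg0.
Qed.

Lemma cauchy_double_exp_weight k l a b :
  cintegral (g1 k) (fun z => z ^+ a * exp_weight n1 z *
    cintegral (g2 l) (fun w => w ^+ b * exp_weight n2 w * (z - w)^-1)) =
  cauchy_double T (g1 k) (g2 l) (a%:Z - n1%:Z) (b%:Z - n2%:Z).
Proof.
apply: eq_cintegral => s s01.
rewrite exp_weightE; last exact: encloses_avoids.
rewrite -inner//; congr (_ * _); apply: eq_cintegral => t t01.
by rewrite exp_weightE//; exact: encloses_avoids.
Qed.

(** Expanding the squared Vandermonde determinants separates all variables except
for the two that the kernel couples. *)
Lemma zeta_covE : zeta_cov T n1 n2 g1 g2 =
  kernel_sum (fun (_ : 'I_r1) a => exp_moment n1 a) (fun (_ : 'I_r2) b => exp_moment n2 b)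
    (fun k l a b => cauchy_double T (g1 k) (g2 l) (a%:Z - n1%:Z) (b%:Z - n2%:Z)) /
  (weight_sum (fun (_ : 'I_r1) a => exp_moment n1 a) *
   weight_sum (fun (_ : 'I_r2) b => exp_moment n2 b)).
Proof.
have W r n (g : 'I_r -> R -> C) : (forall k, smooth_loop (g k)) ->
    (forall k, encloses (g k) 0) ->
    mcintegral g (fun z => zeta_weight T n z) = weight_sum (fun (_ : 'I_r) a => exp_moment n a).
  move=> lg eg.
  have := mcintegral_weight 1 (y := id) (phi := exp_weight n) lg
    (fun k a => ccont_exp_weight n a (lg k) (eg k)).
  rewrite mul1r => H.
  transitivity (weight_sum (fun k a => cintegral (g k) (fun z => z ^+ a * exp_weight n z))).
    by rewrite -H; apply: eq_mcintegral => z _; rewrite mul1r.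
  by apply: eq_weight_sum => k a; exact: cintegral_exp_weight.
rewrite /zeta_cov (W _ _ _ lg1 eg1) (W _ _ _ lg2 eg2); congr (_ / _).
have cK k l b (t : R) : 0 <= t <= 1 ->
    ccont_on (g2 l) (fun w => w ^+ b * exp_weight n2 w * (g1 k t - w)^-1).
  move=> t01 u u01; apply: ccvgM; first exact: (ccont_exp_weight n2 b (lg2 l) (eg2 l) u01).
  have cg := smooth_loop_ccont (lg2 l).
  by ccont_arith; exact: gg0.
have cD k l b : ccont_on (g1 k) (fun z =>
    cintegral (g2 l) (fun w => w ^+ b * exp_weight n2 w * (z - w)^-1)).
  move=> s s01; have cg := smooth_loop_ccont (lg1 k).
  apply: (cintegral_cauchy_ccont (lg2 l) (f := g1 k)
    (psi := fun _ w => w ^+ b * exp_weight n2 w)); first exact: cg.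
  - by move=> t t01; exact: gg0.
  - move=> t t01; apply: (ccont_snd (p := (s, t))
      (f := fun t => g2 l t ^+ b * exp_weight n2 (g2 l t))).
    exact: (ccont_exp_weight n2 b (lg2 l) (eg2 l) t01).
  - by apply: filterE => u; exact: ccont_exp_weight.
have := mcintegral_kernel 1 1 (y1 := id) (y2 := id)
  (phi1 := exp_weight n1) (phi2 := exp_weight n2) (kappa := fun z w => (z - w)^-1)
  lg1 lg2 (fun k a => ccont_exp_weight n1 a (lg1 k) (eg1 k))
  (fun l b => ccont_exp_weight n2 b (lg2 l) (eg2 l)) cK cD.
rewrite !mul1r => H.
apply: (etrans _ (etrans H _)).
  by apply: eq_mcintegral => z _; apply: eq_mcintegral => w _; rewrite !mul1r.
apply: eq_kernel_sum => [k a|l b|k l a b]; [exact: cintegral_exp_weight..|].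
exact: cauchy_double_exp_weight.
Qed.

End Contours.

(** In [zeta_covE] the contours only occur in double integrals, which
[cauchy_double_universal] compares. *)
Lemma zeta_cov_universal n1 r1 n2 r2 (g1 g1' : 'I_r1 -> R -> C) (g2 g2' : 'I_r2 -> R -> C) :
  zeta_contours g1 g2 -> zeta_contours g1' g2' ->
  zeta_cov T n1 n2 g1 g2 = zeta_cov T n1 n2 g1' g2'.
Proof.
move=> c c'; apply: (etrans (zeta_covE _ _ c)); apply: (etrans _ (esym (zeta_covE _ _ c'))).
apply: (congr1 (fun x => x / _)); apply: eq_kernel_sum => [k a|l b|k l a b].
- exact: erefl.
- exact: erefl.
case: c => h1 h2 h12; case: c' => h1' h2' h12'.
have [[s1 e1] [s2 e2]] := (h1 k, h2 l); have [[s1' e1'] [s2' e2']] := (h1' k, h2' l).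
exact: (cauchy_double_universal T0 _ _ (simple_loop_smooth s1) (simple_loop_smooth s2)
  e1 e2 (h12 k l) (simple_loop_smooth s1') (simple_loop_smooth s2') e1' e2' (h12' k l)).
Qed.

End ZetaCovariance.

(** * Circles *)

Section Circles.
Variable R : realType.
Local Notation C := R[i].
Local Notation "x %:C" := (real_complex R x).
Implicit Types (c k p q : C) (s t : R).

Definition sqnorm q : R := complex.Re q ^+ 2 + complex.Im q ^+ 2.

Lemma sqnormM p q : sqnorm (p * q) = sqnorm p * sqnorm q.
Proof. by rewrite /sqnorm ReM ImM; ring. Qed.

Lemma sqnorm_real (x : R) : sqnorm x%:C = x ^+ 2.
Proof. by rewrite /sqnorm /= expr0n addr0. Qed.

Definition unit_circle t : C := cexp (two_pi_i R * t%:C).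

Lemma unit_circle_neq0 t : unit_circle t != 0. Proof. exact: cexp_neq0. Qed.

Lemma sqnorm_unit_circle t : sqnorm (unit_circle t) = 1.
Proof.
rewrite /sqnorm /= !exprMn -mulrDr cos2Dsin2 mulr1.
by rewrite !(mulr0, mul0r, subr0) ?subrr expR0 expr1n.
Qed.

Lemma unit_circle1 : unit_circle 1 = unit_circle 0.
Proof.
by apply: complex_eq; rewrite /= !(mulr0, mul0r, mulr1, addr0, subr0, add0r) mulr_natl
  oppr0 ?cos2pi ?sin2pi ?cos0 ?sin0.
Qed.

Lemma unit_circle_inj s t : 0 <= s < 1 -> 0 <= t < 1 ->
  unit_circle s = unit_circle t -> s = t.
Proof.
wlog st : s t / s <= t.
  by move=> W s01 t01 E; have [/W/(_ s01 t01 E)|/ltW/W/(_ t01 s01 (esym E))] := leP s t.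
move=> /andP[s0 s1] /andP[t0 t1] E; apply/eqP; rewrite eq_le st leNgt/=; apply/negP => lt_st.
have : unit_circle (t - s) = 1.
  apply: (mulfI (unit_circle_neq0 s)); rewrite mulr1 [RHS]E /unit_circle -cexpD.
  by congr cexp; rewrite rmorphB; ring.
move=> /(congr1 (fun z : C => complex.Re z)); rewrite /= !(mulr0, mul0r, addr0, subr0) expR0 mul1r add0r.
rewrite (_ : 2 * pi * (t - s) = (pi * (t - s)) *+ 2); last by ring.
rewrite cos_mulr2n => cE; have sE := cos2Dsin2 (pi * (t - s)).
have : sin (pi * (t - s)) ^+ 2 = 0 by lra.
apply/eqP; rewrite sqrf_eq0 gt_eqF//; apply: sin_gt0_pi.
rewrite mulr_gt0 ?pi_gt0 ?subr_gt0//= gtr_pMr ?pi_gt0//.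
by rewrite ltrBlDr ltr_wpDr.
Qed.

Definition circle c k t : C := c + k * unit_circle t.

Lemma cder_circle c k t : cder (circle c k) t (two_pi_i R * k * unit_circle t).
Proof.
apply: cder_eq.
  exact: (cderD (cder_cst c t) (cderM (cder_cst k t)
    (cder_cexp (cderM (cder_cst (two_pi_i R) t) (cder_real t))))).
by rewrite /unit_circle; cbv beta; ring.
Qed.

Lemma ccont_unit_circle t : ccvg (nbhs t) unit_circle (unit_circle t).
Proof. by rewrite /unit_circle; ccont_arith; split; [exact: cvg_id|exact: cvg_cst]. Qed.

Lemma velocity_circle c k t : velocity (circle c k) t = two_pi_i R * k * unit_circle t.
Proof.
have [[_ d1] [_ d2]] := cder_circle c k t.
by apply: complex_eq; rewrite /velocity /= derive1E ?d1 ?d2.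
Qed.

Lemma smooth_circle c k : smooth_loop (circle c k).
Proof.
split.
- by move=> t; rewrite velocity_circle; exact: cder_circle.
- move=> t; rewrite (_ : velocity _ = fun t => two_pi_i R * k * unit_circle t); last first.
    by apply/funext => u; exact: velocity_circle.
  by ccont_arith; exact: ccont_unit_circle.
- by rewrite /circle unit_circle1.
Qed.

Lemma simple_circle c k : k != 0 -> simple_loop (circle c k).
Proof.
move=> k0; have [d v g01] := smooth_circle c k.
split => //; last 1 first.
- by move=> s t s01 t01 /addrI/(mulfI k0); exact: unit_circle_inj.
- by split => [t|t]; [case: (d t) => -[]|case: (v t)].
- by split => [t|t]; [case: (d t) => _ []|case: (v t)].
Qed.

Lemma circle_avoids c k q : k != 0 -> sqnorm q != 1 -> avoids (circle c k) (c + k * q).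
Proof.
move=> k0 q1 t _; apply: contraNneq q1 => /addrI/(mulfI k0) <-.
by rewrite sqnorm_unit_circle.
Qed.

Lemma cintegral_circle_center c k : k != 0 ->
  cintegral (circle c k) (fun z => (z - c)^-1) = two_pi_i R.
Proof.
move=> k0; rewrite cintegralE; transitivity (cint01 (fun=> two_pi_i R)).
  apply: eq_cint01 => t _; rewrite velocity_circle /circle.
  field; rewrite addrC addKr mulf_neq0//; exact: unit_circle_neq0.
by apply: complex_eq; rewrite /= int01_cst.
Qed.

Let cc c k (t : R) : ccvg (nbhs t) (circle c k) (circle c k t).
Proof. exact: smooth_loop_ccont (smooth_circle c k) t. Qed.

(** Contracting the point to the centre. *)
Lemma circle_encloses c k q : k != 0 -> sqnorm q < 1 -> encloses (circle c k) (c + k * q).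
Proof.
move=> k0 q1; split.
  by move=> t t01; apply/eqP; exact: (circle_avoids _ k0 (negbT (lt_eqF q1)) t01).
suff E : cintegral (circle c k) (fun z => (z - (c + k * q))^-1) = two_pi_i R.
  by rewrite /winding E divff// two_pi_i_neq0.
have lg := smooth_circle c k; have [dg _ g01] := lg.
pose h (s : R) z := (z - c - s%:C * (k * q))^-1.
pose K (s : R) z := k * q / (z - c - s%:C * (k * q)) ^+ 2.
have n0 (s t : R) : 0 <= s <= 1 -> circle c k t - c - s%:C * (k * q) != 0.
  move=> /andP[s0 s1].
  rewrite (_ : _ - _ = k * (unit_circle t - s%:C * q)); last by rewrite /circle; ring.
  rewrite mulf_neq0// subr_eq0; apply/eqP => /(congr1 sqnorm).
  rewrite sqnorm_unit_circle sqnormM sqnorm_real => /esym/eqP; rewrite lt_eqF//.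
  by rewrite (le_lt_trans _ q1)// ler_piMl ?addr_ge0 ?sqr_ge0// expr_le1.
have i0 : 0 <= (0 : R) <= 1 by apply/andP; split; [exact: lexx|exact: ler01].
have i1 : 0 <= (1 : R) <= 1 by apply/andP; split; [exact: ler01|exact: lexx].
have ch (s : R) : 0 <= s <= 1 -> ccont_on (circle c k) (h s).
  by move=> s01 t t01; rewrite /h; ccont_arith; exact: n0.
have D : cintegral (circle c k) (h 1) = cintegral (circle c k) (h 0).
  apply: (cintegral_deformation lg (h := h) (k := K)); [| |exact: ch|exact: ch|].
  - move=> s t s01 t01; apply: cder_eq.
      apply: (cderV (n0 s t s01)).
      exact: (cderB (cder_cst (circle c k t - c) s) (cderM (cder_real s) (cder_cst (k * q) s))).
    by rewrite /K; cbv beta; field; exact: n0.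
  - move=> s t s01 t01; rewrite /K; ccont_arith.
    + by rewrite expf_neq0// n0.
    + exact: (ccont_snd (p := (s, t)) (cc c k t)).
    + by apply: (ccont_fst (p := (s, t))); split; [exact: cvg_id|exact: cvg_cst].
  - move=> s s01; apply: (cintegral_primitive lg
      (F := fun t => - (k * q) * (circle c k t - c - s%:C * (k * q))^-1)).
    + move=> t t01; apply: cder_eq.
        apply: (cderM (cder_cst _ t)); apply: (cderV (n0 s t s01)).
        exact: (cderB (cderB (dg t) (cder_cst c t)) (cder_cst (s%:C * (k * q)) t)).
      by rewrite /K; cbv beta; field; exact: n0.
    + by move=> t t01; rewrite /K; ccont_arith; rewrite expf_neq0// n0.
    + by rewrite g01.
rewrite -(cintegral_circle_center c k0).
transitivity (cintegral (circle c k) (h 1)).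
  by apply: eq_cintegral => t _; rewrite /h mul1r opprD addrA.
by rewrite D; apply: eq_cintegral => t _; rewrite /h mul0r subr0.
Qed.

(** Sending the point to infinity. *)
Lemma circle_excludes c k q : k != 0 -> 1 < sqnorm q -> excludes (circle c k) (c + k * q).
Proof.
move=> k0 q1; split.
  by move=> t t01; apply/eqP; exact: (circle_avoids _ k0 (negbT (gt_eqF q1)) t01).
suff E : cintegral (circle c k) (fun z => (z - (c + k * q))^-1) = 0.
  by rewrite /winding E mul0r.
have lg := smooth_circle c k; have [dg _ g01] := lg.
pose h (s : R) z := s%:C / (s%:C * (z - c) - k * q).
pose K (s : R) z := - (k * q) / (s%:C * (z - c) - k * q) ^+ 2.
have n0 (s t : R) : 0 <= s <= 1 -> s%:C * (circle c k t - c) - k * q != 0.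
  move=> /andP[s0 s1].
  rewrite (_ : _ - _ = k * (s%:C * unit_circle t - q)); last by rewrite /circle; ring.
  rewrite mulf_neq0// subr_eq0; apply/eqP => /(congr1 sqnorm).
  rewrite sqnormM sqnorm_unit_circle mulr1 sqnorm_real => /eqP; rewrite lt_eqF//.
  by rewrite (le_lt_trans _ q1)// expr_le1.
have i0 : 0 <= (0 : R) <= 1 by apply/andP; split; [exact: lexx|exact: ler01].
have i1 : 0 <= (1 : R) <= 1 by apply/andP; split; [exact: ler01|exact: lexx].
have ch (s : R) : 0 <= s <= 1 -> ccont_on (circle c k) (h s).
  by move=> s01 t t01; rewrite /h; ccont_arith; exact: n0.
have D : cintegral (circle c k) (h 1) = cintegral (circle c k) (h 0).
  apply: (cintegral_deformation lg (h := h) (k := K)); [| |exact: ch|exact: ch|].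
  - move=> s t s01 t01; apply: cder_eq.
      apply: (cderM (cder_real s)); apply: (cderV (n0 s t s01)).
      exact: (cderB (cderM (cder_real s) (cder_cst (circle c k t - c) s)) (cder_cst (k * q) s)).
    by rewrite /K; cbv beta; field; exact: n0.
  - move=> s t s01 t01; rewrite /K; ccont_arith.
    + by rewrite expf_neq0// n0.
    + by apply: (ccont_fst (p := (s, t))); split; [exact: cvg_id|exact: cvg_cst].
    + exact: (ccont_snd (p := (s, t)) (cc c k t)).
  - move=> s s01; apply: (cintegral_primitive lg
      (F := fun t => (circle c k t - c) * (s%:C * (circle c k t - c) - k * q)^-1)).
    + move=> t t01; apply: cder_eq.
        apply: (cderM (cderB (dg t) (cder_cst c t))); apply: (cderV (n0 s t s01)).
        exact: (cderB (cderM (cder_cst s%:C t) (cderB (dg t) (cder_cst c t)))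
          (cder_cst (k * q) t)).
      by rewrite /K; cbv beta; field; exact: n0.
    + by move=> t t01; rewrite /K; ccont_arith; rewrite expf_neq0// n0.
    + by rewrite g01.
transitivity (cintegral (circle c k) (h 1)).
  by apply: eq_cintegral => t _; rewrite /h !mul1r opprD addrA.
rewrite D -[RHS](cintegral0 lg); apply: eq_cintegral => t _.
by rewrite /h mul0r.
Qed.

Lemma cintegral_circle_affine c k (rho : R) (f : C -> C) :
  ccont_on (circle 0 rho%:C) (fun u => f (c + k * u)) ->
  cintegral (circle c (k * rho%:C)) f =
  k * cintegral (circle 0 rho%:C) (fun u => f (c + k * u)).
Proof.
move=> cf; apply: (etrans _ (cintegralZ (smooth_circle 0 rho%:C) k cf)).
rewrite !cintegralE; apply: eq_cint01 => t _; rewrite !velocity_circle.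
rewrite (_ : circle c (k * rho%:C) t = c + k * circle 0 rho%:C t); first by ring.
by rewrite /circle; ring.
Qed.

End Circles.

(** * The rescaled covariance and its limit *)

Section RescaledCovariance.
Variable R : realType.
Variable T : R.
Hypothesis T_gt0 : 0 < T.
Local Notation C := R[i].
Local Notation "x %:C" := (real_complex R x).
Implicit Types (e rho s t L : R) (u v z w : C).

Definition circ rho : R -> C := circle 0 rho%:C.

(** With [e = 1 / L], this is the weight of [xi (L T)] in the coordinate
[u = L (1 - z)], up to a constant factor. *)
Definition eps_weight (n r : nat) e u : C := exp_weight T n u * ((1 - e%:C * u) ^+ r)^-1.

Lemma smooth_circ rho : smooth_loop (circ rho). Proof. exact: smooth_circle. Qed.

Lemma circ_neq0 rho t : 0 < rho -> circ rho t != 0.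
Proof.
by move=> r0; rewrite /circ /circle add0r mulf_neq0 ?unit_circle_neq0// fmorph_eq0 gt_eqF.
Qed.

Lemma sqnorm_circ rho t : sqnorm (circ rho t) = rho ^+ 2.
Proof. by rewrite /circ /circle add0r sqnormM sqnorm_unit_circle sqnorm_real mulr1. Qed.

Lemma one_sub_neq0 e rho t : `|e| < 4^-1 -> 0 < rho <= 2 -> 1 - e%:C * circ rho t != 0.
Proof.
move=> /ltr_normlP[e1 e2] /andP[r0 r2]; rewrite subr_eq0; apply/eqP => /(congr1 (@sqnorm R)).
rewrite sqnormM sqnorm_circ sqnorm_real /sqnorm /= expr0n addr0 expr1n => E.
have : e ^+ 2 < 16^-1 by nra.
have : rho ^+ 2 <= 4 by nra.
move: E; set x := e ^+ 2; set y := rho ^+ 2 => E y4 x16.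
have x0 : 0 <= x by exact: sqr_ge0.
have y0 : 0 <= y by exact: sqr_ge0.
nra.
Qed.

Lemma ccont_eps_weight n r a rho e t : `|e| < 4^-1 -> 0 < rho <= 2 ->
  ccont (fun p : R * R => circ rho p.2 ^+ a * eps_weight n r p.1 (circ rho p.2)) (e, t).
Proof.
move=> e4 r2; have cc := ccont_snd (p := (e, t)) (smooth_loop_ccont (smooth_circ rho) t).
have ce : ccvg (nbhs (e, t)) (fun q : R * R => q.1%:C) (e, t).1%:C.
  by apply: (ccont_fst (p := (e, t))); split; [exact: cvg_id|exact: cvg_cst].
case/andP: (r2) => r0 _; rewrite /eps_weight /exp_weight; ccont_arith.
- by rewrite expf_neq0 ?circ_neq0.
- by rewrite expf_neq0// one_sub_neq0.
Qed.

Lemma ccont_on_eps_weight n r a rho e : `|e| < 4^-1 -> 0 < rho <= 2 ->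
  ccont_on (circ rho) (fun u => u ^+ a * eps_weight n r e u).
Proof.
move=> e4 r2 t _; apply: (@ccont_comp _ _ _ (fun t => (e, t))
  (fun p : R * R => circ rho p.2 ^+ a * eps_weight n r p.1 (circ rho p.2))).
  by apply: continuous_for_pair; [exact: cvg_cst|exact: cvg_id].
exact: ccont_eps_weight.
Qed.

Lemma near_small : \forall e \near (0 : R), `|e| < 4^-1.
Proof.
have : (0 : R) < 4^-1 by rewrite invr_gt0.
move=> h; have := @nbhs0_lt R R _ h; exact.
Qed.

Definition eps_moment (n r : nat) rho e (a : nat) : C :=
  cintegral (circ rho) (fun u => u ^+ a * eps_weight n r e u).

Lemma eps_moment_ccont n r rho a : 0 < rho <= 2 ->
  ccont (fun e => eps_moment n r rho e a) 0.
Proof.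
move=> r2; apply: (cintegral_ccont (smooth_circ rho)
  (K := fun e u => u ^+ a * eps_weight n r e u)).
  by move=> t _; apply: ccont_eps_weight => //; rewrite normr0 invr_gt0.
by apply: filterS near_small => e e4; exact: ccont_on_eps_weight.
Qed.

Lemma encloses_circ rho : 0 < rho -> encloses (circ rho) 0.
Proof.
move=> r0; rewrite (_ : 0 = 0 + rho%:C * 0); last by rewrite mulr0 addr0.
apply: circle_encloses; first by rewrite fmorph_eq0 gt_eqF.
by rewrite /sqnorm /= expr0n addr0.
Qed.

Lemma zeta_contours_circ r1 r2 :
  zeta_contours (fun _ : 'I_r1 => circ 2) (fun _ : 'I_r2 => circ 1).
Proof.
have n0 (x : R) : 0 < x -> x%:C != 0 by move=> x0; rewrite fmorph_eq0 gt_eqF.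
split=> [_|_|_ _ t t01].
- by split; [apply: simple_circle; exact: n0|exact: encloses_circ].
- by split; [apply: simple_circle; exact: n0|exact: encloses_circ].
- rewrite (_ : circ 1 t = 0 + 2%:C * (2%:C^-1 * unit_circle t)); last first.
    by rewrite /circ /circle !add0r mulVKf ?n0// rmorph1 mul1r.
  apply: circle_encloses; first exact: n0.
  rewrite sqnormM sqnorm_unit_circle mulr1 -fmorphV sqnorm_real.
  by rewrite expr_lt1// invf_lt1// ltr1n.
Qed.

Lemma eps_moment0 n r rho a : 0 < rho -> eps_moment n r rho 0 a = exp_moment T n a.
Proof.
move=> r0; rewrite -(cintegral_exp_weight T_gt0 n a (smooth_circ rho) (encloses_circ r0)).
apply: eq_cintegral => t _; rewrite /eps_weight mul0r subr0 expr1n invr1 mulr1.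
by [].
Qed.

Section Double.
Variables n1 r1 n2 r2 : nat.

Definition eps_inner (b : nat) e u : C :=
  cintegral (circ 1) (fun v => v ^+ b * eps_weight n2 r2 e v * (1 - e%:C * u) * (u - v)^-1).

Definition eps_double e (a b : nat) : C :=
  cintegral (circ 2) (fun u => u ^+ a * eps_weight n1 r1 e u * eps_inner b e u).

Let i1 : 0 < (1 : R) <= 2. Proof. by rewrite ltr01 ler1n. Qed.
Let i2 : 0 < (2 : R) <= 2. Proof. by rewrite ltr0n lexx. Qed.

Lemma circ_sub_neq0 s t : circ 2 s - circ 1 t != 0.
Proof.
rewrite subr_eq0; apply/eqP => /(congr1 (@sqnorm R)); rewrite !sqnorm_circ expr1n.
by apply/eqP; rewrite gt_eqF// expr_gt1// ltr1n.
Qed.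

Lemma ccont_eps_inner b e s : `|e| < 4^-1 ->
  ccont (fun p : R * R => eps_inner b p.1 (circ 2 p.2)) (e, s).
Proof.
move=> e4; have cc := ccont_snd (p := (e, s)) (smooth_loop_ccont (smooth_circ 2) s).
have small : \forall p \near (e, s), `|p.1| < 4^-1.
  have : \forall x \near e, `|x| < 4^-1.
    by have /cvgr_lt/(_ _ e4) := @norm_continuous _ R e.
  move=> h; have : (fst : R * R -> R) x @[x --> (e, s)] --> e by exact: cvg_fst.
  by move/(_ _ h).
apply: (cintegral_cauchy_ccont (smooth_circ 1) (f := fun p : R * R => circ 2 p.2)
  (psi := fun p v => v ^+ b * eps_weight n2 r2 p.1 v * (1 - p.1%:C * circ 2 p.2))).
- exact: cc.
- by move=> t _; exact: circ_sub_neq0.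
- move=> t t01; apply: ccvgM.
    apply: (@ccont_comp _ _ _ (fun p : (R * R) * R => (p.1.1, p.2))
      (fun p : R * R => circ 1 p.2 ^+ b * eps_weight n2 r2 p.1 (circ 1 p.2))).
      apply: continuous_for_pair; last exact: cvg_snd.
      by apply: continuous_comp; [exact: cvg_fst|exact: cvg_fst].
    exact: ccont_eps_weight.
  apply: (ccont_fst (p := ((e, s), t)) (f := fun p : R * R => 1 - p.1%:C * circ 2 p.2)).
  ccont_arith.
  by apply: (ccont_fst (p := (e, s))); split; [exact: cvg_id|exact: cvg_cst].
- apply: filterS small => p p4 t t01; apply: ccvgM; last exact: ccvg_cst.
  exact: (ccont_on_eps_weight n2 r2 b p4 i1 t01).
Qed.

Lemma eps_double_ccont a b : ccont (fun e => eps_double e a b) 0.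
Proof.
have K e s : `|e| < 4^-1 -> ccont (fun p : R * R =>
    circ 2 p.2 ^+ a * eps_weight n1 r1 p.1 (circ 2 p.2) * eps_inner b p.1 (circ 2 p.2)) (e, s).
  by move=> e4; apply: ccvgM; [exact: ccont_eps_weight|exact: ccont_eps_inner].
apply: (cintegral_ccont (smooth_circ 2)
  (K := fun e u => u ^+ a * eps_weight n1 r1 e u * eps_inner b e u)).
  by move=> t _; apply: K; rewrite normr0 invr_gt0.
apply: filterS near_small => e e4 t _.
apply: (@ccont_comp _ _ _ (fun t => (e, t)) (fun p : R * R =>
    circ 2 p.2 ^+ a * eps_weight n1 r1 p.1 (circ 2 p.2) * eps_inner b p.1 (circ 2 p.2))).
  by apply: continuous_for_pair; [exact: cvg_cst|exact: cvg_id].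
exact: K.
Qed.

Lemma eps_double0 a b :
  eps_double 0 a b = cauchy_double T (circ 2) (circ 1) (a%:Z - n1%:Z) (b%:Z - n2%:Z).
Proof.
have H := @cauchy_double_exp_weight R T n1 1 n2 1 _ _ (zeta_contours_circ 1 1) ord0 ord0 a b.
apply: (etrans _ H).
apply: eq_cintegral => s _; rewrite /eps_weight mul0r subr0 expr1n invr1 mulr1.
congr (_ * _); apply: eq_cintegral => t _.
by rewrite /eps_weight !mul0r !subr0 expr1n invr1 !mulr1.
Qed.

(** With [e = 1 / L], this is the covariance of [L^-1/2 xi (L T)], as [xi_cov_circ]
shows; the expression still makes sense for [e = 0]. *)
Definition eps_cov e : C :=
  kernel_sum (fun (_ : 'I_r1) a => eps_moment n1 r1 2 e a)
    (fun (_ : 'I_r2) b => eps_moment n2 r2 1 e b) (fun _ _ a b => eps_double e a b) /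
  (weight_sum (fun (_ : 'I_r1) a => eps_moment n1 r1 2 e a) *
   weight_sum (fun (_ : 'I_r2) b => eps_moment n2 r2 1 e b)).

Lemma eps_cov0 : eps_cov 0 =
  zeta_cov T n1 n2 (fun _ : 'I_r1 => circ 2) (fun _ : 'I_r2 => circ 1).
Proof.
apply: (etrans _ (esym (zeta_covE T_gt0 n1 n2 (zeta_contours_circ r1 r2)))).
have r02 : 0 < (2 : R) by [].
have r01 : 0 < (1 : R) by [].
have E1 := fun a => eps_moment0 n1 r1 a r02.
have E2 := fun a => eps_moment0 n2 r2 a r01.
rewrite /eps_cov (eq_weight_sum (M' := fun (_ : 'I_r1) a => exp_moment T n1 a)); last by [].
rewrite (eq_weight_sum (M' := fun (_ : 'I_r2) a => exp_moment T n2 a)); last by [].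
apply: (congr1 (fun x => x / _)); apply: eq_kernel_sum => // _ _ a b.
exact: eps_double0.
Qed.

(** The denominators have nonzero limits by [weight_sum_exp_moment_neq0]. *)
Lemma eps_cov_ccont : (r1 <= n1)%N -> (r2 <= n2)%N -> ccont eps_cov 0.
Proof.
move=> rn1 rn2.
have c1 a := eps_moment_ccont n1 r1 a i2.
have c2 b := eps_moment_ccont n2 r2 b i1.
have ws r (M : R -> nat -> C) : (forall a, ccont (fun e => M e a) 0) ->
    ccont (fun e => weight_sum (fun (_ : 'I_r) a => M e a)) 0.
  move=> cM; apply: ccvg_sum => s _; apply: ccvgM; first exact: ccvg_cst.
  by apply: ccvg_prod => k _; exact: cM.
have w1 := ws r1 _ c1; have w2 := ws r2 _ c2.
have nz n r rho : 0 < rho -> (r <= n)%N ->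
    weight_sum (fun (_ : 'I_r) a => eps_moment n r rho 0 a) != 0.
  move=> rho0 rn; rewrite (eq_weight_sum (M' := fun (_ : 'I_r) a => exp_moment T n a)).
    exact: weight_sum_exp_moment_neq0.
  by move=> _ a; exact: eps_moment0.
apply: ccvgM; last first.
  by apply: ccvgV; [rewrite mulf_neq0// nz|exact: ccvgM].
apply: ccvg_sum => -[[k l] [s1 s2]] _; apply: ccvgM; first exact: ccvg_cst.
apply: ccvgM; last exact: eps_double_ccont.
by apply: ccvgM; apply: ccvg_prod => j _; [exact: c1|exact: c2].
Qed.

End Double.
End RescaledCovariance.

(** * The covariance of the rescaled field on contours of size [1 / L] *)

Section XiCovariance.
Variable R : realType.
Variables T L e : R.
Hypothesis T_gt0 : 0 < T.
Hypothesis L_gt4 : 4 < L.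
Hypothesis eL : e = L^-1.
Local Notation C := R[i].
Local Notation "x %:C" := (real_complex R x).
Implicit Types (rho t : R) (u v z w : C).

Let L0 : 0 < L. Proof. exact: lt_trans L_gt4. Qed.
Let LC0 : L%:C != 0. Proof. by rewrite fmorph_eq0 gt_eqF. Qed.
Let e0 : 0 < e. Proof. by rewrite eL invr_gt0. Qed.
Let eC0 : e%:C != 0. Proof. by rewrite fmorph_eq0 gt_eqF. Qed.
Let eLC : e%:C = L%:C^-1. Proof. by rewrite eL fmorphV. Qed.
Let e4 : `|e| < 4^-1.
Proof. by rewrite eL ger0_norm ?invr_ge0 ?ltW// ltf_pV2// posrE. Qed.
Let i1 : 0 < (1 : R) <= 2. Proof. by rewrite ltr01 ler1n. Qed.
Let i2 : 0 < (2 : R) <= 2. Proof. by rewrite ltr0n lexx. Qed.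

(** The image of the circle [|u| = rho] under [z = 1 - u / L]. *)
Definition xi_circ rho : R -> C := circle 1 (- e%:C * rho%:C).

Lemma xi_circE rho t : xi_circ rho t = 1 - e%:C * circ rho t.
Proof. by rewrite /xi_circ /circ /circle; ring. Qed.

Lemma smooth_xi_circ rho : smooth_loop (xi_circ rho). Proof. exact: smooth_circle. Qed.

Lemma xi_contours_circ r1 r2 :
  xi_contours (fun _ : 'I_r1 => xi_circ 2) (fun _ : 'I_r2 => xi_circ 1).
Proof.
have n0 (x : R) : 0 < x -> - e%:C * x%:C != 0.
  by move=> x0; rewrite mulf_neq0 ?oppr_eq0// fmorph_eq0 gt_eqF.
have e2 : e ^+ 2 < 16^-1.
  have H (x : R) : 0 < x -> x < 4^-1 -> x ^+ 2 < 16^-1 by move=> *; nra.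
  by apply: H; [|move: e4 => /ltr_normlP[]].
have S (rho : R) : 0 < rho <= 2 -> [/\ simple_loop (xi_circ rho),
    encloses (xi_circ rho) 1 & excludes (xi_circ rho) 0].
  move=> /andP[rho0 rho2]; split.
  - by apply: simple_circle; exact: n0.
  - rewrite (_ : 1 = 1 + (- e%:C * rho%:C) * 0); last by rewrite mulr0 addr0.
    apply: circle_encloses; first exact: n0.
    by rewrite /sqnorm /= expr0n addr0.
  - rewrite (_ : 0 = 1 + (- e%:C * rho%:C) * (e * rho)^-1%:C); last first.
      have rhoC0 : rho%:C != 0 by rewrite fmorph_eq0 gt_eqF.
      by rewrite fmorphV rmorphM; field; rewrite eC0 rhoC0.
    apply: circle_excludes; first exact: n0.
    rewrite sqnorm_real exprVn invf_gt1; last by rewrite exprn_gt0// mulr_gt0.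
    have r4 : rho ^+ 2 <= 4 by nra.
    rewrite exprMn; have := ler_pM (sqr_ge0 e) (sqr_ge0 rho) (ltW e2) r4.
    by move/le_lt_trans; apply; rewrite -[16]/(4 * 4)%:R natrM invfM mulrVK ?unitfE// invf_lt1// ltr1n.
split=> [_|_|_ _ t t01]; [exact: S|exact: S|].
rewrite (_ : xi_circ 1 t = 1 + (- e%:C * 2%:C) * (2%:C^-1 * unit_circle t)); last first.
  have h2 : 2%:C != 0 by rewrite fmorph_eq0.
  by rewrite /xi_circ /circle rmorph1; field.
apply: circle_encloses; first exact: n0.
rewrite sqnormM sqnorm_unit_circle mulr1 -fmorphV sqnorm_real.
by rewrite expr_lt1// invf_lt1// ltr1n.
Qed.

Lemma cintegral_xi_circ rho (f : C -> C) :
  ccont_on (circ rho) (fun u => f (1 - e%:C * u)) ->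
  cintegral (xi_circ rho) f = - e%:C * cintegral (circ rho) (fun u => f (1 - e%:C * u)).
Proof.
move=> cf; have E u : 1 + - e%:C * u = 1 - e%:C * u by rewrite mulNr.
apply: (etrans (cintegral_circle_affine (k := - e%:C) (c := 1) _)).
  by move=> t t01; under [X in ccont X]eq_fun do rewrite E; exact: cf.
by congr (_ * _); apply: eq_cintegral => t _; rewrite E.
Qed.

Definition xi_weight (n r : nat) z : C :=
  (z ^+ r)^-1 * (cexp (- (z * (L * T)%:C)) / (1 - z) ^+ n).

Definition xi_coord z : C := L%:C * (1 - z).

Lemma xi_coordE u : xi_coord (1 - e%:C * u) = u.
Proof.
by rewrite /xi_coord opprB addrC subrK eLC mulVKf.
Qed.

(** The constant that [xi_weight] acquires in the coordinate [u]. *)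
Definition xi_scale (n : nat) : C := cexp (- (L * T)%:C) * L%:C ^+ n.

Lemma xi_scale_neq0 n : xi_scale n != 0.
Proof. by rewrite mulf_neq0 ?cexp_neq0// expf_neq0. Qed.

Lemma xi_weightE n r u :
  xi_weight n r (1 - e%:C * u) = xi_scale n * eps_weight T n r e u.
Proof.
rewrite /xi_weight /eps_weight /exp_weight /xi_scale.
have -> : 1 - (1 - e%:C * u) = e%:C * u by ring.
have -> : - ((1 - e%:C * u) * (L * T)%:C) = - (L * T)%:C + T%:C * u.
  by rewrite rmorphM /= eLC; field.
rewrite cexpD exprMn invfM eLC exprVn invrK.
by rewrite mulrC -!mulrA; congr (_ * _); rewrite [_ * (L%:C ^+ n * _)]mulrCA !mulrA.
Qed.

Definition frakF_scale (r : nat) : C :=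
  (-1) ^+ (r * r.+1)./2 / (two_pi_i R ^+ r * (r`!)%:R) *
  (\prod_(k < r) \prod_(l < r | (k < l)%N) L%:C ^+ 2)^-1.

Lemma frakF_scale_neq0 r : frakF_scale r != 0.
Proof.
rewrite /frakF_scale !mulf_neq0 ?signr_eq0 ?invr_eq0//.
  by rewrite mulf_neq0 ?expf_neq0 ?two_pi_i_neq0// pnatr_eq0 -lt0n fact_gt0.
by apply/prodf_neq0 => k _; apply/prodf_neq0 => l _; rewrite expf_neq0.
Qed.

Lemma frakFE n r (z : 'I_r -> C) : frakF (L * T) n z =
  frakF_scale r * (sq_vandermonde (fun k => xi_coord (z k)) *
    \prod_k xi_weight n r (z k)).
Proof.
have V : sq_vandermonde (fun k => xi_coord (z k)) =
    (\prod_(k < r) \prod_(l < r | (k < l)%N) L%:C ^+ 2) * sq_vandermonde z.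
  rewrite -big_split/=; apply: eq_bigr => k _; rewrite -big_split/=.
  by apply: eq_bigr => l _; rewrite /xi_coord; ring.
have W : \prod_k xi_weight n r (z k) = (\prod_k z k ^+ r)^-1 *
    \prod_k (cexp (- (z k * (L * T)%:C)) / (1 - z k) ^+ n).
  by rewrite -prodfV -big_split.
have P0 : \prod_(k < r) \prod_(l < r | (k < l)%N) L%:C ^+ 2 != 0.
  by apply/prodf_neq0 => k _; apply/prodf_neq0 => l _; rewrite expf_neq0.
rewrite V W /frakF /frakF_scale; move: P0.
move: (\prod_(k < r) \prod_(l < r | _) L%:C ^+ 2) => P P0.
move: (\prod_k (cexp _ / _)) => X; move: (sq_vandermonde z) => S.
rewrite [in LHS]invfM; move: (_^-1) (_^-1) => a b.
by rewrite !mulrA; field.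
Qed.

Let xi_neq0 rho t : 0 < rho <= 2 -> 1 - e%:C * circ rho t != 0.
Proof. exact: one_sub_neq0. Qed.

Lemma ccont_on_xi_weight n r a rho : 0 < rho <= 2 ->
  ccont_on (xi_circ rho) (fun z => xi_coord z ^+ a * xi_weight n r z).
Proof.
move=> r2 t _; have cc := smooth_loop_ccont (smooth_xi_circ rho) t.
have z0 : xi_circ rho t != 0 by rewrite xi_circE xi_neq0.
have z1 : 1 - xi_circ rho t != 0.
  rewrite xi_circE opprB addrC subrK mulf_neq0//.
  by case/andP: r2 => r0 _; exact: circ_neq0.
by rewrite /xi_coord /xi_weight; ccont_arith; rewrite expf_neq0.
Qed.

Let xi_termE n r a u : xi_coord (1 - e%:C * u) ^+ a * xi_weight n r (1 - e%:C * u) =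
  xi_scale n * (u ^+ a * eps_weight T n r e u).
Proof. by rewrite xi_coordE xi_weightE mulrCA. Qed.

Definition xi_factor n : C := - e%:C * xi_scale n.

Lemma xi_factor_neq0 n : xi_factor n != 0.
Proof. by rewrite mulf_neq0 ?oppr_eq0 ?xi_scale_neq0. Qed.

Lemma cintegral_xi_weight n r a rho : 0 < rho <= 2 ->
  cintegral (xi_circ rho) (fun z => xi_coord z ^+ a * xi_weight n r z) =
  xi_factor n * eps_moment T n r rho e a.
Proof.
move=> r2; have cw := ccont_on_eps_weight T n r a e4 r2.
rewrite cintegral_xi_circ; last first.
  move=> t t01; under [X in ccont X]eq_fun do rewrite xi_termE.
  by apply: ccvgM; [exact: ccvg_cst|exact: (cw t t01)].
rewrite /xi_factor -mulrA -(cintegralZ (smooth_circ rho) _ cw).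
by congr (_ * _); apply: eq_cintegral => t _; exact: xi_termE.
Qed.

Section Kernel.
Variables n1 r1 n2 r2 : nat.

Let xi_sub s t : xi_circ 2 s - xi_circ 1 t = - e%:C * (circ 2 s - circ 1 t).
Proof. by rewrite !xi_circE; ring. Qed.

Let xi_sub_neq0 s t : xi_circ 2 s - xi_circ 1 t != 0.
Proof. by rewrite xi_sub mulf_neq0 ?oppr_eq0// circ_sub_neq0. Qed.

Let ccont_xi_kernel b s :
  ccont_on (xi_circ 1) (fun w => xi_coord w ^+ b * xi_weight n2 r2 w *
    (- xi_circ 2 s * (xi_circ 2 s - w)^-1)).
Proof.
move=> t t01; apply: ccvgM; first exact: (ccont_on_xi_weight n2 r2 b i1 t01).
have cc := smooth_loop_ccont (smooth_xi_circ 1) t.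
by ccont_arith; exact: xi_sub_neq0.
Qed.

Let xi_inner b s :
  cintegral (xi_circ 1) (fun w => xi_coord w ^+ b * xi_weight n2 r2 w *
    (- xi_circ 2 s * (xi_circ 2 s - w)^-1)) =
  xi_factor n2 * L%:C * eps_inner T n2 r2 b e (circ 2 s).
Proof.
have cw : ccont_on (circ 1) (fun v =>
    v ^+ b * eps_weight T n2 r2 e v * (1 - e%:C * circ 2 s) * (circ 2 s - v)^-1).
  move=> t t01; apply: ccvgM; last first.
    have cc := smooth_loop_ccont (smooth_circ 1) t.
    by ccont_arith; exact: circ_sub_neq0.
  by apply: ccvgM; [exact: (ccont_on_eps_weight T n2 r2 b e4 i1 t01)|exact: ccvg_cst].
rewrite cintegral_xi_circ; last first.
  move=> t t01; have := ccont_xi_kernel b s t01.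
  by under [X in ccont X]eq_fun do rewrite xi_circE.
rewrite /xi_factor -[- e%:C * xi_scale n2 * L%:C]mulrA -[RHS]mulrA; congr (_ * _).
rewrite /eps_inner -(cintegralZ (smooth_circ 1) _ cw).
apply: eq_cintegral => t _; rewrite xi_termE -[1 - e%:C * circ 1 t]xi_circE xi_sub.
have uv := circ_sub_neq0 s t.
rewrite xi_circE eLC; move: (circ 1 t ^+ b * _) => X.
by field; rewrite uv LC0.
Qed.

Let ccont_eps_inner_circ b s : ccont (fun s => eps_inner T n2 r2 b e (circ 2 s)) s.
Proof.
apply: (@ccont_comp _ _ _ (fun s => (e, s))
  (fun p : R * R => eps_inner T n2 r2 b p.1 (circ 2 p.2))).
  by apply: continuous_for_pair; [exact: cvg_cst|exact: cvg_id].
exact: ccont_eps_inner.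
Qed.

Let xi_double a b :
  cintegral (xi_circ 2) (fun z => xi_coord z ^+ a * xi_weight n1 r1 z *
    cintegral (xi_circ 1) (fun w => xi_coord w ^+ b * xi_weight n2 r2 w *
      (- z * (z - w)^-1))) =
  xi_factor n1 * xi_factor n2 * L%:C * eps_double T n1 r1 n2 r2 e a b.
Proof.
have cw : ccont_on (circ 2) (fun u =>
    u ^+ a * eps_weight T n1 r1 e u * eps_inner T n2 r2 b e u).
  move=> s s01; apply: ccvgM; last exact: ccont_eps_inner_circ.
  exact: (ccont_on_eps_weight T n1 r1 a e4 i2 s01).
have E u s : u = circ 2 s -> xi_coord (1 - e%:C * u) ^+ a * xi_weight n1 r1 (1 - e%:C * u) *
    cintegral (xi_circ 1) (fun w => xi_coord w ^+ b * xi_weight n2 r2 w *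
      (- (1 - e%:C * u) * (1 - e%:C * u - w)^-1)) =
    xi_scale n1 * xi_factor n2 * L%:C *
      (u ^+ a * eps_weight T n1 r1 e u * eps_inner T n2 r2 b e u).
  move=> ->; rewrite xi_termE -xi_circE xi_inner.
  move: (_ ^+ a * _) (eps_inner _ _ _ _ _ _) (xi_scale _) (xi_factor _) => A B S F.
  ring.
rewrite cintegral_xi_circ; last first.
  move=> s s01; under [X in ccont X]eq_fun do rewrite (E _ _ erefl).
  by apply: ccvgM; [exact: ccvg_cst|exact: (cw s s01)].
rewrite /eps_double [RHS](_ : _ = - e%:C * (xi_scale n1 * xi_factor n2 * L%:C *
    cintegral (circ 2) (fun u => u ^+ a * eps_weight T n1 r1 e u * eps_inner T n2 r2 b e u)));
  last by rewrite {1}/xi_factor !mulrA.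
congr (_ * _); rewrite -(cintegralZ (smooth_circ 2) _ cw).
by apply: eq_cintegral => s _; exact: E.
Qed.

Lemma weight_sumZ r (c : C) (M : 'I_r -> nat -> C) :
  weight_sum (fun k a => c * M k a) = c ^+ r * weight_sum M.
Proof.
rewrite /weight_sum mulr_sumr; apply: eq_bigr => s _.
by rewrite big_split/= prodr_const card_ord mulrCA.
Qed.

Lemma kernel_sumZ (c1 c2 c : C) (M1 : 'I_r1 -> nat -> C) (M2 : 'I_r2 -> nat -> C)
    (D : 'I_r1 -> 'I_r2 -> nat -> nat -> C) :
  kernel_sum (fun k a => c1 * M1 k a) (fun l b => c2 * M2 l b)
    (fun k l a b => c1 * c2 * c * D k l a b) =
  c1 ^+ r1 * c2 ^+ r2 * c * kernel_sum M1 M2 D.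
Proof.
rewrite /kernel_sum mulr_sumr; apply: eq_bigr => -[[k l] [s1 s2]] _.
rewrite !big_split/=.
have P r (x : C) (k0 : 'I_r) : x ^+ r = x * \prod_(i | i != k0) x.
  by rewrite -{1}(card_ord r) -prodr_const (bigD1 k0).
rewrite (P _ c1 k) (P _ c2 l); ring.
Qed.

(** In the coordinate [u] the kernel [- z / (z - w)] is [L (1 - e u) / (u - v)], which is
where the factor [L] comes from; all other constants occur in the numerator and
in the denominator with the same exponents. *)
Lemma xi_cov_circ :
  xi_cov (L * T) n1 n2 (fun _ : 'I_r1 => xi_circ 2) (fun _ : 'I_r2 => xi_circ 1) =
  L%:C * eps_cov T n1 r1 n2 r2 e.
Proof.
have W n r rho : 0 < rho <= 2 ->
    mcintegral (fun _ : 'I_r => xi_circ rho) (fun z : 'I_r -> C => frakF (L * T) n z) =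
    frakF_scale r * (xi_factor n ^+ r * weight_sum (fun (_ : 'I_r) a => eps_moment T n r rho e a)).
  move=> rho2.
  have H := mcintegral_weight (frakF_scale r) (fun _ : 'I_r => smooth_xi_circ rho)
    (fun _ a => ccont_on_xi_weight n r a rho2).
  transitivity (frakF_scale r * weight_sum (fun (_ : 'I_r) a =>
      cintegral (xi_circ rho) (fun z => xi_coord z ^+ a * xi_weight n r z))).
    by apply: (etrans _ H); apply: eq_mcintegral => z _; exact: frakFE.
  congr (_ * _); rewrite -weight_sumZ; apply: eq_weight_sum => _ a.
  exact: cintegral_xi_weight.
have cD (k : 'I_r1) (l : 'I_r2) b : ccont_on (xi_circ 2) (fun z =>
    cintegral (xi_circ 1) (fun w => xi_coord w ^+ b * xi_weight n2 r2 w *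
      (- z * (z - w)^-1))).
  move=> s s01; under [X in ccont X]eq_fun do rewrite xi_inner.
  by apply: ccvgM; [exact: ccvg_cst|exact: ccont_eps_inner_circ].
have H := mcintegral_kernel (frakF_scale r1) (frakF_scale r2)
  (kappa := fun z w => - z * (z - w)^-1)
  (fun _ : 'I_r1 => smooth_xi_circ 2) (fun _ : 'I_r2 => smooth_xi_circ 1)
  (fun _ a => ccont_on_xi_weight n1 r1 a i2) (fun _ b => ccont_on_xi_weight n2 r2 b i1)
  (fun _ _ b s _ => ccont_xi_kernel b s) cD.
have N : mcintegral (fun _ : 'I_r1 => xi_circ 2) (fun z : 'I_r1 -> C =>
      mcintegral (fun _ : 'I_r2 => xi_circ 1) (fun w : 'I_r2 -> C =>
    - (\sum_(k < r1) \sum_(l < r2) z k / (z k - w l)) *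
      frakF (L * T) n1 z * frakF (L * T) n2 w)) =
    frakF_scale r1 * frakF_scale r2 * (xi_factor n1 ^+ r1 * xi_factor n2 ^+ r2 * L%:C *
      kernel_sum (fun (_ : 'I_r1) a => eps_moment T n1 r1 2 e a)
        (fun (_ : 'I_r2) b => eps_moment T n2 r2 1 e b)
        (fun _ _ a b => eps_double T n1 r1 n2 r2 e a b)).
  apply: (etrans _ (etrans H _)).
    apply: eq_mcintegral => z _; apply: eq_mcintegral => w _.
    rewrite !frakFE; congr (_ * _ * _); rewrite -sumrN; apply: eq_bigr => k _.
    by rewrite -sumrN; apply: eq_bigr => l _; rewrite mulNr.
  congr (_ * _); rewrite -kernel_sumZ; apply: eq_kernel_sum => [_ a|_ b|_ _ a b].
  - exact: cintegral_xi_weight.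
  - exact: cintegral_xi_weight.
  - exact: xi_double.
rewrite /xi_cov N (W _ _ _ i2) (W _ _ _ i1) /eps_cov.
move: (kernel_sum _ _ _) (weight_sum _) (weight_sum _) => K W1 W2.
have f1 := frakF_scale_neq0 r1; have f2 := frakF_scale_neq0 r2.
have x1 : xi_factor n1 ^+ r1 != 0 by rewrite expf_neq0// xi_factor_neq0.
have x2 : xi_factor n2 ^+ r2 != 0 by rewrite expf_neq0// xi_factor_neq0.
move: (frakF_scale r1) (frakF_scale r2) (_ ^+ r1) (_ ^+ r2) f1 f2 x1 x2.
move=> f1 f2 x1 x2 f10 f20 x10 x20.
rewrite [X in _ / X](_ : _ = (f1 * f2 * (x1 * x2)) * (W2 * W1)); last by ring.
rewrite [X in X / _](_ : _ = (f1 * f2 * (x1 * x2)) * (L%:C * K)); last by ring.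
have nz : f1 * f2 * (x1 * x2) != 0 by rewrite !mulf_neq0.
by rewrite -mulf_div divff// mul1r mulrA.
Qed.

End Kernel.
End XiCovariance.

(** * Normal laws as affine images of the standard one *)

Section NormalLaws.
Variable R : realType.
Local Notation mu := (@lebesgue_measure R).
Implicit Types (m s x z : R) (g : R -> R).

(** The Radon-Nikodym derivative agrees with the density almost everywhere. *)
Lemma integral_normal_prob m s (f : R -> \bar R) : s != 0 ->
  (forall x, 0 <= f x)%E -> measurable_fun [set: measurableTypeR R] f ->
  (\int[normal_prob m s]_x f x = \int[mu]_x (f x * (normal_pdf m s x)%:E))%E.
Proof.
move=> s0 f0 mf; have dom := normal_prob_dominates m s.
rewrite -(Radon_Nikodym_SigmaFinite.change_of_variables (mu := mu) dom f0 _ mf)//.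
have mRN := measurable_int _ (Radon_Nikodym_SigmaFinite.f_integrable (mu := mu) dom).
have mpdf : measurable_fun [set: measurableTypeR R] (fun x => (normal_pdf m s x)%:E).
  by apply/measurable_EFinP; exact: measurable_normal_pdf.
apply: ae_eq_integral => //; [exact: emeasurable_funM..|].
apply: ae_eqe_mul2l; apply: integral_ae_eq => //.
- exact: Radon_Nikodym_SigmaFinite.f_integrable.
- by move=> A _ mA; rewrite -Radon_Nikodym_SigmaFinite.f_integral.
Qed.

Lemma normal_pdf_affine m s z : 0 < s ->
  normal_pdf m s (m + s * z) * s = normal_pdf 0 1 z.
Proof.
move=> s0; rewrite !normal_pdfE ?gt_eqF// /normal_peak /normal_fun subr0 addrC addKr.
have -> : - (s * z) ^+ 2 / (s ^+ 2 *+ 2) = - z ^+ 2 / (1 ^+ 2 *+ 2).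
  by field; rewrite gt_eqF.
rewrite -mulrnAr sqrtrM ?sqr_ge0// sqrtr_sqr gtr0_norm// expr1n mul1r invfM.
by rewrite mulrC !mulrA mulfV ?mul1r// gt_eqF.
Qed.

Lemma ge0_integral_normal_affine m s g : 0 < s -> continuous g -> (forall x, 0 <= g x) ->
  (\int[normal_prob m s]_x (g x)%:E = \int[normal_prob 0 1]_z (g (m + s * z))%:E)%E.
Proof.
move=> s0 cg g0.
have caff : continuous (fun z => m + s * z).
  by move=> z; apply: cvgD; [exact: cvg_cst|apply: cvgM; [exact: cvg_cst|exact: cvg_id]].
have cga : continuous (fun z => g (m + s * z)).
  by move=> z; apply: continuous_comp; [exact: caff|exact: cg].
have mE (h : R -> R) : continuous h -> measurable_fun [set: measurableTypeR R] (EFin \o h).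
  by move=> ch; apply/measurable_EFinP; exact: continuous_measurable_fun.
rewrite integral_normal_prob ?gt_eqF//; last exact: mE.
have H1 := @integral_normal_prob 0 1 (fun z => (g (m + s * z))%:E) (oner_neq0 R)
  (fun z => g0 (m + s * z)) (mE _ cga).
apply: (etrans _ (esym H1)).
pose F z := m + s * z; pose G x := g x * normal_pdf m s x.
have dF z : is_derive z 1 F s.
  by rewrite /F; apply: is_derive_eq; rewrite /GRing.scale/=; ring.
have F'E : derive1 F = cst s.
  by apply/funext => z; rewrite derive1E; have [_ ->] := dF z.
transitivity (\int[mu]_x (G x)%:E)%E; first by apply: eq_integral => x _; rewrite EFinM.
rewrite (@increasing_ge0_integration_by_substitutionT R F G).
- apply: eq_integral => z _; rewrite F'E /G /= -EFinM; congr (_%:E).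
  by rewrite -(normal_pdf_affine m z s0) mulrA.
- by move=> x y xy; rewrite /F ltrD2l ltr_pM2l.
- by rewrite F'E => x; exact: cvg_cst.
- by rewrite F'E; exact: is_cvg_cst.
- by rewrite F'E; exact: is_cvg_cst.
- by move=> z; have [] := dF z.
- apply/cvgrNyPle => A; near=> z.
  rewrite /F -lerBrDl -ler_pdivlMl// mulrC; near: z; exact: nbhs_ninfty_le.
- apply/cvgryPge => A; near=> z.
  rewrite /F -lerBlDl -ler_pdivrMl// mulrC; near: z; exact: nbhs_pinfty_ge.
- move=> x; apply: cvgM; first exact: cg.
  by apply: continuous_normal_pdf; rewrite gt_eqF.
- by move=> x; rewrite mulr_ge0 ?normal_pdf_ge0.
Unshelve. all: by end_near. Qed.

Lemma normal_lawN m s : @normal_law R m (- s) = normal_law m s.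
Proof.
rewrite /normal_law oppr_eq0; case: (s == 0); apply/funext => A; first by [].
rewrite /normal_prob; apply: eq_integral => x _.
by rewrite /normal_pdf oppr_eq0 /normal_peak /normal_fun sqrrN.
Qed.

Section Law.
Context d (W : measurableType d) (P : probability W R) (Y : W -> R) (m s : R).
Hypothesis mY : measurable_fun setT Y.
Hypothesis s_ge0 : 0 <= s.
Hypothesis lawY : forall A : set R, measurable A -> P (Y @^-1` A) = normal_law m s A.

Lemma ge0_integral_normal_law g : continuous g -> (forall x, 0 <= g x) ->
  (\int[P]_w (g (Y w))%:E = \int[normal_prob 0 1]_z (g (m + s * z))%:E)%E.
Proof.
move=> cg g0.
have mg : measurable_fun [set: measurableTypeR R] (EFin \o g).
  by apply/measurable_EFinP; exact: continuous_measurable_fun.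
have mY' : @measurable_fun _ _ W (measurableTypeR R) setT Y by exact: mY.
pose Ym : {RV P >-> measurableTypeR R} := @mfun_Sub _ _ W (measurableTypeR R) Y (mem_set mY').
have := @ge0_integral_distribution _ _ _ _ _ P Ym (EFin \o g) mg g0.
rewrite /= => <-.
have [s0|s0] := eqVneq s 0.
  transitivity (\int[\d_ (m : measurableTypeR R)]_(x in setT) (g x)%:E)%E.
    apply: eq_measure_integral => A mA _; apply: (etrans (lawY mA)).
    by rewrite /normal_law s0 eqxx.
  rewrite integral_dirac// diracT mul1e.
  transitivity (\int[normal_prob 0 1]_z cst (g m)%:E z)%E; last first.
    by apply: eq_integral => z _; rewrite s0 mul0r addr0.
  rewrite integral_cst// -[LHS]mule1; congr (_ * _)%E.
  exact/esym/integral_normal_pdf.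
rewrite -ge0_integral_normal_affine//; last by rewrite lt_def s0.
apply: eq_measure_integral => A mA _; apply: (etrans (lawY mA)).
by rewrite /normal_law (negbTE s0).
Qed.

End Law.

Local Notation gamma := (normal_prob (0 : R) 1).

(** Comparison with the normal density of variance 2, by [t <= exp t] for
[t = z ^ 2 / 4]. *)
Lemma integrable_sqr_normal : gamma.-integrable setT (fun z => (z ^+ 2)%:E).
Proof.
have csq : continuous (fun z : R => z ^+ 2) by exact: sqr_continuous.
have msq : measurable_fun [set: measurableTypeR R] (fun z : R => (z ^+ 2)%:E).
  by apply/measurable_EFinP; exact: continuous_measurable_fun.
apply/integrableP; split => //.
under eq_integral do rewrite abse_EFin ger0_norm ?sqr_ge0//.
rewrite integral_normal_prob//; last by move=> z; rewrite lee_fin sqr_ge0.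
pose q : R := Num.sqrt 2.
have q2 : q ^+ 2 = 2 by rewrite sqr_sqrtr.
have q0 : q != 0 by rewrite gt_eqF// sqrtr_gt0.
have H z : z ^+ 2 * normal_pdf 0 1 z <= 4 * (normal_peak 1 / normal_peak q) * normal_pdf 0 q z.
  rewrite !normal_pdfE// /normal_fun !subr0 q2 expr1n.
  have pq := normal_peak_gt0 q0.
  rewrite mulrCA [leRHS](_ : _ = normal_peak 1 * (4 * expR (- z ^+ 2 / (2 *+ 2))));
    last by field; rewrite gt_eqF.
  rewrite ler_pM2l ?normal_peak_gt0//.
  pose t := z ^+ 2 / 4.
  have -> : - z ^+ 2 / (1 *+ 2) = - t - t by rewrite /t; field.
  have -> : - z ^+ 2 / (2 *+ 2) = - t by rewrite /t; field.
  have -> : z ^+ 2 = 4 * t by rewrite /t; field.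
  rewrite expRD -mulrA ler_pM2l// mulrA ler_piMl ?expR_ge0//.
  rewrite expRN ler_pdivrMr ?expR_gt0// mul1r.
  by rewrite (le_trans _ (expR_ge1Dx t))// lerDr.
apply: (@le_lt_trans _ _ (\int[mu]_z
    ((4 * (normal_peak 1 / normal_peak q))%:E * (normal_pdf 0 q z)%:E))%E).
  apply: ge0_le_integral => //.
  - by move=> z _; rewrite -EFinM lee_fin mulr_ge0 ?sqr_ge0 ?normal_pdf_ge0.
  - by apply: emeasurable_funM => //; apply/measurable_EFinP; exact: measurable_normal_pdf.
  - by apply: emeasurable_funM => //; apply/measurable_EFinP; exact: measurable_normal_pdf.
  - by move=> z _; rewrite -!EFinM lee_fin.
rewrite integralZl//; last exact: integrable_normal_pdf.
by rewrite integral_normal_pdf mule1 ltry.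
Qed.

Lemma bounded_integrable d (W : measurableType d) (P : probability W R) (f : W -> R) (M : R) :
  measurable_fun setT f -> (forall w, `|f w| <= M) -> P.-integrable setT (EFin \o f).
Proof.
move=> mf fM; apply: (le_integrable measurableT (g := cst M%:E)).
- exact/measurable_EFinP.
- by move=> w _ /=; rewrite lee_fin (le_trans (fM w))// ler_norm.
- apply/integrableP; split => //.
  by rewrite /= integral_cst//= probability_setT mule1 ltry.
Qed.

Lemma integrable_normal_affine_sqr m s :
  gamma.-integrable setT (fun z => ((m + s * z) ^+ 2)%:E).
Proof.
have caff : continuous (fun z : R => (m + s * z) ^+ 2).
  move=> z; apply: (@continuous_comp _ _ _ (fun z : R => m + s * z) (fun x => x ^+ 2)).
    by apply: cvgD; [exact: cvg_cst|apply: cvgM; [exact: cvg_cst|exact: cvg_id]].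
  exact: sqr_continuous.
have ig : gamma.-integrable setT
    (fun z => (2 * m ^+ 2)%:E + (2 * s ^+ 2)%:E * (z ^+ 2)%:E)%E.
  apply: integrableD => //; last by apply: integrableZl => //; exact: integrable_sqr_normal.
  exact: (@bounded_integrable _ _ gamma (cst (2 * m ^+ 2)) `|2 * m ^+ 2|).
apply: (le_integrable measurableT _ _ ig).
  by apply/measurable_EFinP; exact: continuous_measurable_fun.
move=> z _ /=; rewrite -?EFinM -?EFinD ?abse_EFin lee_fin !ger0_norm ?sqr_ge0//.
  by have := sqr_ge0 (m - s * z); nra.
by have := sqr_ge0 m; have := sqr_ge0 (s * z); nra.
Qed.

Lemma integrable_normal_affine m s : gamma.-integrable setT (fun z => (m + s * z)%:E).
Proof.
have c1 : continuous (fun z : R => m + s * z).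
  by move=> z; apply: cvgD; [exact: cvg_cst|apply: cvgM; [exact: cvg_cst|exact: cvg_id]].
have ig : gamma.-integrable setT (fun z => 1%:E + ((m + s * z) ^+ 2)%:E)%E.
  apply: integrableD => //; last exact: integrable_normal_affine_sqr.
  by apply: (@bounded_integrable _ _ gamma (cst 1) 1) => // z; rewrite normr1.
apply: (le_integrable measurableT _ _ ig).
  by apply/measurable_EFinP; exact: continuous_measurable_fun.
move=> z _ /=; rewrite -?EFinD ?abse_EFin lee_fin [leRHS]ger0_norm.
  move: (m + s * z) => x; have := sqr_ge0 (x + 1); have := sqr_ge0 (x - 1).
  by have := sqr_ge0 x; rewrite ler_norml => *; apply/andP; split; nra.
by rewrite addr_ge0// sqr_ge0.
Qed.

Section Law.
Context d (W : measurableType d) (P : probability W R) (Y : W -> R) (m s : R).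
Hypothesis mY : measurable_fun setT Y.
Hypothesis s_ge0 : 0 <= s.
Hypothesis lawY : forall A : set R, measurable A -> P (Y @^-1` A) = normal_law m s A.

(** Both [|g|] and [|g| + g] are nonnegative, so that [ge0_integral_normal_law]
applies to them. *)
Lemma Rintegral_normal_law g : continuous g ->
  gamma.-integrable setT (fun z => (g (m + s * z))%:E) ->
  P.-integrable setT (fun w => (g (Y w))%:E) /\
  (\int[P]_w g (Y w) = \int[gamma]_z g (m + s * z)).
Proof.
move=> cg ig.
have mg : measurable_fun setT (fun w => g (Y w)).
  by apply: (measurableT_comp _ mY); exact: continuous_measurable_fun.
have cn : continuous (fun x => `|g x|).
  by move=> x; apply: continuous_comp; [exact: cg|exact: norm_continuous].
have cp : continuous (fun x => `|g x| + g x).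
  by move=> x; apply: cvgD; [exact: cn|exact: cg].
have En := ge0_integral_normal_law mY s_ge0 lawY cn (fun x => normr_ge0 (g x)).
have p0 x : 0 <= `|g x| + g x by rewrite -[g x in X in _ <= _ + X]opprK subr_ge0 -normrN ler_norm.
have Ep := ge0_integral_normal_law mY s_ge0 lawY cp p0.
have iY : P.-integrable setT (fun w => (g (Y w))%:E).
  apply/integrableP; split; first exact/measurable_EFinP.
  under eq_integral do rewrite abse_EFin.
  rewrite En; case/integrableP: ig => _.
  by under eq_integral do rewrite abse_EFin.
split=> //.
have inY : P.-integrable setT (fun w => `|g (Y w)|%:E) by exact: integrable_norm.
have ing : gamma.-integrable setT (fun z => `|g (m + s * z)|%:E) by exact: integrable_norm.
have := congr1 fine Ep; rewrite -!/(Rintegral _ _ _) !RintegralD//.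
by have := congr1 fine En; rewrite -!/(Rintegral _ _ _) => -> /addrI.
Qed.

End Law.
End NormalLaws.

(** * Characteristic functions of centered Gaussian variables *)

Section GaussianCharacteristic.
Variable R : realType.
Local Notation gamma := (normal_prob (0 : R) 1).
Implicit Types (m s v b z : R).

(** The mean 0 and the variance 1 of the standard law, kept as integrals. *)
Definition gmean : R := \int[gamma]_z z.
Definition gvar : R := \int[gamma]_z (z - gmean) ^+ 2.

(** [E (cos (Y + b))] for a centered Gaussian [Y] of variance [v]. *)
Definition gauss_cos v b : R :=
  \int[gamma]_z cos (Num.sqrt (v / gvar) * (z - gmean) + b).

Let integrable_id : gamma.-integrable setT (fun z : R => z%:E).
Proof.
have := integrable_normal_affine (0 : R) 1.
by apply: eq_integrable => // z _; rewrite add0r mul1r.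
Qed.

Let integrable_csqr : gamma.-integrable setT (fun z => ((z - gmean) ^+ 2)%:E).
Proof.
have := integrable_normal_affine_sqr (- gmean) 1.
by apply: eq_integrable => // z _; rewrite mul1r addrC.
Qed.

Lemma gvar_gt0 : 0 < gvar.
Proof.
rewrite lt_def Rintegral_ge0 ?andbT; last by move=> z _; exact: sqr_ge0.
apply/negP => /eqP V0.
have I0 : (\int[gamma]_z `|((z - gmean) ^+ 2)%:E| = 0)%E.
  under eq_integral do rewrite abse_EFin ger0_norm ?sqr_ge0//.
  have := integrable_fin_num measurableT integrable_csqr.
  by move=> /fineK <-; congr (_%:E).
have mf := measurable_int _ integrable_csqr.
have [N [mN N0 NP]] := (ae_eq_integral_abs gamma measurableT mf).1 I0.
have sub : [set: R] `<=` N `|` [set gmean].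
  move=> z _; have [->|zg] := eqVneq z gmean; first by right.
  left; apply: NP => /= /(_ I) /eqP; rewrite eqe sqrf_eq0 subr_eq0.
  by rewrite (negbTE zg).
have g1 : gamma [set gmean] = 0%E.
  by rewrite /normal_prob integral_set1.
have : (gamma setT <= gamma N + gamma [set gmean])%E.
  apply: (@le_trans _ _ (gamma (N `|` [set gmean]))).
    apply: le_measure => //; rewrite inE; first exact: measurableT.
    by apply: measurableU => //; exact: measurable_set1.
  by apply: measureU2 => //; exact: measurable_set1.
have -> : gamma setT = 1%E by exact: integral_normal_pdf.
by rewrite N0 g1 adde0 lee_fin ler10.
Qed.

(** Dominated convergence: the integrand is bounded by 1. *)
Lemma gauss_cos_continuous b : continuous (gauss_cos ^~ b).
Proof.
move=> v; pose f s z := cos (s * (z - gmean) + b) : R.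
pose F s := \int[gamma]_z f s z.
have cf2 s : continuous (f s).
  move=> z; apply: (@continuous_comp _ _ _ (fun z => s * (z - gmean) + b) cos);
    last exact: continuous_cos.
  apply: cvgD; last exact: cvg_cst.
  by apply: cvgM; [exact: cvg_cst|apply: cvgB; [exact: cvg_id|exact: cvg_cst]].
have cF s0 : {for s0, continuous F}.
  have : {in `]s0 - 1, s0 + 1[%classic, continuous F}.
    apply: (@continuity_under_integral R _ _ gamma f setT measurableT (s0 - 1) (s0 + 1)
      _ _ (cst 1)).
    - move=> s _; apply: (@bounded_integrable R _ _ gamma _ 1).
        exact: continuous_measurable_fun.
      by move=> z; rewrite ler_norml cos_geN1 cos_le1.
    - apply: aeW => z _ s _.
      apply: (@continuous_comp _ _ _ (fun s => s * (z - gmean) + b) cos);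
        last exact: continuous_cos.
      apply: cvgD; last exact: cvg_cst.
      by apply: cvgM; [exact: cvg_id|exact: cvg_cst].
    - by apply: (@bounded_integrable R _ _ gamma (cst 1) 1) => // z; rewrite normr1.
    - by move=> s _; apply: aeW => z _; rewrite ler_norml cos_geN1 cos_le1.
  apply; rewrite inE/= in_itv/=; apply/andP; split; first by rewrite ltrBlDr ltrDl.
  by rewrite ltrDl.
apply: (@continuous_comp _ _ _ (fun v => Num.sqrt (v / gvar)) F); last exact: cF.
apply: (@continuous_comp _ _ _ (fun v => v / gvar) Num.sqrt); last exact: sqrt_continuous.
by apply: cvgM; [exact: cvg_id|exact: cvg_cst].
Qed.

Section Law.
Context d (W : measurableType d) (P : probability W R) (Y : W -> R).
Hypothesis mY : measurable_fun setT Y.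
Hypothesis lawY : exists m s : R, forall A : set R, measurable A ->
  P (Y @^-1` A) = normal_law m s A.

Let law_ge0 : exists m s : R, 0 <= s /\ forall A : set R, measurable A ->
  P (Y @^-1` A) = normal_law m s A.
Proof.
have [m [s L]] := lawY; have [s0|/ltW s0] := leP 0 s; first by exists m, s.
by exists m, (- s); split; [rewrite oppr_ge0|move=> A /L ->; rewrite normal_lawN].
Qed.

Lemma gaussian_integrable_sqr : P.-integrable setT (fun w => (Y w ^+ 2)%:E).
Proof.
have [m [s [s0 L]]] := law_ge0.
have [] // := @Rintegral_normal_law R _ _ P Y m s mY s0 L (fun x => x ^+ 2).
- exact: sqr_continuous.
- exact: integrable_normal_affine_sqr.
Qed.

(** The law of [Y] is that of [m + s Z] with [Z] standard normal; the vanishing mean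
gives [m = - s gmean], and then the variance is [s ^ 2 * gvar]. *)
Lemma gaussian_cos b : \int[P]_w Y w = 0 ->
  \int[P]_w cos (Y w + b) = gauss_cos (\int[P]_w (Y w ^+ 2)) b.
Proof.
have [m [s [s0 L]]] := law_ge0 => EY.
have law := @Rintegral_normal_law R _ _ P Y m s mY s0 L.
have mE : m = - (s * gmean).
  have [_ E1] := law id (fun x => cvg_id) (integrable_normal_affine m s).
  move: EY; rewrite E1 RintegralD//.
  - rewrite (_ : \int[gamma]_z cst m z = m); last first.
      rewrite Rintegral_cst// -[RHS]mulr1; congr (_ * _).
      exact: (congr1 fine (integral_normal_pdf 0 1)).
    by rewrite RintegralZl// => /eqP; rewrite addr_eq0 => /eqP.
  - by apply: (@bounded_integrable R _ _ gamma (cst m) `|m|).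
  - exact: (integrableZl measurableT s integrable_id).
have [_ E2] := law _ (@sqr_continuous R) (integrable_normal_affine_sqr m s).
have V : \int[P]_w (Y w ^+ 2) = s ^+ 2 * gvar.
  rewrite E2 -RintegralZl//; apply: eq_Rintegral => z _.
  by rewrite mE; ring.
have cc : continuous (fun x : R => cos (x + b)).
  move=> x; apply: (@continuous_comp _ _ _ (fun x : R => x + b) cos);
    last exact: continuous_cos.
  by apply: cvgD; [exact: cvg_id|exact: cvg_cst].
have [|_ E3] := law _ cc.
  apply: (@bounded_integrable R _ _ gamma _ 1).
    apply: (measurableT_comp (continuous_measurable_fun cc)).
    apply: continuous_measurable_fun => z.
    by apply: cvgD; [exact: cvg_cst|apply: cvgM; [exact: cvg_cst|exact: cvg_id]].
  by move=> z; rewrite ler_norml cos_geN1 cos_le1.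
rewrite E3 V /gauss_cos mulfK ?gt_eqF ?gvar_gt0// sqrtr_sqr ger0_norm//.
by apply: eq_Rintegral => z _; congr cos; rewrite mE; ring.
Qed.

End Law.
End GaussianCharacteristic.

(** * Continuous functions of finitely many real variables *)

Section FiniteProduct.
Variables (R : realType) (I : finType).
Implicit Types (x y : I -> R) (e : R).

Definition box x e : set (I -> R) := [set y | forall i, `|x i - y i| < e].

(** With finitely many coordinates, boxes form a base of the pointwise topology. *)
Lemma box_ptws x (A : set {ptws I -> R}) : nbhs (x : {ptws I -> R}) A ->
  exists2 e, 0 < e & box x e `<=` A.
Proof.
move=> xA; pose G : set_system {ptws I -> R} := filter_from [set e : R | 0 < e] (box x).
have FG : Filter G.
  apply: filter_from_filter; first by exists 1 => /=.
  move=> e1 e2 /= e10 e20; exists (Num.min e1 e2); first by rewrite /= lt_min e10.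
  by move=> y yb; split=> i; have := yb i; rewrite lt_min => /andP[].
have : G --> (x : {ptws I -> R}).
  apply/cvg_sup => i.
  have surj : (fun y : {ptws I -> R} => y i) @` setT = setT.
    by apply/seteqP; split=> // r _; exists (fun=> r).
  apply/cvg_image => // U xU; exists ((fun y : {ptws I -> R} => y i) @^-1` U).
    have [e /= e0 eU] := (nbhs_ballP _ _).1 xU.
    by exists e => // y yb; apply: eU; exact: yb.
  by apply/seteqP; split=> [r [y Uy <-]//|r Ur]; exists (fun=> r).
by move/(_ _ xA) => [e e0 sub]; exists e.
Qed.

Lemma nbhs_box x e : 0 < e -> nbhs (x : {ptws I -> R}) (box x e).
Proof.
move=> e0.
have : \forall y \near (x : {ptws I -> R}), forall i : I, `|x i - y i| < e.
  apply: (@filter_forall _ I (fun i (y : {ptws I -> R}) => `|x i - y i| < e) _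
    (nbhs_filter (x : {ptws I -> R}))) => i.
  have : (fun y : {ptws I -> R} => y i) @ (x : {ptws I -> R}) --> x i.
    exact: (@proj_continuous I (fun _ => R) i x).
  by move/cvgrPdist_lt => /(_ e e0).
by [].
Qed.

Lemma continuous_box (f : {ptws I -> R} -> R) x e : continuous f -> 0 < e ->
  exists2 r, 0 < r & forall y, box x r y -> `|f x - f y| < e.
Proof.
move=> cf e0; have /cvgrPdist_lt/(_ e e0)/box_ptws[r r0 xr] := cf x.
by exists r.
Qed.

(** An open set of a finite power of the line is a countable union of boxes with
rational sides. *)
Lemma continuous_measurable_finite d (W : measurableType d) (X : I -> W -> R)
    (f : {ptws I -> R} -> R) : continuous f -> (forall i, measurable_fun setT (X i)) ->
  measurable_fun setT (fun w => f (fun i => X i w)).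
Proof.
move=> cf mX; apply: (measurability _ (RGenOpens.measurableE R)).
move=> _ [_ [a [b ->] <-]]; rewrite setTI.
pose bx (q : {ffun I -> rat * rat}) : set (I -> R) :=
  [set y | forall i, ratr (q i).1 < y i < ratr (q i).2].
pose A : set (I -> R) := [set y | f y \in `]a, b[].
set B := _ @^-1` _.
suff -> : B = \bigcup_(q in [set q | bx q `<=` A])
    \bigcap_(i in [set: I]) (X i @^-1` `]ratr (q i).1, ratr (q i).2[).
  rewrite bigcup_mkcond; apply: countable_bigcupT_measurable => // q.
  case: ifP => _ //; apply: fin_bigcap_measurable => // i _.
  by rewrite -[X in measurable X]setTI; apply: mX => //; exact: measurable_itv.
apply/seteqP; split=> [w Bw|w [q qA qw]]; last first.
  by apply: (qA (fun i => X i w)) => i; have := qw i Logic.I; rewrite /= in_itv.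
pose x : I -> R := fun i => X i w.
have : nbhs (x : {ptws I -> R}) (f @^-1` `]a, b[).
  by apply: cf; apply: open_nbhs_nbhs; split; [exact: interval_open|exact: Bw].
move=> /box_ptws[e e0 xe].
have ex i : exists q : rat * rat, [/\ x i - e < ratr q.1, ratr q.1 < x i,
    x i < ratr q.2 & ratr q.2 < x i + e].
  have h1 : x i - e < x i by rewrite ltrBlDr ltrDl.
  have h2 : x i < x i + e by rewrite ltrDl.
  have [p] := rat_in_itvoo h1; have [q] := rat_in_itvoo h2.
  by rewrite !in_itv/= => /andP[? ?] /andP[? ?]; exists (p, q).
exists [ffun i => sval (cid (ex i))].
  move=> y yb; apply: xe => i; have := yb i; rewrite ffunE.
  case: cid => -[p q] /= [h1 h2 h3 h4] /andP[h5 h6].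
  by rewrite ltr_distlC; apply/andP; split; [exact: lt_trans h5|exact: lt_trans h4].
move=> i _; rewrite /= in_itv/= ffunE; case: cid => -[p q] /= [h1 h2 h3 h4].
by apply/andP; split.
Qed.

Lemma uniform_continuous_cube (f : {ptws I -> R} -> R) (a b e : R) : continuous f -> 0 < e ->
  exists2 r, 0 < r & forall x y, (forall i, a <= x i <= b) -> box x r y ->
    `|f x - f y| < e.
Proof.
move=> cf e0.
have cK : compact ([set x | forall i, `[a, b]%classic (x i)] : set {ptws I -> R}).
  exact: (@tychonoff I (fun _ => R) (fun _ => `[a, b]%classic) (fun _ => @segment_compact R a b)).
move: cK; rewrite compact_near_coveringP => cov.
have e20 : 0 < e / 2 by rewrite divr_gt0.
have : \forall r \near 0^'+, [set x | forall i, `[a, b]%classic (x i)] `<=`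
    (fun x : {ptws I -> R} => forall y, box x r y -> `|f x - f y| < e).
  apply: (cov R (0^'+) (fun r x => forall y, box x r y -> `|f x - f y| < e)) => x _.
  have [r r0 xr] := continuous_box x cf e20.
  exists (box x (r / 2), [set s | s < r / 2]).
    split => /=; first by apply: nbhs_box; rewrite divr_gt0.
    have r20 : 0 < r / 2 by rewrite divr_gt0.
    exact: (nbhs_right_lt r20).
  move=> [x' s]/= [xx' sr] y x'y.
  have h1 : `|f x - f x'| < e / 2.
    by apply: xr => i; apply: lt_trans (xx' i) _; rewrite ltr_pdivrMr// ltr_pMr// ltr1n.
  have h2 : `|f x - f y| < e / 2.
    apply: xr => i; have := xx' i; have := x'y i => h3 h4.
    rewrite -[x i](subrK (x' i)) -addrA (le_lt_trans (ler_normD _ _))// (splitr r) ltrD//.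
    exact: lt_trans h3 sr.
  rewrite (_ : f x' - f y = (f x - f y) - (f x - f x')); last by ring.
  by rewrite (le_lt_trans (ler_normB _ _))// (splitr e) ltrD.
move=> nr.
have [r [r0 rP]] : exists r : R, 0 < r /\ [set x | forall i, `[a, b]%classic (x i)] `<=`
    (fun x : {ptws I -> R} => forall y, box x r y -> `|f x - f y| < e).
  have [r] := @filter_ex _ (0^'+) _ _ (filterI (nbhs_right_gt (0 : R)) nr).
  by move=> [r0 rP]; exists r.
by exists r => // x y xab; apply: rP => i /=; rewrite in_itv/= xab.
Qed.

End FiniteProduct.

(** * Approximation by trigonometric polynomials *)

Section BernsteinWeights.
Variable R : realType.
Implicit Types (y a : R) (n m : nat) (g : nat -> R).

(** The binomial probabilities: after [n] steps, each made with probability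
[y], the walk has made [m] of them. *)
Fixpoint bern n y m : R :=
  if n is n'.+1 then
    (if m is m'.+1 then y * bern n' y m' else 0) + (1 - y) * bern n' y m
  else (m == 0%N)%:R.

Lemma bern_ge0 n y m : 0 <= y <= 1 -> 0 <= bern n y m.
Proof.
move=> /andP[y0 y1]; elim: n m => [|n ih] m /=; first exact: ler0n.
by case: m => [|m]; rewrite ?add0r ?addr_ge0// mulr_ge0// subr_ge0.
Qed.

Lemma bern_out n y m : (n < m)%N -> bern n y m = 0.
Proof.
elim: n m => [|n ih] [|m]//= nm.
by rewrite !ih ?mulr0 ?addr0// ltnW.
Qed.

Lemma bern_rec n y g :
  \sum_(m < n.+2) bern n.+1 y m * g m =
  y * (\sum_(m < n.+1) bern n y m * g m.+1) + (1 - y) * (\sum_(m < n.+1) bern n y m * g m).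
Proof.
have -> : \sum_(m < n.+1) bern n y m * g m = \sum_(m < n.+2) bern n y m * g m.
  by rewrite [RHS]big_ord_recr/= bern_out// mul0r addr0.
rewrite [LHS]big_ord_recl [X in _ + (1 - y) * X]big_ord_recl/= add0r mulrDr addrCA mulrA.
congr (_ + _).
rewrite !mulr_sumr -big_split/=; apply: eq_bigr => m _.
by rewrite /bump/= add1n; ring.
Qed.

Lemma bern_sum n y : \sum_(m < n.+1) bern n y m = 1.
Proof.
suff : \sum_(m < n.+1) bern n y m * 1 = 1.
  by move=> <-; apply: eq_bigr => m _; rewrite mulr1.
elim: n => [|n ih]; first by rewrite big_ord1 /= mulr1.
by rewrite (bern_rec n y (fun=> 1)) ih; ring.
Qed.

Lemma bern_sqr n y a :
  \sum_(m < n.+1) bern n y m * (m%:R - a) ^+ 2 = n%:R * y * (1 - y) + (n%:R * y - a) ^+ 2.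
Proof.
elim: n a => [|n ih] a; first by rewrite big_ord1 /= mul1r; ring.
rewrite (bern_rec n y (fun m => (m%:R - a) ^+ 2)) ih.
have -> : \sum_(m < n.+1) bern n y m * (m.+1%:R - a) ^+ 2 =
    n%:R * y * (1 - y) + (n%:R * y - (a - 1)) ^+ 2.
  rewrite -ih; apply: eq_bigr => m _; rewrite -natr1; congr (_ * _ ^+ 2); ring.
by rewrite -natr1; ring.
Qed.

Lemma bern_var n y : 0 <= y <= 1 ->
  \sum_(m < n.+2) bern n.+1 y m * (y - m%:R / n.+1%:R) ^+ 2 <= n.+1%:R^-1.
Proof.
move=> /andP[y0 y1]; have n0 : n.+1%:R != 0 :> R by rewrite pnatr_eq0.
have -> : \sum_(m < n.+2) bern n.+1 y m * (y - m%:R / n.+1%:R) ^+ 2 =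
    n.+1%:R ^- 2 * \sum_(m < n.+2) bern n.+1 y m * (m%:R - n.+1%:R * y) ^+ 2.
  rewrite mulr_sumr; apply: eq_bigr => m _; rewrite [RHS]mulrCA; congr (_ * _).
  by field; rewrite addrC natr1.
rewrite bern_sqr subrr expr0n addr0.
have -> : n.+1%:R ^- 2 * (n.+1%:R * y * (1 - y)) = n.+1%:R^-1 * (y * (1 - y)).
  by field; rewrite addrC natr1.
by rewrite ler_piMr ?invr_ge0// mulr_ile1 ?subr_ge0// gerBl.
Qed.

End BernsteinWeights.

Section Bernstein.
Variables (R : realType) (I : finType).
Implicit Types (x y : I -> R) (F : (I -> R) -> R).

Definition grid n (k : {ffun I -> 'I_n.+2}) : I -> R := fun i => (k i)%:R / n.+1%:R.

Definition bernstein n F y : R :=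
  \sum_(k : {ffun I -> 'I_n.+2}) F (grid k) * \prod_i bern n.+1 (y i) (k i).

Lemma bern_prod_sum n y :
  \sum_(k : {ffun I -> 'I_n.+2}) \prod_i bern n.+1 (y i) (k i) = 1.
Proof.
rewrite -(bigA_distr_bigA (fun i (m : 'I_n.+2) => bern n.+1 (y i) m)).
by rewrite big1// => i _; rewrite bern_sum.
Qed.

Lemma bern_prod_var n y i : (forall i, 0 <= y i <= 1) ->
  \sum_(k : {ffun I -> 'I_n.+2}) (\prod_j bern n.+1 (y j) (k j)) *
    (y i - grid k i) ^+ 2 <= n.+1%:R^-1.
Proof.
move=> y01; pose h (j : I) (m : 'I_n.+2) : R := bern n.+1 (y j) m *
  (if j == i then (y j - m%:R / n.+1%:R) ^+ 2 else 1).
have -> : \sum_(k : {ffun I -> 'I_n.+2}) (\prod_j bern n.+1 (y j) (k j)) *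
    (y i - grid k i) ^+ 2 = \sum_(k : {ffun I -> 'I_n.+2}) \prod_j h j (k j).
  apply: eq_bigr => k _.
  by rewrite -(prod_insert i (fun j => bern n.+1 (y j) (k j)) (fun j => (y j - grid k j) ^+ 2)).
rewrite -(bigA_distr_bigA h) (bigD1 i)//= [X in _ * X]big1 ?mulr1; last first.
  move=> j /negbTE ji; rewrite -[RHS](bern_sum n.+1 (y j)).
  by apply: eq_bigr => m _; rewrite /h ji mulr1.
by rewrite /h eqxx; exact: bern_var.
Qed.

Lemma bernstein_bounded n F y (M : R) : (forall i, 0 <= y i <= 1) ->
  (forall x, `|F x| <= M) -> `|bernstein n F y| <= M.
Proof.
move=> y01 FM; rewrite /bernstein (le_trans (ler_norm_sum _ _ _))//.
rewrite -[leRHS]mulr1 -[in leRHS](bern_prod_sum n y) mulr_sumr ler_sum// => k _.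
have p0 : 0 <= \prod_i bern n.+1 (y i) (k i) by apply: prodr_ge0 => i _; exact: bern_ge0.
by rewrite normrM [X in _ * X]ger0_norm// ler_wpM2r.
Qed.

(** The mass of the binomial law outside of the box of radius [r] is controlled
by the variance. *)
Lemma bernstein_error n F y (M e r : R) : 0 < r -> 0 <= e -> (forall i, 0 <= y i <= 1) ->
  (forall x, `|F x| <= M) -> (forall x, box y r x -> `|F y - F x| <= e) ->
  `|F y - bernstein n F y| <= e + 2 * M * #|I|%:R / r ^+ 2 / n.+1%:R.
Proof.
move=> r0 e0 y01 FM Fe; pose w (k : {ffun I -> 'I_n.+2}) := \prod_i bern n.+1 (y i) (k i).
have w0 k : 0 <= w k by apply: prodr_ge0 => i _; exact: bern_ge0.
have M0 : 0 <= M by rewrite (le_trans _ (FM y)).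
have H (x : I -> R) : `|F y - F x| <= e + 2 * M / r ^+ 2 * \sum_i (y i - x i) ^+ 2.
  have s0 : 0 <= \sum_i (y i - x i) ^+ 2 by apply: sumr_ge0 => i _; exact: sqr_ge0.
  have c0 : 0 <= 2 * M / r ^+ 2 by rewrite divr_ge0 ?sqr_ge0 ?mulr_ge0.
  have [yx|] := pselect (box y r x).
    by rewrite (le_trans (Fe x yx))// lerDl mulr_ge0.
  move=> /existsNP[i /negP]; rewrite -leNgt => ri.
  rewrite (@le_trans _ _ (2 * M))//.
    by rewrite (le_trans (ler_normB _ _))// mulr_natl mulr2n lerD.
  rewrite -[leLHS]add0r lerD// -mulrA ler_peMr ?mulr_ge0//.
  rewrite mulrC ler_pdivlMr ?exprn_gt0// mul1r.
  rewrite (bigD1 i)//= -[leLHS]addr0 lerD//.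
    by rewrite -[leRHS]real_normK ?num_real// lerXn2r ?nnegrE// ltW.
  by apply: sumr_ge0 => j _; exact: sqr_ge0.
have -> : F y - bernstein n F y = \sum_k (F y - F (grid k)) * w k.
  rewrite -[F y in LHS]mulr1 -(bern_prod_sum n y) mulr_sumr -sumrB.
  by apply: eq_bigr => k _; rewrite mulrBl.
rewrite (le_trans (ler_norm_sum _ _ _))//.
apply: (@le_trans _ _ (\sum_k (e + 2 * M / r ^+ 2 * \sum_i (y i - grid k i) ^+ 2) * w k)).
  by apply: ler_sum => k _; rewrite normrM (ger0_norm (w0 k)) ler_wpM2r.
under eq_bigr do rewrite mulrDl; rewrite big_split/= -mulr_sumr bern_prod_sum mulr1.
rewrite lerD2l; under eq_bigr do rewrite -mulrA; rewrite -mulr_sumr.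
under eq_bigr do rewrite mulr_suml; rewrite exchange_big/=.
have -> : 2 * M * #|I|%:R / r ^+ 2 / n.+1%:R =
    2 * M / r ^+ 2 * \sum_(i : I) n.+1%:R^-1.
  by rewrite sumr_const -[_ *+ #|_|]mulr_natr; ring.
rewrite ler_wpM2l ?divr_ge0 ?sqr_ge0 ?mulr_ge0//.
apply: ler_sum => i _; apply: le_trans (bern_prod_var n i y01).
by apply: ler_sum => k _; rewrite mulrC.
Qed.

(** The span of the functions [x => cos (a . x + b)]. *)
Inductive trig_poly : ((I -> R) -> R) -> Prop :=
| trig_cos (a : I -> R) (b : R) : trig_poly (fun x => cos (\sum_i a i * x i + b))
| trig_lin (c : R) u v : trig_poly u -> trig_poly v -> trig_poly (fun x => c * u x + v x).

Lemma eq_trig_poly u v : u =1 v -> trig_poly u -> trig_poly v.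
Proof. by move=> /funext ->. Qed.

Lemma trig_poly0 : trig_poly (fun=> 0).
Proof.
have t := trig_cos (fun=> 0) 0.
by apply: eq_trig_poly (trig_lin (-1) t t) => x; rewrite mulN1r addNr.
Qed.

Lemma trig_poly_cst c : trig_poly (fun=> c).
Proof.
have t := trig_cos (fun=> 0) 0; apply: eq_trig_poly (trig_lin c t trig_poly0) => x.
by rewrite big1 ?addr0 ?cos0 ?mulr1// => i _; rewrite mul0r.
Qed.

Lemma trig_polyZ c u : trig_poly u -> trig_poly (fun x => c * u x).
Proof.
by move=> t; apply: eq_trig_poly (trig_lin c t trig_poly0) => x; rewrite addr0.
Qed.

Lemma trig_polyD u v : trig_poly u -> trig_poly v -> trig_poly (fun x => u x + v x).
Proof.
by move=> tu tv; apply: eq_trig_poly (trig_lin 1 tu tv) => x; rewrite mul1r.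
Qed.

Lemma trig_polyM u v : trig_poly u -> trig_poly v -> trig_poly (fun x => u x * v x).
Proof.
move=> tu tv; elim: tu => [a b|c u1 u2 _ t1 _ t2]; last first.
  by apply: eq_trig_poly (trig_lin c t1 t2) => x; rewrite mulrDl mulrA.
elim: tv => [a' b'|c v1 v2 _ t1 _ t2]; last first.
  by apply: eq_trig_poly (trig_lin c t1 t2) => x; rewrite mulrDr mulrCA.
have t1 := trig_cos (fun i => a i + a' i) (b + b').
have t2 := trig_cos (fun i => a i - a' i) (b - b').
apply: eq_trig_poly (trig_lin 2^-1 t1 (trig_polyZ 2^-1 t2)) => x.
have -> : \sum_i (a i + a' i) * x i + (b + b') =
    (\sum_i a i * x i + b) + (\sum_i a' i * x i + b').
  by rewrite addrACA -big_split/=; congr (_ + _); apply: eq_bigr => i _; rewrite mulrDl.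
have -> : \sum_i (a i - a' i) * x i + (b - b') =
    (\sum_i a i * x i + b) - (\sum_i a' i * x i + b').
  rewrite opprD addrACA -sumrB; congr (_ + _).
  by apply: eq_bigr => i _; rewrite mulrBl.
by rewrite cosD cosB; field.
Qed.

Lemma trig_poly_sum (J : finType) (u : J -> (I -> R) -> R) : (forall j, trig_poly (u j)) ->
  trig_poly (fun x => \sum_j u j x).
Proof.
move=> tu; elim: (index_enum J) => [|j s ih].
  by apply: eq_trig_poly trig_poly0 => x; rewrite big_nil.
by apply: eq_trig_poly (trig_polyD (tu j) ih) => x; rewrite big_cons.
Qed.

Lemma trig_poly_prod (J : finType) (u : J -> (I -> R) -> R) : (forall j, trig_poly (u j)) ->
  trig_poly (fun x => \prod_j u j x).
Proof.
move=> tu; elim: (index_enum J) => [|j s ih].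
  by apply: eq_trig_poly (trig_poly_cst 1) => x; rewrite big_nil.
by apply: eq_trig_poly (trig_polyM (tu j) ih) => x; rewrite big_cons.
Qed.

(** The coordinate in which Bernstein approximation takes place: it maps
[-K, K] increasingly into [0, 1], and its powers are trigonometric. *)
Definition sin_coord (K : R) x : I -> R := fun i => (1 + sin (x i / K)) / 2.

Lemma sin_coord01 K x i : 0 <= sin_coord K x i <= 1.
Proof.
by rewrite /sin_coord; have := sin_geN1 (x i / K); have := sin_le1 (x i / K); lra.
Qed.

Lemma trig_poly_sin_coord K i : trig_poly (fun x => sin_coord K x i).
Proof.
have t := trig_cos (fun j => if j == i then K^-1 else 0) (- (pi / 2)).
apply: eq_trig_poly (trig_lin 2^-1 t (trig_poly_cst 2^-1)) => x.
rewrite (bigD1 i)//= eqxx big1 ?addr0; last by move=> j /negbTE ->; rewrite mul0r.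
by rewrite cosBpihalf [K^-1 * _]mulrC /sin_coord; field.
Qed.

Lemma trig_poly_bern K i n m : trig_poly (fun x => bern n (sin_coord K x i) m).
Proof.
have ty := trig_poly_sin_coord K i.
have ty1 : trig_poly (fun x => 1 - sin_coord K x i).
  by apply: eq_trig_poly (trig_lin (-1) ty (trig_poly_cst 1)) => x; rewrite mulN1r addrC.
elim: n m => [|n ih] m /=; first exact: trig_poly_cst.
apply: trig_polyD; last exact: trig_polyM.
by case: m => [|m]; [exact: trig_poly0|exact: trig_polyM].
Qed.

Lemma trig_poly_bernstein K n F : trig_poly (fun x => bernstein n F (sin_coord K x)).
Proof.
apply: trig_poly_sum => k; apply: trig_polyZ; apply: trig_poly_prod => i.
exact: trig_poly_bern.
Qed.

End Bernstein.

(** * Convergence in distribution from characteristic functions *)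

Section SinCoordInverse.
Variable R : realType.
Implicit Types (K t : R).

(** The inverse of [sin_coord K] in each coordinate, on the image of
[-K / 2, K / 2]; the truncation keeps away from the points where [asin] is not
continuous. *)
Definition sin_coordV K t : R :=
  K * asin (Num.max (- sin 2^-1) (Num.min (sin 2^-1) (2 * t - 1))).

Let pihalf_gt2V : 2^-1 < pi / 2 :> R.
Proof. by apply: lt_le_trans (pihalf_ge1 R); rewrite invf_lt1// ltr1n. Qed.

Let half_pihalf (t : R) : `|t| <= 2^-1 -> t \in `[(- (pi / 2)), pi / 2].
Proof.
move=> /le_lt_trans/(_ pihalf_gt2V); rewrite in_itv/= ltr_norml => /andP[h1 h2].
by rewrite !ltW.
Qed.

Let c_lt1 : sin 2^-1 < 1 :> R.
Proof.
rewrite -[ltRHS](@sin_pihalf R) ltr_sin//; first by apply: half_pihalf; rewrite ger0_norm.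
by rewrite in_itv/= lexx andbT ge0_cp// divr_ge0 ?pi_ge0.
Qed.

Let c_gt0 : 0 < sin 2^-1 :> R.
Proof.
by rewrite -[ltLHS](@sin0 R) ltr_sin ?invr_gt0//; apply: half_pihalf; rewrite ?normr0// ger0_norm.
Qed.

Let ler_sin_half (s t : R) : `|s| <= 2^-1 -> `|t| <= 2^-1 -> s <= t -> sin s <= sin t.
Proof.
move=> /half_pihalf hs /half_pihalf ht; rewrite le_eqVlt => /predU1P[->//|st].
by apply/ltW; rewrite ltr_sin.
Qed.

Lemma sin_coordV_continuous K : continuous (sin_coordV K).
Proof.
move=> t; apply: cvgM; first exact: cvg_cst.
apply: (@continuous_comp _ _ _
  (fun t => Num.max (- sin 2^-1) (Num.min (sin 2^-1) (2 * t - 1))) asin); last first.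
  apply: continuous_asin; rewrite lt_max gt_max gt_min c_lt1 ltrN2 c_lt1/= andbT.
  by rewrite ltrNl (lt_trans _ c_gt0)// oppr_lt0.
apply: (@continuous_max R R (cst (- sin 2^-1))); first exact: cvg_cst.
apply: (@continuous_min R R (cst (sin 2^-1))); first exact: cvg_cst.
by apply: cvgB; [apply: cvgM; [exact: cvg_cst|exact: cvg_id]|exact: cvg_cst].
Qed.

Lemma sin_coordK (I : finType) K (x : I -> R) i : 0 < K -> `|x i| <= K / 2 ->
  sin_coordV K (sin_coord K x i) = x i.
Proof.
move=> K0 xK; have tK : `|x i / K| <= 2^-1.
  by rewrite normrM normfV (gtr0_norm K0) ler_pdivrMr// mulrC.
have half : `|2^-1 : R| <= 2^-1 by rewrite ger0_norm.
have [h1 h2] : - sin 2^-1 <= sin (x i / K) /\ sin (x i / K) <= sin 2^-1.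
  move: (tK); rewrite ler_norml => /andP[t1 t2].
  by rewrite -sinN; split; apply: ler_sin_half => //; rewrite normrN.
rewrite /sin_coordV /sin_coord (_ : 2 * _ - 1 = sin (x i / K)); last by field.
by rewrite min_r// max_r// sinK ?half_pihalf// mulrC divfK// gt_eqF.
Qed.

End SinCoordInverse.

Section TrigApproximation.
Variables (R : realType) (I : finType).

Lemma continuous_ptws_comp (f : {ptws I -> R} -> R) (g : R -> R) : continuous f ->
  continuous g -> continuous (fun y : {ptws I -> R} => f (fun i => g (y i))).
Proof.
move=> cf cg y A /nbhs_ballP[e /= e0 eA].
have [r r0 fr] := continuous_box (fun i => g (y i)) cf e0.
have : \forall z \near (y : {ptws I -> R}), forall i : I, `|g (y i) - g (z i)| < r.
  apply: (@filter_forall _ I (fun i (z : {ptws I -> R}) => `|g (y i) - g (z i)| < r) _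
    (nbhs_filter (y : {ptws I -> R}))) => i.
  have : (fun z : {ptws I -> R} => g (z i)) @ (y : {ptws I -> R}) --> g (y i).
    apply: (@continuous_comp _ _ _ (fun z : {ptws I -> R} => z i) g); last exact: cg.
    exact: (@proj_continuous I (fun _ => R) i y).
  by move/cvgrPdist_lt => /(_ r r0).
apply: (@filterS _ _ (nbhs_filter (y : {ptws I -> R}))) => z zr.
by apply: eA; exact: fr.
Qed.

(** Trigonometric polynomials approximate a bounded continuous function on
large cubes, with an error outside of the cubes that second moments control:
in the coordinates [sin_coord K] the cube of side [K] becomes a compact subset
of the unit cube, where Bernstein polynomials converge uniformly. *)
Lemma trig_poly_approx (f : {ptws I -> R} -> R) (M e K : R) : continuous f ->
  (forall x, `|f x| <= M) -> 0 < e -> 0 < K ->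
  exists p : (I -> R) -> R, [/\ trig_poly p, (forall x, `|p x| <= M) &
    forall x, `|f x - p x| <= e + 8 * M / K ^+ 2 * \sum_i x i ^+ 2].
Proof.
move=> cf fM e0 K0; have M0 : 0 <= M by rewrite (le_trans _ (fM (fun=> 0))).
pose F (y : {ptws I -> R}) := f (fun i => sin_coordV K (y i)).
have cF : continuous F by apply: continuous_ptws_comp => //; exact: sin_coordV_continuous.
have e20 : 0 < e / 2 by rewrite divr_gt0.
have [r r0 Fr] := uniform_continuous_cube 0 1 cF e20.
pose D := 2 * M * #|I|%:R / r ^+ 2; have D0 : 0 <= D by rewrite divr_ge0 ?sqr_ge0 ?mulr_ge0.
pose n := Num.bound (D / (e / 2)).
have Dn : D / n.+1%:R <= e / 2.
  rewrite ler_pdivrMr// mulrC -ler_pdivrMr// (@le_trans _ _ n%:R) ?ler_nat// ltW//.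
  by apply: archi_boundP; rewrite divr_ge0// ltW.
exists (fun x => bernstein n F (sin_coord K x)); split.
- exact: trig_poly_bernstein.
- by move=> x; apply: bernstein_bounded => [i|y]; [exact: sin_coord01|exact: fM].
move=> x; have [xK|] := pselect (forall i, `|x i| <= K / 2).
  have -> : f x = F (sin_coord K x).
    by congr f; apply/funext => i; rewrite sin_coordK.
  apply: (@le_trans _ _ (e / 2 + e / 2)).
    apply: le_trans (_ : e / 2 + D / n.+1%:R <= _); last by rewrite lerD2l.
    apply: bernstein_error => //; [exact: ltW|by move=> i; exact: sin_coord01| |].
      by move=> y; exact: fM.
    by move=> y yb; apply/ltW/Fr => // i; exact: sin_coord01.
  rewrite -splitr lerDl mulr_ge0 ?divr_ge0 ?sqr_ge0 ?mulr_ge0//.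
  by apply: sumr_ge0 => i _; exact: sqr_ge0.
move=> /existsNP[i /negP]; rewrite -ltNge => Kx.
apply: (@le_trans _ _ (2 * M)).
  rewrite (le_trans (ler_normB _ _))// mulr_natl mulr2n lerD//.
  by apply: bernstein_bounded => [j|y]; [exact: sin_coord01|exact: fM].
have -> : 2 * M = 8 * M / K ^+ 2 * (K / 2) ^+ 2 by field; rewrite gt_eqF.
rewrite -[leLHS]add0r lerD ?(ltW e0)// ler_wpM2l ?divr_ge0 ?sqr_ge0 ?mulr_ge0//.
rewrite (bigD1 i)//= -[leLHS]addr0 lerD//.
  by rewrite -[leRHS]real_normK ?num_real// lerXn2r ?nnegrE ?divr_ge0// ltW.
by apply: sumr_ge0 => j _; exact: sqr_ge0.
Qed.

Lemma trig_poly_bounded (p : (I -> R) -> R) : trig_poly p -> exists M, forall x, `|p x| <= M.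
Proof.
elim=> [a b|c u v _ [M1 h1] _ [M2 h2]].
  by exists 1 => x; rewrite ler_norml cos_geN1 cos_le1.
exists (`|c| * M1 + M2) => x; rewrite (le_trans (ler_normD _ _))// lerD// normrM.
by rewrite ler_wpM2l.
Qed.

Lemma trig_poly_measurable d (W : measurableType d) (X : I -> W -> R) (p : (I -> R) -> R) :
  (forall i, measurable_fun setT (X i)) -> trig_poly p ->
  measurable_fun setT (fun w => p (fun i => X i w)).
Proof.
move=> mX; elim=> [a b|c u v _ mu _ mv].
  apply: (measurableT_comp (continuous_measurable_fun (@continuous_cos R))).
  apply: measurable_funD => //; apply: measurable_sum => i.
  exact: measurable_funM.
by apply: measurable_funD => //; exact: measurable_funM.
Qed.

End TrigApproximation.

Section Levy.
Variables (R : realType) (I : finType).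

Lemma integrable_Rsum d (W : measurableType d) (P : probability W R) (J : finType)
    (f : J -> W -> R) : (forall j, P.-integrable setT (fun w => (f j w)%:E)) ->
  P.-integrable setT (fun w => (\sum_j f j w)%:E).
Proof.
move=> fi; have -> : (fun w => (\sum_j f j w)%:E) = (fun w => \sum_j (f j w)%:E)%E.
  by apply/funext => w; rewrite sumEFin.
exact: integrable_sum.
Qed.

Lemma Rintegral_sum d (W : measurableType d) (P : probability W R) (J : finType)
    (f : J -> W -> R) : (forall j, P.-integrable setT (fun w => (f j w)%:E)) ->
  \int[P]_w (\sum_j f j w) = \sum_j \int[P]_w f j w.
Proof.
move=> fi; rewrite /Rintegral; under eq_integral do rewrite -sumEFin.
rewrite integral_sum// sum_fine// => j _.
exact: (integrable_fin_num measurableT (fi j)).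
Qed.

Lemma Rintegral_dist_le d (W : measurableType d) (P : probability W R) (X : I -> W -> R)
    (f p : W -> R) (M M' e c C : R) :
  (forall i, measurable_fun setT (X i)) ->
  (forall i, (\int[P]_w (X i w ^+ 2)%:E <= C%:E)%E) ->
  measurable_fun setT f -> (forall w, `|f w| <= M) ->
  measurable_fun setT p -> (forall w, `|p w| <= M') -> 0 <= c ->
  (forall w, `|f w - p w| <= e + c * \sum_i X i w ^+ 2) ->
  `|\int[P]_w f w - \int[P]_w p w| <= e + c * (#|I|%:R * C).
Proof.
move=> mX X2 mf fM mp pM c0 fp.
have intf := @bounded_integrable _ _ _ P _ _ mf fM.
have intp := @bounded_integrable _ _ _ P _ _ mp pM.
have intX i : P.-integrable setT (fun w => (X i w ^+ 2)%:E).
  apply/integrableP; split; first exact/measurable_EFinP/measurable_funX.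
  under eq_integral do rewrite gee0_abs ?lee_fin ?sqr_ge0//.
  by apply: le_lt_trans (X2 i) _; rewrite ltry.
have intS : P.-integrable setT (fun w => (\sum_i X i w ^+ 2)%:E).
  exact: integrable_Rsum.
have intS' : P.-integrable setT (fun w => (c * \sum_i X i w ^+ 2)%:E).
  exact: (integrableZl measurableT c intS).
have inte : P.-integrable setT (fun w => e%:E).
  by apply: (@bounded_integrable _ _ _ P (cst e) `|e|).
rewrite -RintegralB//.
apply: le_trans (le_normr_Rintegral measurableT (integrableB measurableT intf intp)) _.
apply: (@le_trans _ _ (\int[P]_w (e + c * \sum_i X i w ^+ 2))).
  apply: le_Rintegral => //.
  - exact: (integrable_abse (integrableB measurableT intf intp)).
  - exact: (integrableD measurableT inte intS').
rewrite RintegralD//.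
rewrite Rintegral_cst// (_ : fine (P setT) = 1) ?mulr1; last by rewrite probability_setT.
rewrite lerD2l RintegralZl// ler_wpM2l//.
rewrite Rintegral_sum//.
rewrite mulr_natl -sumr_const; apply: ler_sum => i _.
by rewrite -lee_fin fineK//; exact: (integrable_fin_num measurableT (intX i)).
Qed.

Variables (d : R -> measure_display) (W : forall L, measurableType (d L)).
Variables (P : forall L, probability (W L) R) (X : forall L, I -> W L -> R).
Arguments X : clear implicits.
Variables (d' : measure_display) (W' : measurableType d') (Q : probability W' R).
Variables (Y : I -> W' -> R) (C : R).
Hypothesis mX : forall L i, measurable_fun setT (X L i).
Hypothesis mY : forall i, measurable_fun setT (Y i).
Hypothesis X2 :
  \forall L \near +oo, forall i, (\int[P L]_w (X L i w ^+ 2)%:E <= C%:E)%E.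
Hypothesis Y2 : forall i, (\int[Q]_w (Y i w ^+ 2)%:E <= C%:E)%E.
Hypothesis cvg_cos : forall (a : I -> R) (b : R),
  \int[P L]_w cos (\sum_i a i * X L i w + b) @[L --> +oo] -->
  \int[Q]_w cos (\sum_i a i * Y i w + b).

Lemma trig_poly_cvg p : trig_poly p ->
  \int[P L]_w p (X L ^~ w) @[L --> +oo] --> \int[Q]_w p (Y ^~ w).
Proof.
elim=> [a b|c u v tu iu tv iv]; first exact: cvg_cos.
have intg e (V : measurableType e) (P' : probability V R) (Z : I -> V -> R) (q : (I -> R) -> R) :
    (forall i, measurable_fun setT (Z i)) -> trig_poly q ->
    P'.-integrable setT (fun w => (q (Z ^~ w))%:E).
  move=> mZ tq; have [M qM] := trig_poly_bounded tq.
  apply: (@bounded_integrable _ _ _ P' (fun w => q (Z ^~ w)) M) => //.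
  exact: trig_poly_measurable.
have lin e (V : measurableType e) (P' : probability V R) (Z : I -> V -> R) :
    (forall i, measurable_fun setT (Z i)) ->
    \int[P']_w (c * u (Z ^~ w) + v (Z ^~ w)) =
    c * \int[P']_w u (Z ^~ w) + \int[P']_w v (Z ^~ w).
  move=> mZ; rewrite RintegralD//; [|exact: (integrableZl measurableT c (intg _ _ _ _ _ mZ tu))|exact: intg].
  by rewrite RintegralZl//; exact: intg.
rewrite (lin _ _ Q _ mY) (_ : (fun L => \int[P L]_w _) = fun L =>
    c * \int[P L]_w u (X L ^~ w) + \int[P L]_w v (X L ^~ w)); last first.
  by apply/funext => L; exact: (lin _ _ (P L) _ (@mX L)).
by apply: cvgD => //; apply: cvgM => //; exact: cvg_cst.
Qed.

(** Levy's continuity theorem, under a bound on second moments: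
[trig_poly_approx] replaces the test function by a trigonometric polynomial,
with an error in the expectations that [X2] and [Y2] make small uniformly in [L],
and [cvg_cos] says that the expectations of the polynomial converge. *)
Lemma cvg_in_distribution_cos : cvg_in_distribution P X Q Y.
Proof.
move=> f cf [M fM].
have mfX L := continuous_measurable_finite cf (@mX L).
have mfY := continuous_measurable_finite cf mY.
have iX L : (P L).-integrable setT (fun w => (f (X L ^~ w))%:E).
  exact: (@bounded_integrable _ _ _ (P L) _ M (mfX L) (fun w => fM _)).
have iY : Q.-integrable setT (fun w => (f (Y ^~ w))%:E).
  exact: (@bounded_integrable _ _ _ Q _ M mfY (fun w => fM _)).
suff H : \int[P L]_w f (X L ^~ w) @[L --> +oo] --> \int[Q]_w f (Y ^~ w).
  have -> : ('E_Q[fun w => f (Y ^~ w)] = (\int[Q]_w f (Y ^~ w))%:E)%E.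
    by rewrite unlock /Rintegral fineK//; exact: (integrable_fin_num measurableT iY).
  rewrite (_ : (fun L => _) = (fun L => (\int[P L]_w f (X L ^~ w))%:E)); last first.
    apply/funext => L; rewrite unlock /Rintegral fineK//.
    exact: (integrable_fin_num measurableT (iX L)).
  by apply: cvg_EFin; [exact: nearW|exact: H].
have M0 : 0 <= M by rewrite (le_trans _ (fM (fun=> 0))).
have C0 : 0 <= Num.max C 0 by rewrite le_max lexx orbT.
pose D := 8 * M * (#|I|%:R * Num.max C 0).
have D0 : 0 <= D by rewrite !mulr_ge0.
apply/cvgrPdist_lt => e e0.
(* This size of the cube makes the second-moment term at most [e / 8]. *)
pose K := 1 + 8 * D / e.
have K1 : 1 <= K by rewrite lerDl divr_ge0 ?mulr_ge0// ltW.
have K0 : 0 < K by apply: lt_le_trans K1.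
have e8 : 0 < e / 8 by rewrite divr_gt0.
have [p [tp pM fp]] := trig_poly_approx cf fM e8 K0.
have DK : 8 * M / K ^+ 2 * (#|I|%:R * Num.max C 0) <= e / 8.
  have -> : 8 * M / K ^+ 2 * (#|I|%:R * Num.max C 0) = D / K ^+ 2.
    by rewrite /D; ring.
  apply: (@le_trans _ _ (D / K)).
    by rewrite ler_wpM2l// lef_pV2 ?posrE ?exprn_gt0// expr2 ler_peMl// ltW.
  rewrite ler_pdivrMr// /K mulrDr mulr1.
  have -> : e / 8 * (8 * D / e) = D by field; rewrite gt_eqF.
  by rewrite lerDr ltW.
have near_le e' (V : measurableType e') (P' : probability V R) (Z : I -> V -> R) :
    (forall i, measurable_fun setT (Z i)) ->
    (forall i, (\int[P']_w (Z i w ^+ 2)%:E <= C%:E)%E) ->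
    `|\int[P']_w f (Z ^~ w) - \int[P']_w p (Z ^~ w)| <= e / 8 + e / 8.
  move=> mZ Z2; apply: le_trans (_ : e / 8 +
      8 * M / K ^+ 2 * (#|I|%:R * Num.max C 0) <= _); last by rewrite lerD2l.
  apply: (@Rintegral_dist_le _ V P' Z (fun w => f (Z ^~ w)) (fun w => p (Z ^~ w)) M M) => //.
  - by move=> i; apply: le_trans (Z2 i) _; rewrite lee_fin le_max lexx.
  - exact: continuous_measurable_finite.
  - exact: trig_poly_measurable.
  - by rewrite divr_ge0 ?sqr_ge0 ?mulr_ge0.
have e4 : 0 < e / 4 by rewrite divr_gt0.
have /cvgrPdist_lt/(_ _ e4) := trig_poly_cvg tp.
apply: filterS2 X2 => L XL2 pL.
have h1 := near_le _ _ Q Y mY Y2; have h2 := near_le _ _ (P L) (X L) (@mX L) XL2.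
rewrite (_ : \int[Q]_w f (Y ^~ w) - \int[P L]_w f (X L ^~ w) =
  (\int[Q]_w f (Y ^~ w) - \int[Q]_w p (Y ^~ w)) +
  (\int[Q]_w p (Y ^~ w) - \int[P L]_w p (X L ^~ w)) -
  (\int[P L]_w f (X L ^~ w) - \int[P L]_w p (X L ^~ w))); last by ring.
rewrite (le_lt_trans (ler_normB _ _))//.
have -> : e = (e / 8 + e / 8) + e / 4 + (e / 8 + e / 8) + e / 4 by field.
apply: (@le_lt_trans _ _ ((e / 8 + e / 8) + e / 4 + (e / 8 + e / 8))); last by rewrite ltrDl.
by rewrite lerD// (le_trans (ler_normD _ _))// lerD// ltW.
Qed.

End Levy.

(** * Limits of positive semidefinite matrices *)

Section PositiveSemidefinite.
Variable R : realType.

Definition psd n (S : 'M[R]_n) : Prop :=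
  S^T = S /\ forall x : 'rV[R]_n, 0 <= (x *m S *m x^T) 0 0.

Lemma psd_mulmx n m (S : 'M[R]_n) (M : 'M[R]_(m, n)) : psd S -> psd (M *m S *m M^T).
Proof.
move=> [Ssym S0]; split; first by rewrite !trmx_mul trmxK Ssym mulmxA.
by move=> x; have := S0 (x *m M); rewrite trmx_mul !mulmxA.
Qed.

Lemma mx_formE n (S : 'M[R]_n) i j :
  ((delta_mx 0 i : 'rV[R]_n) *m S *m (delta_mx 0 j : 'rV[R]_n)^T) 0 0 = S i j.
Proof. by rewrite -rowE trmx_delta -colE !mxE. Qed.

Lemma psd_diag_ge0 n (S : 'M[R]_n) i : psd S -> 0 <= S i i.
Proof. by move=> [_ /(_ (delta_mx 0 i))]; rewrite mx_formE. Qed.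

(** A form that vanishes on two basis vectors takes opposite values on their sum
and on their difference. *)
Lemma psd_diag0 n (S : 'M[R]_n) : psd S -> (forall i, S i i = 0) -> S = 0.
Proof.
move=> [Ssym S0] d0; apply/matrixP => i j; rewrite mxE.
have sij : S j i = S i j by rewrite -[in LHS]Ssym mxE.
have H (t : R) : 0 <= t * S i j *+ 2.
  have := S0 (delta_mx 0 i + t *: delta_mx 0 j).
  rewrite linearD linearZ/= !mulmxDl !mulmxDr -!scalemxAl -!scalemxAr.
  have E (A1 A2 A3 A4 : 'M[R]_1) :
      (A1 + A2 + (A3 + A4)) 0 0 = A1 0 0 + A2 0 0 + (A3 0 0 + A4 0 0).
    by rewrite !mxE.
  have Z (c : R) (A : 'M[R]_1) : (c *: A) 0 0 = c * A 0 0 by rewrite mxE.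
  by rewrite E !Z !mx_formE !d0 sij !mulr0 add0r addr0 -mulr2n.
by have := H 1; have := H (-1); lra.
Qed.

(** One step of Gaussian elimination, applied to rows and columns alike. *)
Lemma psd_schur n (S : 'M[R]_(1 + n)) : psd S -> 0 < S 0 0 ->
  exists M D, [/\ M \in unitmx, psd D & S = M *m block_mx 1%:M 0 0 D *m M^T].
Proof.
move=> Spsd S00; have [Ssym _] := Spsd.
set a := S 0 0 in S00; have a0 : a != 0 by rewrite gt_eqF.
pose b := ursubmx S.
have ul : ulsubmx S = a%:M.
  by rewrite [LHS]mx11_scalar !mxE !lshift0.
have dl : dlsubmx S = b^T by rewrite /b trmx_ursub Ssym.
have SE : S = block_mx a%:M b b^T (drsubmx S) by rewrite -[LHS]submxK ul dl.
pose s := Num.sqrt a; have ss : s * s = a by rewrite -expr2 sqr_sqrtr ?ltW.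
have s0 : s != 0 by rewrite gt_eqF ?sqrtr_gt0.
pose D := drsubmx S - a^-1 *: (b^T *m b).
exists (block_mx s%:M 0 (s^-1 *: b^T) 1%:M), D; split.
- rewrite unitmxE det_lblock det_scalar1 det1 mulr1 unitfE//.
- pose U : 'M[R]_(n, 1 + n) := row_mx (- a^-1 *: b^T) 1%:M.
  suff -> : D = U *m S *m U^T by exact: psd_mulmx.
  rewrite /U [in RHS]SE mul_row_block tr_row_mx mul_row_col !mul1mx trmx1 mulmx1.
  rewrite mul_mx_scalar scalerA mulrN mulfV// scaleN1r addNr mul0mx add0r.
  by rewrite /D scaleNr mulNmx -scalemxAl addrC.
- rewrite [LHS]SE tr_block_mx !mulmx_block !(mulmx0, mul0mx, mulmx1, mul1mx, addr0, add0r).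
  rewrite !tr_scalar_mx trmx0 !(mulmx0, mul0mx, mulmx1, mul1mx, addr0, add0r).
  rewrite linearZ/= trmxK -scalar_mxM ss mul_mx_scalar mul_scalar_mx !scalerA mulfV// !scale1r.
  congr block_mx; rewrite -scalemxAl -scalemxAr scalerA /D.
  have -> : s^-1 / s = a^-1 by rewrite -ss invfM.
  by rewrite addrC subrK.
Qed.

Lemma unitmx_block1 n (M : 'M[R]_n) : M \in unitmx ->
  (block_mx 1%:M 0 0 M : 'M[R]_(1 + n)) \in unitmx.
Proof. by rewrite !unitmxE det_lblock det1 mul1r. Qed.

(** Sylvester's law of inertia, by induction: a nonzero diagonal entry is moved
to the front and split off by [psd_schur]; if there is none, the matrix is zero
by [psd_diag0]. *)
Lemma psd_congr_pid n (S : 'M[R]_n) : psd S ->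
  exists M r, [/\ M \in unitmx, (r <= n)%N & S = M *m pid_mx r *m M^T].
Proof.
elim: n S => [|n ih] S Spsd.
  exists 1%:M, 0%N; split; rewrite ?unitmx1//.
  by apply/matrixP => -[].
have [d0|] := pselect (forall i, S i i = 0).
  exists 1%:M, 0%N; split; rewrite ?unitmx1//.
  by rewrite (psd_diag0 Spsd d0) pid_mx_0 mulmx0 mul0mx.
move=> /existsNP[i /eqP Si].
have Si0 : 0 < S i i by rewrite lt_def Si psd_diag_ge0.
pose p : 'M[R]_(1 + n) := tperm_mx 0 i.
have pT : p^T = p by rewrite /p tr_tperm_mx.
have pp : p *m p = 1%:M by rewrite /p /tperm_mx -perm_mxM tperm2 perm_mx1.
have Ppsd : psd (p *m S *m p^T) by exact: psd_mulmx.
have P00 : (p *m S *m p^T) 0 0 = S i i.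
  by rewrite pT /p -xrowE -xcolE !mxE tpermL.
have [M [D [Mu Dpsd PE]]] := psd_schur Ppsd (eq_rect_r (fun x => 0 < x) Si0 P00).
have [M' [r [M'u rn DE]]] := ih D Dpsd.
pose B : 'M[R]_(1 + n) := block_mx 1%:M 0 0 M'.
exists (p *m M *m B), r.+1; split => //.
  by rewrite !unitmx_mul unitmx_perm Mu unitmx_block1.
have SE : S = p *m (p *m S *m p^T) *m p^T.
  by rewrite pT !mulmxA pp mul1mx -mulmxA pp mulmx1.
have pidE : pid_mx r.+1 = block_mx 1%:M 0 0 (pid_mx r) :> 'M[R]_(1 + n).
  apply/matrixP => j k; rewrite !mxE.
  by case: (splitP j) => j' ->; rewrite !mxE; case: (splitP k) => k' ->; rewrite !mxE ?ord1.
have DB : block_mx 1%:M 0 0 D = B *m pid_mx r.+1 *m B^T.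
  rewrite pidE /B tr_block_mx !mulmx_block.
  by rewrite !(mulmx0, mul0mx, mulmx1, mul1mx, addr0, add0r, trmx1, trmx0) -DE.
by rewrite [LHS]SE PE DB !trmx_mul !mulmxA.
Qed.

Lemma mxrank_congr_pid n (S : 'M[R]_n) M r : M \in unitmx -> (r <= n)%N ->
  S = M *m pid_mx r *m M^T -> \rank S = r.
Proof.
move=> Mu rn ->; rewrite mxrankMfree; last by rewrite row_free_unit unitmx_tr.
by rewrite -mxrank_tr trmx_mul mxrankMfree ?row_free_unit ?unitmx_tr// mxrank_tr rank_pid_mx.
Qed.

Definition mxcvg m n (S_ : R -> 'M[R]_(m, n)) (S : 'M[R]_(m, n)) : Prop :=
  forall i j, S_ L i j @[L --> +oo] --> S i j.

Lemma mxcvg_mull m n k (A : 'M[R]_(k, m)) (S_ : R -> 'M[R]_(m, n)) S :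
  mxcvg S_ S -> mxcvg (fun L => A *m S_ L) (A *m S).
Proof.
move=> h i j; rewrite mxE.
under eq_cvg do rewrite mxE.
by apply: cvg_big => [|l _]; [exact: add_continuous|apply: cvgM; [exact: cvg_cst|exact: h]].
Qed.

Lemma mxcvg_mulr m n k (A : 'M[R]_(n, k)) (S_ : R -> 'M[R]_(m, n)) S :
  mxcvg S_ S -> mxcvg (fun L => S_ L *m A) (S *m A).
Proof.
move=> h i j; rewrite mxE.
under eq_cvg do rewrite mxE.
by apply: cvg_big => [|l _]; [exact: add_continuous|apply: cvgM; [exact: h|exact: cvg_cst]].
Qed.

Lemma mxcvg_det n (S_ : R -> 'M[R]_n) S : mxcvg S_ S ->
  \det (S_ L) @[L --> +oo] --> \det S.
Proof.
move=> h; rewrite /determinant.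
apply: cvg_big => [|s _]; first exact: add_continuous.
apply: cvgM; first exact: cvg_cst.
by apply: cvg_big => [|i _]; [exact: mul_continuous|exact: h].
Qed.

Lemma psd_cvg n (S_ : R -> 'M[R]_n) S : mxcvg S_ S ->
  (\forall L \near +oo, psd (S_ L)) -> psd S.
Proof.
move=> h pS; split.
  apply/matrixP => i j; rewrite mxE; apply: (cvg_unique _ (h j i)) => //.
  apply: cvg_trans (h i j); apply: near_eq_cvg; apply: filterS pS => L [sym _].
  by rewrite -[in LHS]sym mxE.
move=> x; have /(_ 0 0) c : mxcvg (fun L => x *m S_ L *m x^T) (x *m S *m x^T).
  exact: mxcvg_mulr (mxcvg_mull h).
rewrite -(cvg_lim _ c)//; apply: limr_ge; first by apply/cvg_ex; eexists; exact: c.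
by apply: filterS pS => L [_]; exact.
Qed.

(** The rank can only drop in the limit, so that for large [L] there are enough
independent directions of [S_ L] for [A] to map onto those of [S]. *)
Lemma psd_limit n (S_ : R -> 'M[R]_n) S : mxcvg S_ S ->
  (\forall L \near +oo, psd (S_ L)) ->
  \forall L \near +oo, exists A, A *m S_ L *m A^T = S.
Proof.
move=> h pS; have [M [r [Mu rn SE]]] := psd_congr_pid (psd_cvg h pS).
(* In the coordinates where the limit is [pid_mx r], completing the principal
   block with ones gives an approximation [G] of the identity matrix. *)
pose N : 'M[R]_n := invmx M.
pose G (L : R) : 'M[R]_n := pid_mx r *m (N *m S_ L *m N^T) *m pid_mx r + copid_mx r.
have G1 : mxcvg G 1%:M.
  have : mxcvg (fun L => (pid_mx r : 'M[R]_n) *m (N *m S_ L *m N^T) *m (pid_mx r : 'M[R]_n))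
      ((pid_mx r : 'M[R]_n) *m (N *m S *m N^T) *m (pid_mx r : 'M[R]_n)).
    exact (@mxcvg_mulr _ _ _ (pid_mx r) _ _ (@mxcvg_mull _ _ _ (pid_mx r) _ _
      (@mxcvg_mulr _ _ _ N^T _ _ (@mxcvg_mull _ _ _ N _ _ h)))).
  have -> : pid_mx r *m (N *m S *m N^T) *m pid_mx r = pid_mx r :> 'M[R]_n.
    rewrite SE !mulmxA -(mulmxA _ N) mulVmx// mulmx1 -(mulmxA _ _ N^T) -trmx_mul mulVmx//.
    by rewrite trmx1 mulmx1 !pid_mx_id.
  move=> c i j; rewrite (_ : 1%:M i j = (pid_mx r : 'M[R]_n) i j + (copid_mx r) i j).
    under eq_cvg do rewrite mxE.
    by apply: cvgD; [exact: c|exact: cvg_cst].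
  have -> : (copid_mx r : 'M[R]_n) i j = 1%:M i j - (pid_mx r : 'M[R]_n) i j.
    by rewrite /copid_mx [LHS]mxE; congr (_ + _); rewrite mxE.
  by ring.
have dG : \forall L \near +oo, \det (G L) != 0.
  have := mxcvg_det G1; rewrite det1 => /cvgrPdist_lt/(_ 1 ltr01).
  by apply: filterS => L; apply: contraTneq => ->; rewrite subr0 normr1 ltxx.
apply: filterS2 pS dG => L pSL dL.
have [M0 [r0 [M0u r0n S0E]]] := psd_congr_pid pSL.
have r0E := mxrank_congr_pid M0u r0n S0E.
have rr0 : (r <= r0)%N.
  have : (n <= \rank (S_ L) + (n - r))%N.
    have rG : \rank (G L) = n by rewrite mxrank_unit// unitmxE unitfE.
    rewrite -[X in (X <= _)%N]rG.
    apply: leq_trans (mxrank_add _ _) _; rewrite rank_copid_mx// leq_add2r.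
    apply: leq_trans (mxrankM_maxl _ _) _; apply: leq_trans (mxrankM_maxr _ _) _.
    by apply: leq_trans (mxrankM_maxl _ _) _; exact: mxrankM_maxr.
  by rewrite r0E; lia.
(* Normalize [S_ L], keep [r] of its [r0] directions, and map them to [S]. *)
exists (M *m pid_mx r *m invmx M0).
rewrite S0E SE !trmx_mul !mulmxA -(mulmxA _ (invmx M0)) mulVmx// mulmx1.
rewrite -(mulmxA _ M0^T) -trmx_mul mulVmx// trmx1 mulmx1 tr_pid_mx -!mulmxA; congr (_ *m _).
by rewrite !mulmxA !mul_pid_mx; congr (pid_mx _ *m _); lia.
Qed.

End PositiveSemidefinite.

(** * Limits of centered Gaussian vectors *)

Section GaussianFamily.
Variables (R : realType) (I : finType).

(** [gaussian_vector] for functions without bundled measurability, so that it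
applies to rescaled coordinates and to linear images. *)
Definition gaussian_family d (W : measurableType d) (P : probability W R) (X : I -> W -> R) :
    Prop :=
  forall a : I -> R, exists m s : R, forall A : set R, measurable A ->
    P ((fun w => \sum_i a i * X i w) @^-1` A) = normal_law m s A.

Definition second_moment d (W : measurableType d) (P : probability W R) (X : I -> W -> R)
    i j : R := \int[P]_w (X i w * X j w).

Section Moments.
Context d (W : measurableType d) (P : probability W R) (X : I -> W -> R).
Hypothesis mX : forall i, measurable_fun setT (X i).
Hypothesis gX : gaussian_family P X.
Implicit Types (a b : I -> R).
Local Notation S := (second_moment P X).

Let mlin a : measurable_fun setT (fun w => \sum_i a i * X i w).
Proof. by apply: measurable_sum => i; exact: measurable_funM. Qed.

Lemma gaussian_family_integrable_sqr i : P.-integrable setT (fun w => (X i w ^+ 2)%:E).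
Proof.
have [m [s L]] := gX (fun j => (j == i)%:R).
apply: gaussian_integrable_sqr => //; exists m, s => A mA; rewrite -(L A mA).
congr (P _); apply/seteqP; split=> w /=; rewrite (bigD1 i)//= eqxx mul1r big1 ?addr0//;
  by move=> j /negbTE ->; rewrite mul0r.
Qed.

Lemma gaussian_family_integrableM i j : P.-integrable setT (fun w => (X i w * X j w)%:E).
Proof.
have h := integrableD measurableT (gaussian_family_integrable_sqr i)
  (gaussian_family_integrable_sqr j).
apply: le_integrable h => //; first exact/measurable_EFinP/measurable_funM.
move=> w _ /=; rewrite lee_fin normrM [leRHS]ger0_norm ?addr_ge0 ?sqr_ge0//.
rewrite -[X i w ^+ 2]real_normK ?num_real// -[X j w ^+ 2]real_normK ?num_real//.
by have := normr_ge0 (X i w); have := normr_ge0 (X j w); nra.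
Qed.

Lemma gaussian_family_integrable i : P.-integrable setT (fun w => (X i w)%:E).
Proof.
have h1 : P.-integrable setT (fun w => 1%:E) by apply: (@bounded_integrable _ _ _ P (cst 1) `|1|).
have h := integrableD measurableT h1 (gaussian_family_integrable_sqr i).
apply: le_integrable h => //; first exact/measurable_EFinP.
move=> w _ /=; rewrite lee_fin [leRHS]ger0_norm ?addr_ge0 ?sqr_ge0//.
rewrite -[X i w ^+ 2]real_normK ?num_real//.
by have := normr_ge0 (X i w); nra.
Qed.

Lemma second_moment_lin a b :
  P.-integrable setT (fun w => ((\sum_i a i * X i w) * (\sum_j b j * X j w))%:E) /\
  \int[P]_w ((\sum_i a i * X i w) * (\sum_j b j * X j w)) =
  \sum_i \sum_j a i * b j * S i j.
Proof.
have E w : (\sum_i a i * X i w) * (\sum_j b j * X j w) =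
    \sum_i \sum_j a i * b j * (X i w * X j w).
  rewrite mulr_suml; apply: eq_bigr => i _; rewrite mulr_sumr.
  by apply: eq_bigr => j _; ring.
have I2 i j : P.-integrable setT (fun w => (a i * b j * (X i w * X j w))%:E).
  exact: (integrableZl measurableT (a i * b j) (gaussian_family_integrableM i j)).
have I1 i : P.-integrable setT (fun w => (\sum_j a i * b j * (X i w * X j w))%:E).
  by apply: integrable_Rsum => j; exact: I2.
under eq_fun do rewrite E; split; first exact: integrable_Rsum.
under eq_Rintegral do rewrite E.
rewrite Rintegral_sum//; apply: eq_bigr => i _.
rewrite Rintegral_sum//; apply: eq_bigr => j _.
by rewrite RintegralZl//; exact: gaussian_family_integrableM.
Qed.

Lemma second_momentC i j : S i j = S j i.
Proof. by apply: eq_Rintegral => w _; rewrite mulrC. Qed.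

Lemma second_moment_form_ge0 a : 0 <= \sum_i \sum_j a i * a j * S i j.
Proof.
rewrite -(second_moment_lin a a).2; apply: Rintegral_ge0 => w _.
by rewrite -expr2 sqr_ge0.
Qed.

Section Centered.
Hypothesis cX : forall i, \int[P]_w X i w = 0.

Lemma gaussian_family_lin_centered a :
  P.-integrable setT (fun w => (\sum_i a i * X i w)%:E) /\
  \int[P]_w (\sum_i a i * X i w) = 0.
Proof.
have I1 i : P.-integrable setT (fun w => (a i * X i w)%:E).
  exact: (integrableZl measurableT (a i) (gaussian_family_integrable i)).
split; first exact: integrable_Rsum.
rewrite Rintegral_sum// big1// => i _.
by rewrite RintegralZl ?cX ?mulr0//; exact: gaussian_family_integrable.
Qed.

Lemma gaussian_family_cos a (b : R) :
  \int[P]_w cos (\sum_i a i * X i w + b) =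
  gauss_cos (\sum_i \sum_j a i * a j * S i j) b.
Proof.
rewrite (gaussian_cos (mlin a) (gX a)) ?(gaussian_family_lin_centered a).2//.
by rewrite -(second_moment_lin a a).2.
Qed.

Lemma gaussian_family_covariance a b :
  covariance P (fun w => \sum_i a i * X i w) (fun w => \sum_i b i * X i w) =
  (\sum_i \sum_j a i * b j * S i j)%:E.
Proof.
have E0 c : fine ('E_P[fun w => (\sum_i c i * X i w)%R])%E = 0.
  by rewrite unlock; exact: (gaussian_family_lin_centered c).2.
rewrite covariance.unlock !E0 unlock.
have [i e] := second_moment_lin a b.
rewrite -e /Rintegral fineK; last exact: (integrable_fin_num measurableT i).
by apply: eq_integral => w _; rewrite mulrfctE /= !subr0.
Qed.

End Centered.
End Moments.

Definition form_mx (S : I -> I -> R) : 'M[R]_#|I| :=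
  \matrix_(i, j) S (enum_val i) (enum_val j).

Lemma form_mx_psd (S : I -> I -> R) : (forall i j, S i j = S j i) ->
  (forall a, 0 <= \sum_i \sum_j a i * a j * S i j) -> psd (form_mx S).
Proof.
move=> Ssym S0; split; first by apply/matrixP => i j; rewrite !mxE Ssym.
move=> x; rewrite (_ : _ 0 0 = \sum_i \sum_j x 0 (enum_rank i) * x 0 (enum_rank j) * S i j)//.
rewrite mxE exchange_big/=.
rewrite (reindex _ (onW_bij _ (enum_val_bij I)))/=; apply: eq_bigr => j _.
rewrite !mxE mulr_suml (reindex _ (onW_bij _ (enum_val_bij I)))/=; apply: eq_bigr => i _.
by rewrite !mxE !enum_valK mulrAC.
Qed.

Lemma sqr_integral_le d (W : measurableType d) (P : probability W R) (X : I -> W -> R) i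
    (C : R) : (forall i, measurable_fun setT (X i)) -> gaussian_family P X ->
  second_moment P X i i <= C -> (\int[P]_w (X i w ^+ 2)%:E <= C%:E)%E.
Proof.
move=> mX gX; rewrite -lee_fin /second_moment /Rintegral fineK//.
exact: (integrable_fin_num measurableT (gaussian_family_integrableM mX gX i i)).
Qed.

(** By [psd_limit], a linear image of a single vector of the family has the
limiting covariance, and the characteristic functions of the family converge to
its characteristic function because they depend continuously on the
covariance. *)
Lemma gaussian_limit (d : R -> measure_display) (W : forall L, measurableType (d L))
    (P : forall L, probability (W L) R) (X : forall L, I -> W L -> R) (S : I -> I -> R) :
  (forall L i, measurable_fun setT (X L i)) ->
  (\forall L \near +oo, gaussian_family (P L) (X L)) ->
  (\forall L \near +oo, forall i, \int[P L]_w X L i w = 0) ->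
  (forall i j, second_moment (P L) (X L) i j @[L --> +oo] --> S i j) ->
  exists d' (W' : measurableType d') (Q : probability W' R) (Z : I -> W' -> R),
    [/\ forall i, measurable_fun setT (Z i), gaussian_family Q Z,
        forall i, \int[Q]_w Z i w = 0,
        forall i j, second_moment Q Z i j = S i j &
        cvg_in_distribution P X Q Z].
Proof.
move=> mX gX cX SX.
pose S_ L := form_mx (second_moment (P L) (X L)).
have cS : mxcvg S_ (form_mx S).
  move=> i j; rewrite mxE; under eq_cvg do rewrite mxE; exact: SX.
have pS : \forall L \near +oo, psd (S_ L).
  apply: filterS gX => L gL; apply: form_mx_psd => [i j|a]; first exact: second_momentC.
  exact: second_moment_form_ge0.
have [L0 [[gL cL] [A AS]]] := filter_ex (filterI (filterI gX cX) (psd_limit cS pS)).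
pose B j i := A (enum_rank j) (enum_rank i).
pose Z j w := \sum_i B j i * X L0 i w.
have mZ j : measurable_fun setT (Z j).
  by apply: measurable_sum => i; apply: measurable_funM => //; exact: mX.
have ZE a w : \sum_j a j * Z j w = \sum_i (\sum_j a j * B j i) * X L0 i w.
  under eq_bigr do rewrite mulr_sumr; rewrite exchange_big/=; apply: eq_bigr => i _.
  by rewrite mulr_suml; apply: eq_bigr => j _; rewrite mulrA.
have gZ : gaussian_family (P L0) Z.
  move=> a; have [m [s L]] := gL (fun i => \sum_j a j * B j i).
  exists m, s => D mD; rewrite -(L D mD); congr (P L0 _).
  by apply/seteqP; split=> w /=; rewrite ZE.
have cZ j : \int[P L0]_w Z j w = 0.
  exact: (gaussian_family_lin_centered (mX L0) gL cL (B j)).2.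
have SZ j k : second_moment (P L0) Z j k = S j k.
  rewrite /second_moment (second_moment_lin (mX L0) gL (B j) (B k)).2.
  transitivity (form_mx S (enum_rank j) (enum_rank k)); last by rewrite mxE !enum_rankK.
  rewrite -AS mxE exchange_big/= (reindex _ (onW_bij _ (enum_val_bij I)))/=.
  apply: eq_bigr => l _.
  rewrite !mxE mulr_suml (reindex _ (onW_bij _ (enum_val_bij I)))/=; apply: eq_bigr => i _.
  by rewrite !mxE /B !enum_valK mulrAC.
exists (d L0), (W L0), (P L0), Z; split => //.
pose C := 1 + \sum_i `|S i i|.
have SC i : S i i + 1 <= C.
  rewrite addrC lerD2l (bigD1 i)//= -[leLHS]addr0 lerD ?ler_norm//.
  by apply: sumr_ge0.
apply: (@cvg_in_distribution_cos _ _ _ _ P X _ _ (P L0) Z C mX mZ).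
- have : \forall L \near +oo, forall i, second_moment (P L) (X L) i i <= S i i + 1.
    apply: filter_forall => i; have /cvgrPdist_le/(_ 1 ltr01) := SX i i.
    apply: filterS => L; rewrite ler_distl => /andP[+ _].
    by rewrite lerBlDr.
  apply: filterS2 gX => L gL' h i.
  exact: (@sqr_integral_le _ _ (P L) (X L) i C (@mX L) gL' (le_trans (h i) (SC i))).
- move=> i; apply: (@sqr_integral_le _ _ (P L0) Z i C mZ gZ).
  by rewrite SZ; apply: le_trans (SC i); rewrite lerDl.
move=> a b; rewrite (gaussian_family_cos mZ gZ cZ).
have -> : \sum_i \sum_j a i * a j * second_moment (P L0) Z i j =
    \sum_i \sum_j a i * a j * S i j.
  by apply: eq_bigr => i _; apply: eq_bigr => j _; rewrite SZ.
apply: cvg_trans (_ : gauss_cos (\sum_i \sum_j a i * a j * second_moment (P L) (X L) i j) b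
    @[L --> +oo] --> _).
  apply: near_eq_cvg; apply: filterS2 gX cX => L gL' cL'.
  by rewrite (gaussian_family_cos (@mX L) gL' cL').
have cF : \sum_i \sum_j a i * a j * second_moment (P L) (X L) i j @[L --> +oo] -->
    \sum_i \sum_j a i * a j * S i j.
  apply: cvg_big => [|i _]; first exact: add_continuous.
  apply: cvg_big => [|j _]; first exact: add_continuous.
  by apply: cvgM; [exact: cvg_cst|exact: SX].
exact: (continuous_cvg _ (@gauss_cos_continuous R b _) cF).
Qed.

End GaussianFamily.

(** * Covariances of sums of top coordinates *)

Section TopSums.
Variables (R : realType) (N : nat).
Implicit Types (S : tri N -> tri N -> R) (p q : tri N) (n r : nat).

Definition top_ind n r p : R := ((level p == n) && (n - r < rank_in_level p)%N)%:R.

Definition top_form S n1 r1 n2 r2 : R :=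
  \sum_p \sum_q top_ind n1 r1 p * top_ind n2 r2 q * S p q.

Lemma top_sumE (W : Type) (X : tri N -> W -> R) n r :
  top_sum X n r = fun w => \sum_p top_ind n r p * X p w.
Proof.
apply/funext => w; rewrite /top_sum big_mkcond; apply: eq_bigr => p _.
by rewrite /top_ind; case: ifP; rewrite ?mul1r ?mul0r.
Qed.

Lemma top_formC S n1 r1 n2 r2 : (forall p q, S p q = S q p) ->
  top_form S n1 r1 n2 r2 = top_form S n2 r2 n1 r1.
Proof.
move=> Ssym; rewrite /top_form exchange_big/=; apply: eq_bigr => p _.
by apply: eq_bigr => q _; rewrite Ssym [X in X * _]mulrC.
Qed.

Lemma rank_in_level_gt0 p : (0 < rank_in_level p)%N.
Proof. by case/andP: (valP p). Qed.

Lemma rank_in_level_le p : (rank_in_level p <= level p)%N.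
Proof. by case/andP: (valP p). Qed.

Lemma level_le p : (level p <= N)%N.
Proof. by rewrite -ltnS ltn_ord. Qed.

Lemma top_ind0 n p : top_ind n 0 p = 0.
Proof.
rewrite /top_ind subn0 ltnNge; case: eqP => //= <-.
by rewrite rank_in_level_le.
Qed.

Lemma top_form0l S n1 n2 r2 : top_form S n1 0 n2 r2 = 0.
Proof.
by rewrite /top_form big1// => p _; rewrite big1// => q _; rewrite top_ind0 !mul0r.
Qed.

Lemma top_form0r S n1 r1 n2 : top_form S n1 r1 n2 0 = 0.
Proof.
by rewrite /top_form big1// => p _; rewrite big1// => q _; rewrite top_ind0 mulr0 mul0r.
Qed.

Lemma eq_tri p q : (q == p) = (level q == level p) && (rank_in_level q == rank_in_level p).
Proof.
by rewrite -val_eqE /level /rank_in_level; case: (val p) => a b; case: (val q).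
Qed.

Lemma top_ind_delta p q : (q == p)%:R =
  top_ind (level p) (level p - rank_in_level p).+1 q -
  top_ind (level p) (level p - rank_in_level p) q.
Proof.
rewrite eq_tri /top_ind; have := rank_in_level_gt0 p; have := rank_in_level_le p.
case: eqP => [_|_]; last by rewrite subrr.
move: (level p) (rank_in_level p) (rank_in_level q) => n k k' kn k0.
rewrite (_ : (n - (n - k).+1 < k')%N = (k <= k')%N); last by lia.
rewrite (_ : (n - (n - k) < k')%N = (k < k')%N); last by lia.
by case: ltngtP; rewrite ?subrr ?subr0.
Qed.

(** A coordinate is the difference of two consecutive sums of top coordinates. *)
Lemma top_form_coord S p q :
  let n := level p in let a := (n - rank_in_level p)%N in
  let m := level q in let b := (m - rank_in_level q)%N in
  S p q = top_form S n a.+1 m b.+1 - top_form S n a.+1 m b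
    - top_form S n a m b.+1 + top_form S n a m b.
Proof.
move=> n a m b.
transitivity (\sum_p' \sum_q' (p' == p)%:R * (q' == q)%:R * S p' q').
  rewrite (bigD1 p)//= [X in _ + X]big1 ?addr0; last first.
    by move=> p' /negbTE ->; rewrite big1// => q' _; rewrite !mul0r.
  rewrite (bigD1 q)//= big1 ?addr0; last by move=> q' /negbTE ->; rewrite mulr0 mul0r.
  by rewrite !eqxx !mul1r.
rewrite /top_form -!sumrB -big_split/=; apply: eq_bigr => p' _.
rewrite -!sumrB -big_split/=; apply: eq_bigr => q' _.
by rewrite !top_ind_delta -/n -/m -/a -/b; ring.
Qed.

Lemma top_form_cvg (S_ : R -> tri N -> tri N -> R) S n1 r1 n2 r2 :
  (forall p q, S_ L p q @[L --> +oo] --> S p q) ->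
  top_form (S_ L) n1 r1 n2 r2 @[L --> +oo] --> top_form S n1 r1 n2 r2.
Proof.
move=> h; apply: cvg_big => [|p _]; first exact: add_continuous.
apply: cvg_big => [|q _]; first exact: add_continuous.
by apply: cvgM; [exact: cvg_cst|exact: h].
Qed.

End TopSums.

(** * Convergence of the rescaled covariances *)

Section Limit.
Variables (R : realType) (N : nat).
Variables (d : R -> measure_display) (W : forall tau : R, measurableType (d tau)).
Variable P : forall tau : R, probability (W tau) R.
Variable xi : forall tau : R, tri N -> {RV (P tau) >-> R}.
Hypothesis xi_centered : forall tau : R, 0 < tau -> centered (xi tau).
Hypothesis xi_gaussian : forall tau : R, 0 < tau -> gaussian_vector (xi tau).
Hypothesis xi_covariance : forall tau : R, 0 < tau ->
  forall n1 n2 r1 r2 : nat,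
    (1 <= n2 <= n1)%N -> (n1 <= N)%N ->
    (1 <= r1 <= n1)%N -> (1 <= r2 <= n2)%N ->
  forall (g1 : 'I_r1 -> R -> R[i]) (g2 : 'I_r2 -> R -> R[i]),
    xi_contours g1 g2 ->
  exists c : R,
    covariance (P tau) (top_sum (xi tau) n1 r1) (top_sum (xi tau) n2 r2)
      = c%:E /\
    real_complex R c = xi_cov tau n1 n2 g1 g2.
Variable T : R.
Hypothesis T_gt0 : 0 < T.

Let X (L : R) (p : tri N) (w : W (L * T)) : R := (Num.sqrt L)^-1 * xi (L * T) p w.
Arguments X : clear implicits.
Let S L := second_moment (P (L * T)) (X L).

Lemma measurable_rescaled L p : measurable_fun setT (X L p).
Proof. by apply: measurable_funM => //; exact: measurable_funP. Qed.

Lemma gaussian_rescaled L : 0 < L -> gaussian_family (P (L * T)) (X L).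
Proof.
move=> L0 a; have [m [s H]] := xi_gaussian (mulr_gt0 L0 T_gt0) (fun p => a p / Num.sqrt L).
exists m, s => A mA; rewrite -(H A mA).
have E w : \sum_p a p * X L p w = \sum_p a p / Num.sqrt L * xi (L * T) p w.
  by apply: eq_bigr => p _; rewrite /X mulrA.
by congr (P _ _); apply/seteqP; split=> w; rewrite /= E.
Qed.

Lemma xi_Rintegral0 L p : 0 < L -> \int[P (L * T)]_w xi (L * T) p w = 0.
Proof.
move=> L0; have := xi_centered (mulr_gt0 L0 T_gt0) p.
by rewrite unlock /Rintegral => ->.
Qed.

Lemma rescaled_Rintegral0 L p : 0 < L -> \int[P (L * T)]_w X L p w = 0.
Proof.
move=> L0; have mxi q : measurable_fun setT (xi (L * T) q) by exact: measurable_funP.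
rewrite RintegralZl ?xi_Rintegral0 ?mulr0//.
exact: (gaussian_family_integrable mxi (xi_gaussian (mulr_gt0 L0 T_gt0))).
Qed.

Lemma rescaled_covariance L n1 n2 r1 r2 : 4 < L ->
  (1 <= n2 <= n1)%N -> (n1 <= N)%N -> (1 <= r1 <= n1)%N -> (1 <= r2 <= n2)%N ->
  real_complex R (top_form (S L) n1 r1 n2 r2) = eps_cov T n1 r1 n2 r2 L^-1.
Proof.
move=> L4 n21 n1N r1n r2n; have L0 : 0 < L by apply: lt_trans L4.
have LT0 := mulr_gt0 L0 T_gt0.
have [c [cE]] := xi_covariance LT0 n21 n1N r1n r2n (xi_contours_circ L4 erefl r1 r2).
rewrite (xi_cov_circ T L4 erefl) => cL.
pose S0 := second_moment (P (L * T)) (fun p => xi (L * T) p).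
have mxi p : measurable_fun setT (xi (L * T) p) by exact: measurable_funP.
have cS : c = top_form S0 n1 r1 n2 r2.
  apply: EFin_inj; rewrite -cE !top_sumE.
  apply: (gaussian_family_covariance mxi (xi_gaussian LT0)) => p.
  exact: xi_Rintegral0.
have SE p q : S L p q = L^-1 * S0 p q.
  rewrite /S /S0 /second_moment /X -RintegralZl//; last first.
    exact: (gaussian_family_integrableM mxi (xi_gaussian LT0)).
  apply: eq_Rintegral => w _; rewrite mulrACA -invfM -expr2 sqr_sqrtr//; exact: ltW.
have -> : top_form (S L) n1 r1 n2 r2 = L^-1 * c.
  rewrite cS /top_form mulr_sumr; apply: eq_bigr => p _; rewrite mulr_sumr.
  by apply: eq_bigr => q _; rewrite SE mulrCA.
rewrite rmorphM/= cL mulrA -rmorphM mulVf ?gt_eqF//.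
by rewrite rmorph1 mul1r.
Qed.

(** The limit is real as a limit of covariances. *)
Lemma top_form_limit n1 n2 r1 r2 :
  (1 <= n2 <= n1)%N -> (n1 <= N)%N -> (1 <= r1 <= n1)%N -> (1 <= r2 <= n2)%N ->
  exists2 c : R, top_form (S L) n1 r1 n2 r2 @[L --> +oo] --> c &
    real_complex R c = zeta_cov T n1 n2 (fun _ : 'I_r1 => circ 2) (fun _ : 'I_r2 => circ 1).
Proof.
move=> n21 n1N r1n r2n; case/andP: (r1n) => _ rn1; case/andP: (r2n) => _ rn2.
set z := zeta_cov _ _ _ _ _.
have L4 : \forall L \near +oo, 4 < L :> R by exact: nbhs_pinfty_gt.
have : ccvg (pinfty_nbhs R) (fun L => eps_cov T n1 r1 n2 r2 L^-1) z.
  rewrite /z -eps_cov0//; apply: ccvg_comp; last exact: eps_cov_ccont.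
  by apply/(@gtr0_cvgV0 _ _ _ _ (fun x : R => x)); [exact: nbhs_pinfty_gt|exact: cvg_id].
move=> [cRe cIm].
have E : \forall L \near +oo,
    real_complex R (top_form (S L) n1 r1 n2 r2) = eps_cov T n1 r1 n2 r2 L^-1.
  by apply: filterS L4 => L L4; exact: rescaled_covariance.
exists (complex.Re z).
  apply: cvg_trans cRe; apply: near_eq_cvg; apply: filterS E => L <-.
  by [].
have Im0 : complex.Im z = 0.
  apply: (cvg_unique _ cIm) => //; apply: cvg_near_cst.
  by apply: filterS E => L <-.
by rewrite [RHS]complexE Im0 rmorph0 mulr0 addr0.
Qed.

Lemma top_form_is_cvg n1 n2 r1 r2 :
  (1 <= n1 <= N)%N -> (1 <= n2 <= N)%N -> (r1 <= n1)%N -> (r2 <= n2)%N ->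
  exists c : R, top_form (S L) n1 r1 n2 r2 @[L --> +oo] --> c.
Proof.
move=> /andP[n10 n1N] /andP[n20 n2N].
case: r1 => [|r1] rn1; first by exists 0; under eq_cvg do rewrite top_form0l; exact: cvg_cst.
case: r2 => [|r2] rn2; first by exists 0; under eq_cvg do rewrite top_form0r; exact: cvg_cst.
have [n21|/ltnW n12] := leqP n2 n1.
  have [c cc _] := @top_form_limit n1 n2 r1.+1 r2.+1 (introT andP (conj n20 n21)) n1N rn1 rn2.
  by exists c.
have [c cc _] := @top_form_limit n2 n1 r2.+1 r1.+1 (introT andP (conj n10 n12)) n2N rn2 rn1.
exists c; apply: cvg_trans cc; apply: near_eq_cvg; apply: nearW => L.
by apply: top_formC => p q; exact: second_momentC.
Qed.

Lemma second_moment_is_cvg p q : exists c : R, S L p q @[L --> +oo] --> c.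
Proof.
have h (p' : tri N) : (1 <= level p' <= N)%N.
  by rewrite level_le andbT (leq_trans (rank_in_level_gt0 p') (rank_in_level_le p')).
have hr (p' : tri N) : ((level p' - rank_in_level p').+1 <= level p')%N.
  by have := rank_in_level_gt0 p'; have := rank_in_level_le p'; lia.
have hr' p' := ltnW (hr p').
have [c1 h1] := top_form_is_cvg (h p) (h q) (hr p) (hr q).
have [c2 h2] := top_form_is_cvg (h p) (h q) (hr p) (hr' q).
have [c3 h3] := top_form_is_cvg (h p) (h q) (hr' p) (hr q).
have [c4 h4] := top_form_is_cvg (h p) (h q) (hr' p) (hr' q).
exists (c1 - c2 - c3 + c4); under eq_cvg do rewrite top_form_coord.
by apply: cvgD => //; apply: cvgB => //; apply: cvgB.
Qed.

End Limit.

Theorem proposition5p1 (R : realType) (N : nat) (hN : (1 <= N)%N)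
  (d : R -> measure_display) (W : forall tau : R, measurableType (d tau))
  (P : forall tau : R, probability (W tau) R)
  (xi : forall tau : R, tri N -> {RV (P tau) >-> R})
  (xi_centered : forall tau : R, 0 < tau -> centered (xi tau))
  (xi_gaussian : forall tau : R, 0 < tau -> gaussian_vector (xi tau))
  (xi_covariance : forall tau : R, 0 < tau ->
    forall n1 n2 r1 r2 : nat,
      (1 <= n2 <= n1)%N -> (n1 <= N)%N ->
      (1 <= r1 <= n1)%N -> (1 <= r2 <= n2)%N ->
    forall (g1 : 'I_r1 -> R -> R[i]) (g2 : 'I_r2 -> R -> R[i]),
      xi_contours g1 g2 ->
    exists c : R,
      covariance (P tau) (top_sum (xi tau) n1 r1) (top_sum (xi tau) n2 r2)
        = c%:E /\
      real_complex R c = xi_cov tau n1 n2 g1 g2)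
  (T : R) (hT : 0 < T) :
  exists (d' : measure_display) (W' : measurableType d')
         (Q : probability W' R) (zeta : tri N -> {RV Q >-> R}),
    [/\ cvg_in_distribution (fun L : R => P (L * T))
          (fun (L : R) (p : tri N) (w : W (L * T)) =>
             (Num.sqrt L)^-1 * xi (L * T) p w)
          Q (fun p : tri N => zeta p),
        centered zeta,
        gaussian_vector zeta &
        forall n1 n2 r1 r2 : nat,
          (1 <= n2 <= n1)%N -> (n1 <= N)%N ->
          (1 <= r1 <= n1)%N -> (1 <= r2 <= n2)%N ->
        forall (g1 : 'I_r1 -> R -> R[i]) (g2 : 'I_r2 -> R -> R[i]),
          zeta_contours g1 g2 ->
        exists c : R,
          covariance Q (top_sum zeta n1 r1) (top_sum zeta n2 r2) = c%:E /\
          real_complex R c = zeta_cov T n1 n2 g1 g2].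
Proof.
have cS := second_moment_is_cvg xi_centered xi_gaussian xi_covariance hT.
pose S p q := sval (cid (cS p q)).
have SX p q := svalP (cid (cS p q)).
pose X (L : R) (p : tri N) (w : W (L * T)) : R := (Num.sqrt L)^-1 * xi (L * T) p w.
have mX L p : measurable_fun setT (@X L p) by exact: measurable_rescaled.
have L_gt0 : \forall L \near +oo, 0 < L :> R by exact: nbhs_pinfty_gt.
have gX : \forall L \near +oo, gaussian_family (P (L * T)) (@X L).
  by apply: filterS L_gt0 => L L0; exact: gaussian_rescaled.
have cX : \forall L \near +oo, forall p, \int[P (L * T)]_w X L p w = 0.
  by apply: filterS L_gt0 => L L0 p; exact: rescaled_Rintegral0.
have [d' [W' [Q [Z [mZ gZ cZ SZ cvgZ]]]]] := gaussian_limit mX gX cX SX.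
pose zeta p : {RV Q >-> R} := mfun_Sub (mem_set (mZ p)).
exists d', W', Q, zeta; split.
- exact: cvgZ.
- move=> p; have := cZ p; rewrite unlock /Rintegral => E.
  rewrite -[LHS]fineK ?E//.
  exact: (integrable_fin_num measurableT (gaussian_family_integrable mZ gZ p)).
- exact: gZ.
move=> n1 n2 r1 r2 n21 n1N r1n r2n g1 g2 g12.
have [c cc cE] :=
  top_form_limit xi_centered xi_gaussian xi_covariance hT n21 n1N r1n r2n.
exists c; split; last first.
  exact (etrans cE (zeta_cov_universal hT n1 n2 (zeta_contours_circ R r1 r2) g12)).
rewrite !top_sumE; apply: etrans (gaussian_family_covariance mZ gZ cZ _ _) _.
congr (_%:E); apply: (cvg_unique _ _ cc) => //.
have -> : \sum_p \sum_q top_ind R n1 r1 p * top_ind R n2 r2 q * second_moment Q Z p q =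
    top_form S n1 r1 n2 r2.
  by apply: eq_bigr => p _; apply: eq_bigr => q _; rewrite SZ.
exact: top_form_cvg SX.
Qed.
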